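(* Let $s\in(0,1)$ and $2<p<2/(1-s)$, let $\Omega\subset\mathbb{R}^d$ be a bounded smooth domain and $t_1<t_2$. Let $u$ be a weak supersolution and $v$ a weak subsolution of $\partial_t w+(-\Delta_p)^s w=0$ in $\Omega\times(t_1,t_2]$. Let $\mathcal K\Subset\Omega$ and $[\tau_1,\tau_2]\subset(t_1,t_2]$. Assume that $$u\ge v\quad\text{a.e. in }(\mathbb{R}^d\setminus\mathcal K)\times(\tau_1,\tau_2]\ \text{ and on }\ \mathcal K\times\{\tau_1\}.$$ Then $$u\ge v\quad\text{a.e. in }\mathcal K\times(\tau_1,\tau_2].$$
   Context: The fractional $p$-Laplacian is $$(-\Delta_p)^s u(x,t)=\mathrm{P.V.}\int_{\mathbb{R}^d}\frac{|u(x,t)-u(y,t)|^{p-2}(u(x,t)-u(y,t))}{|x-y|^{d+sp}}\,dy .$$ The tail space $L^{p-1}_{sp}(\mathbb{R}^d)$ consists of all $w:\mathbb{R}^d\to\mathbb{R}$ with $\|w\|_{L^{p-1}_{sp}(\mathbb{R}^d)}:=\bigl(\int_{\mathbb{R}^d}\frac{|w(x)|^{p-1}}{1+|x|^{d+sp}}\,dx\bigr)^{1/(p-1)}<\infty$. In spaces of the form $C_{\mathrm{loc}}(t_1,t_2;X)$, $L^q_{\mathrm{loc}}(t_1,t_2;X)$, ''loc'' refers to compact sub-intervals of $(t_1,t_2]$. $W^{s,p}_0(\mathcal K)$ denotes the functions in $W^{s,p}(\mathbb{R}^d)$ vanishing a.e. outside $\mathcal K$. A function $u:\mathbb{R}^d\times(t_1,t_2]\to\mathbb{R}$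 is a weak subsolution of $\partial_t u+(-\Delta_p)^su=0$ in $\Omega\times(t_1,t_2]$ if $$u\in C_{\mathrm{loc}}(t_1,t_2;L^2_{\mathrm{loc}}(\Omega))\cap L^p_{\mathrm{loc}}(t_1,t_2;W^{s,p}_{\mathrm{loc}}(\Omega))\cap L^\infty_{\mathrm{loc}}(t_1,t_2;L^{p-1}_{sp}(\mathbb{R}^d))$$ and for every compact $\mathcal K\subset\Omega$, every $[\tau_1,\tau_2]\subset(t_1,t_2]$ and every nonnegative $\varphi\in L^p(\tau_1,\tau_2;W^{s,p}_0(\mathcal K))\cap H^1(\tau_1,\tau_2;L^2(\mathcal K))$, $$\int_{\mathcal K}u\varphi\,dx\Big|_{\tau_1}^{\tau_2}-\int_{\tau_1}^{\tau_2}\!\!\int_{\mathcal K}u\,\partial_t\varphi\,dx\,dt+\int_{\tau_1}^{\tau_2}\mathcal E(u(\cdot,t),\varphi(\cdot,t))\,dt\le 0,$$ where $$\mathcal E(u(\cdot,t),\varphi(\cdot,t))=\iint_{\mathbb{R}^d\times\mathbb{R}^d}\frac{|u(x,t)-u(y,t)|^{p-2}(u(x,t)-u(y,t))(\varphi(x,t)-\varphi(y,t))}{|x-y|^{d+sp}}\,dy\,dx .$$ A weak supersolution satisfies the same with $\ge 0$. *)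

(* Defs.v *)
From HB Require Import structures.
From mathcomp Require Import all_boot all_order all_algebra.
From mathcomp Require Import all_classical all_reals all_analysis.

Set Implicit Arguments.
Unset Strict Implicit.
Unset Printing Implicit Defensive.

Import Order.TTheory GRing.Theory Num.Theory.
Import numFieldNormedType.Exports.

Local Open Scope classical_set_scope.
Local Open Scope ring_scope.

(* The sigma-algebra on R^n is generated by the coordinates (as for tuples in
   the library); it is the Borel one. *)
Section measurable_rV.
Context {R : realType}.
Variable n : nat.

Let coord (i : 'I_n) (x : 'rV[R]_n) : measurableTypeR R := x ord0 i.

Let rV_set0 : g_sigma_preimage coord set0.
Proof. exact: sigma_algebra0. Qed.

Let rV_setC A : g_sigma_preimage coord A -> g_sigma_preimage coord (~` A).
Proof. exact: sigma_algebraC. Qed.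

Let rV_bigcup (F : _^nat) : (forall i, g_sigma_preimage coord (F i)) ->
  g_sigma_preimage coord (\bigcup_i (F i)).
Proof. exact: sigma_algebra_bigcup. Qed.

HB.instance Definition _ := @isMeasurable.Build default_measure_display
  'rV[R]_n (g_sigma_preimage coord) rV_set0 rV_setC rV_bigcup.

Lemma measurable_rV_coord (i : 'I_n) :
  measurable_fun setT ((fun x => x ord0 i) : 'rV[R]_n -> R).
Proof.
move=> _ Y mY; rewrite setTI; apply: sub_sigma_algebra => /=.
rewrite -bigcup_seq/=; exists i => /=; first by rewrite mem_index_enum.
by exists Y => //; rewrite setTI.
Qed.

Lemma measurable_fun_rVP d (T : measurableType d) (f : T -> 'rV[R]_n) :
  (forall i, measurable_fun setT ((fun x => f x ord0 i) : T -> R)) ->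
  measurable_fun setT f.
Proof.
move=> mf.
suff prefS : g_sigma_preimage (fun i => coord i \o f) `<=` measurable.
  move=> _ A mA; rewrite setTI; apply: prefS.
  by rewrite g_sigma_preimage_comp; exists A => //; rewrite setTI.
apply: smallest_sub; first exact: sigma_algebra_measurable.
rewrite -bigcup_seq; apply: bigcup_sub => i _.
by move=> A [B mB <-]; exact: mf.
Qed.

End measurable_rV.

Section lebesgue_rV.
Context {R : realType}.

(* The measure on R^n.+1 is the product measure transported along the
   identification of R * R^n with R^n.+1. *)
Definition rV_cons n (z : measurableTypeR R * 'rV[R]_n) : 'rV[R]_n.+1 :=
  \row_i (if unlift ord0 i is Some j then z.2 ord0 j else z.1).

Definition rV_uncons n (x : 'rV[R]_n.+1) : measurableTypeR R * 'rV[R]_n :=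
  (x ord0 ord0, \row_j x ord0 (lift ord0 j)).

Lemma rV_consK n : cancel (@rV_cons n) (@rV_uncons n).
Proof.
move=> [a y]; rewrite /rV_uncons /rV_cons /= mxE unlift_none; congr pair.
by apply/rowP => j; rewrite !mxE liftK.
Qed.

Lemma measurable_rV_cons n : measurable_fun setT (@rV_cons n).
Proof.
apply: measurable_fun_rVP => i; under eq_fun do rewrite mxE.
case: unliftP => [j _|_]; last exact: measurable_fst.
exact: (measurableT_comp (measurable_rV_coord j) measurable_snd).
Qed.

Lemma measurable_rV_uncons n : measurable_fun setT (@rV_uncons n).
Proof.
apply: measurable_fun_pair; first exact: measurable_rV_coord.
apply: measurable_fun_rVP => i.
under eq_fun do rewrite mxE.
exact: measurable_rV_coord.
Qed.

Section step.
Variables (n : nat) (mu : {sigma_finite_measure set 'rV[R]_n -> \bar R}).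
Local Open Scope ereal_scope.

Definition lebesgue_rV_step : set 'rV[R]_n.+1 -> \bar R :=
  pushforward (lebesgue_measure \x mu) (@rV_cons n).

Let step_measure : {measure set 'rV[R]_n.+1 -> \bar R} :=
  @measure_function_pushforward__canonical__measure_function_Measure _ _ _ _ _
    (lebesgue_measure \x mu) (@rV_cons n) (@measurable_rV_cons n).

HB.instance Definition _ := isMeasure.Build _ _ _ lebesgue_rV_step
  (measure0 step_measure) (measure_ge0 step_measure)
  (@measure_semi_sigma_additive _ _ _ step_measure).

Let lebesgue_rV_step_sigma_finite : sigma_finite setT lebesgue_rV_step.
Proof.
have /sigma_finiteP[F [TF ndF Foo]] := sigma_finiteT (@lebesgue_measure R).
have /sigma_finiteP[G [TG ndG Goo]] := sigma_finiteT mu.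
have mFG i : measurable (F i `*` G i).
  by apply: measurableX; [exact: (Foo i).1|exact: (Goo i).1].
exists (fun i => @rV_uncons n @^-1` (F i `*` G i)).
  rewrite -preimage_bigcup (_ : \bigcup_i _ = setT) ?preimage_setT//.
  apply/seteqP; split => // -[x y] _.
  have [i _ Fix] : (\bigcup_i F i) x by rewrite -TF.
  have [j _ Gjy] : (\bigcup_i G i) y by rewrite -TG.
  exists (maxn i j) => //; split => /=.
  - by move: x Fix; exact/subsetPset/ndF/leq_maxl.
  - by move: y Gjy; exact/subsetPset/ndG/leq_maxr.
move=> i; split.
  by rewrite -[X in measurable X]setTI; exact: measurable_rV_uncons.
rewrite /lebesgue_rV_step /pushforward -comp_preimage.
rewrite (_ : _ \o _ = id) ?preimage_id; last first.
  by apply/funext => z /=; exact: rV_consK.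
have [mF Fi] := Foo i; have [mG Gi] := Goo i.
by rewrite product_measure1E// lte_mul_pinfty// ge0_fin_numE.
Qed.

HB.instance Definition _ := @Measure_isSigmaFinite.Build _ _ _ lebesgue_rV_step
  lebesgue_rV_step_sigma_finite.
End step.

Fixpoint lebesgue_rV n : {sigma_finite_measure set 'rV[R]_n -> \bar R} :=
  match n with
  | 0 => \d_ (0 : 'rV[R]_0)
  | m.+1 => lebesgue_rV_step (lebesgue_rV m)
  end.

Lemma lebesgue_rV_box n (A : 'I_n -> set (measurableTypeR R)) :
  (forall i, measurable (A i)) ->
  lebesgue_rV n [set x : 'rV[R]_n | forall i, A i (x ord0 i)] =
  (\prod_(i < n) lebesgue_measure (A i))%E.
Proof.
elim: n A => [|n IH] A mA.
  by rewrite big_ord0 /= diracE mem_set// => -[].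
rewrite big_ord_recl -IH// -product_measure1E//; last first.
  rewrite (_ : mkset _ = \bigcap_(i in [set: 'I_n])
    ((fun x : 'rV[R]_n => x ord0 i : measurableTypeR R) @^-1` A (lift ord0 i))).
    apply: fin_bigcap_measurable => [|i _]; first exact: finite_finset.
    by rewrite -[X in measurable X]setTI; apply: measurable_rV_coord => //; exact: mA.
  by apply/seteqP; split => x /= h i; [move=> _|]; exact: h.
rewrite /= /lebesgue_rV_step /pushforward; congr (product_measure1 _ _ _).
apply/seteqP; split => -[x y] /=; rewrite /rV_cons /=.
  move=> h; split; first by have := h ord0; rewrite mxE unlift_none.
  by move=> i; have := h (lift ord0 i); rewrite mxE liftK.
by move=> [h1 h2] i; rewrite mxE; case: unliftP => [j ->|->].
Qed.

End lebesgue_rV.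

Section smooth_domain.
Context {R : realType}.

Fixpoint is_Ck (V : normedModType R) (k : nat) (f : V -> R^o) : Prop :=
  match k with
  | 0 => continuous f
  | m.+1 => (forall x v, derivable f x v) /\
            (forall v, is_Ck m (fun x => 'D_v f x))
  end.

Definition is_smooth (V : normedModType R) (f : V -> R^o) : Prop :=
  forall k, is_Ck k f.

(* The boundary is locally the regular zero set of a smooth function that is
   negative exactly on the side of Omega. *)
Definition smooth_boundary n (Omega : set 'rV[R]_n) : Prop :=
  forall x0, (closure Omega `\` interior Omega) x0 ->
  exists (U : set 'rV[R]_n) (rho : 'rV[R]_n -> R^o),
    [/\ open U /\ U x0,
        is_smooth rho,
        (exists v, 'D_v rho x0 != 0),
        (forall x, U x -> (Omega x <-> rho x < 0)) &
        (forall x, U x ->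
           ((closure Omega `\` interior Omega) x <-> rho x = 0))].

Definition bounded_smooth_domain n (Omega : set 'rV[R]_n) : Prop :=
  [/\ Omega !=set0, open Omega, connected Omega, bounded_set Omega &
      smooth_boundary Omega].

Definition compactly_contained n (K Omega : set 'rV[R]_n) : Prop :=
  compact (closure K) /\ closure K `<=` Omega.

End smooth_domain.

Section function_spaces.
Context {R : realType} {d : nat}.
Local Notation E := 'rV[R]_d.
Local Notation dx := (@lebesgue_rV R d).
Local Notation dt := (@lebesgue_measure R).
Implicit Types (A K Omega : set E) (I : set R) (w : E -> R) (f : E -> R -> R).

(* The library norm on 'rV[R]_d is the sup norm. *)
Definition eucl (x : E) : R := Num.sqrt (\sum_i x ord0 i ^+ 2).

Definition Lr_norm (r : R) A w : \bar R := Lnorm dx r%:E (EFin \o (w \_ A)).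

(* Gagliardo norm; the integrand is 0 on the null diagonal. *)
Definition Wsp_norm (s p : R) A w : \bar R :=
  (\int[dx]_(x in A) (`|w x| `^ p)%:E +
   \int[dx \x dx]_(z in A `*` A)
     (`|w z.1 - w z.2| `^ p / eucl (z.1 - z.2) `^ (d%:R + s * p))%:E)%E
  `^ p^-1.

Definition tail_norm (s p : R) w : \bar R :=
  (\int[dx]_x (`|w x| `^ (p - 1) / (1 + eucl x `^ (d%:R + s * p)))%:E)%E
  `^ (p - 1)^-1.

(* L^q(I; X) for a space X of functions on A with (extended) norm N; Bochner
   measurability is rendered by joint measurability, the spaces X used below
   being separable. *)
Definition bochner_space (q : \bar R) I A (N : (E -> R) -> \bar R) f : Prop :=
  measurable_fun (A `*` I) (fun z : E * measurableTypeR R => f z.1 z.2) /\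
  (Lnorm dt q ((fun t => N (f ^~ t)) \_ I) < +oo)%E.

(* C([a, b]; L^2(K)) *)
Definition C_L2 (a b : R) K f : Prop :=
  (forall t, t \in `[a, b] ->
     measurable_fun K (f ^~ t) /\ (Lr_norm 2 K (f ^~ t) < +oo)%E) /\
  (forall t0, t0 \in `[a, b] ->
     Lr_norm 2 K (fun x => f x t - f x t0)
       @[t --> within `[a, b] (nbhs t0)] --> 0%E).

(* C_loc(t1,t2;L^2_loc) /\ L^p_loc(t1,t2;W^{s,p}_loc) /\
   L^oo_loc(t1,t2;L^{p-1}_sp) *)
Definition solution_space (s p : R) Omega (t1 t2 : R) f : Prop :=
  forall a b, t1 < a -> a < b -> b <= t2 ->
  [/\ forall K, compact K -> K `<=` Omega -> C_L2 a b K f,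
      forall K, compact K -> K `<=` Omega ->
        bochner_space p%:E `[a, b] K (Wsp_norm s p K) f &
      bochner_space +oo%E `[a, b] setT (tail_norm s p) f].

(* g is the time derivative of f in the sense of L^2(K)-valued distributions
   on (a, b). *)
Definition weak_dt (a b : R) K (f g : E -> R -> R) : Prop :=
  forall eta : R -> R^o, is_smooth eta ->
    closure [set t | eta t != 0] `<=` `]a, b[ ->
  {ae dx, forall x, K x ->
    \int[dt]_(t in `]a, b[) (f x t * derive1 eta t) =
    - \int[dt]_(t in `]a, b[) (g x t * eta t)}.

(* H^1(a, b; L^2(K)), with f its continuous representative (whose values at a
   and b enter the weak formulation) and g its derivative. *)
Definition H1_L2 (a b : R) K (f g : E -> R -> R) : Prop :=
  [/\ bochner_space 2%:E `[a, b] K (Lr_norm 2 K) f,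
      bochner_space 2%:E `[a, b] K (Lr_norm 2 K) g,
      weak_dt a b K f g & C_L2 a b K f].

(* L^p(a, b; W^{s,p}_0(K)) *)
Definition Lp_Wsp0 (s p a b : R) K f : Prop :=
  bochner_space p%:E `[a, b] setT (Wsp_norm s p setT) f /\
  {ae dt, forall t, t \in `[a, b] -> {ae dx, forall x, ~ K x -> f x t = 0}}.

Definition energy (s p : R) (w phi : E -> R) : R :=
  \int[(dx \x dx)%E]_z
    (`|w z.1 - w z.2| `^ (p - 2) * (w z.1 - w z.2) * (phi z.1 - phi z.2) /
     eucl (z.1 - z.2) `^ (d%:R + s * p)).

(* The left-hand side of the weak formulation tested with phi, where psi is
   the time derivative of phi. *)
Definition weak_form (s p : R) K (a b : R)
    (u phi psi : E -> R -> R) : R :=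
  \int[dx]_(x in K) (u x b * phi x b) - \int[dx]_(x in K) (u x a * phi x a)
  - \int[dt]_(t in `[a, b]) \int[dx]_(x in K) (u x t * psi x t)
  + \int[dt]_(t in `[a, b]) energy s p (u ^~ t) (phi ^~ t).

Definition weak_ineq (P : R -> Prop) (s p : R) Omega (t1 t2 : R)
    (u : E -> R -> R) : Prop :=
  forall K (a b : R) (phi psi : E -> R -> R),
    compact K -> K `<=` Omega -> t1 < a -> a < b -> b <= t2 ->
    Lp_Wsp0 s p a b K phi -> H1_L2 a b K phi psi ->
    {ae (dx \x dt)%E, forall z, z.2 \in `[a, b] -> 0 <= phi z.1 z.2} ->
  P (weak_form s p K a b u phi psi).

Definition weak_subsolution (s p : R) Omega (t1 t2 : R)
    (u : E -> R -> R) : Prop :=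
  solution_space s p Omega t1 t2 u /\
  weak_ineq (fun r => r <= 0) s p Omega t1 t2 u.

Definition weak_supersolution (s p : R) Omega (t1 t2 : R)
    (u : E -> R -> R) : Prop :=
  solution_space s p Omega t1 t2 u /\
  weak_ineq (fun r => 0 <= r) s p Omega t1 t2 u.

End function_spaces.

(* Main.v *)
From HB Require Import structures.
Require Import Defs.
From mathcomp Require Import all_boot all_order all_algebra.
From mathcomp Require Import all_classical all_reals all_analysis.
From mathcomp Require Import ess_sup_inf measurable_realfun ring lra.
Import Order.TTheory GRing.Theory Num.Theory.
Import numFieldNormedType.Exports.
Local Open Scope classical_set_scope.
Local Open Scope ring_scope.

(** Let w = v - u, let K0 be the closure of K, and let X(t) be the squared L^2(K0)
    norm of the excess eta(t) = w(., t)_+, which vanishes off K0 for almost every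
    t in (tau1, tau2]. Formally, testing both weak inequalities with eta gives
    X' / 2 <= E(u, eta) - E(v, eta), and the right-hand side is nonpositive
    because a |-> |a|^(p-2) a and the positive part are both nondecreasing
    (pflux_maxr_ge0). Since X vanishes at tau1, it vanishes identically.

    The excess is not differentiable in time, so it cannot serve as a test
    function. Instead of regularizing it, one freezes it: on [r, t] both
    inequalities are tested with eta(t), which does not depend on time. Convexity
    of the squared positive part (maxr_sqr_convex) then plays the role of the
    chain rule and gives
      X(t) - X(r) <= 2 int_r^t (E(u(tau), eta(t)) - E(v(tau), eta(t))) dtau.
    In the integrand eta(t) = eta(tau) + (eta(t) - eta(tau)). The first part
    has the good sign. By Young's inequality the second part is at most
      e (size of u(tau) and v(tau)) + e^(1-p) |eta(t) - eta(tau)|^p,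
    with the W^{s,p} norm, for every e > 0 (energy_gap). As a function of time
    eta is in L^p with values in W^{s,p}, where translations are continuous
    (excess_shift_small, based on Lp_translation). Cutting the time interval into
    slices of length h and comparing each slice with the preceding one, the
    errors add up to a quantity that tends to 0 when first e is chosen small and
    then h tends to 0 (integral_eq0_of_gap). Hence the integral of X over the time
    interval is 0 (excess_mass_vanish), and v <= u almost everywhere on K0 by
    Tonelli's theorem.

    Three points need care. The form E is nonlocal: with K1 a compact
    neighbourhood of K0 in Omega, pairs of points outside K1 x K1 contribute only
    when one of them is in K0 and the other off K1; there the kernel is at most a
    multiple of the tail weight (kernel_le_tail_weight), which is integrable, and
    the tail norm of the solutions takes over (flux_bound). The mass at the
    initial time vanishes on K by hypothesis and on K0 minus K by continuity in
    L^2, from times close to tau1 (excess_mass_small). Finally, a function of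
    space alone that lies in the local spaces is admissible in the weak
    formulation with time derivative 0 (static_Lp_Wsp0, static_H1_L2). *)

(** * Power inequalities *)

Section power_inequalities.
Context {R : realType}.
Implicit Types a b p r e : R.

Lemma powRp_split a p : 1 < p -> 0 <= a -> a `^ p = a `^ (p - 1) * a.
Proof.
move=> p1 a0; rewrite mulrC mulr_powRB1//; lra.
Qed.

(** Young's inequality with the small factor on the first term; the two powers
    of e are those produced by scaling a and b. *)
Lemma powR_Young_eps a b e p : 1 < p -> 0 <= a -> 0 <= b -> 0 < e ->
  a `^ (p - 1) * b <= e * a `^ p + e `^ (1 - p) * b `^ p.
Proof.
move=> p1 a0 b0 e0.
have [bea|aeb] := leP b (e * a).
  rewrite (@powRp_split a p)// -[leLHS]addr0 lerD ?mulr_ge0 ?powR_ge0//.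
  by rewrite mulrCA ler_wpM2l// powR_ge0.
have ab : a <= e^-1 * b by rewrite ler_pdivlMl// ltW.
rewrite -[leLHS]add0r lerD//; first by rewrite mulr_ge0 ?powR_ge0// ltW.
rewrite (@powRp_split b p)// mulrA ler_wpM2r//.
rewrite (_ : 1 - p = - (p - 1)); last ring.
rewrite powRN -powR_inv1 ?powR_ge0// -powRrM mulrN1.
have -> : e `^ (- (p - 1)) = e^-1 `^ (p - 1).
  by rewrite -[in RHS]powR_inv1 ?(ltW e0)// -powRrM mulN1r.
rewrite -powRM ?invr_ge0 ?(ltW e0)//.
by rewrite ge0_ler_powR ?nnegrE//; [lra|rewrite mulr_ge0// invr_ge0 ltW].
Qed.

Lemma powRD_le a b r : 0 <= r -> 0 <= a -> 0 <= b ->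
  (a + b) `^ r <= 2 `^ r * (a `^ r + b `^ r).
Proof.
move=> r0 a0 b0; wlog ab : a b a0 b0 / a <= b.
  move=> H; have [ab|/ltW ba] := leP a b; first exact: H.
  by rewrite addrC [a `^ r + _]addrC; exact: H.
have : (a + b) `^ r <= (2 * b) `^ r.
  by rewrite ge0_ler_powR ?nnegrE//; lra.
move/le_trans; apply; rewrite powRM//.
by rewrite ler_wpM2l ?powR_ge0// lerDr powR_ge0.
Qed.

Lemma powR_superadd a b p : 1 <= p -> 0 <= a -> 0 <= b ->
  a `^ p + b `^ p <= (a + b) `^ p.
Proof.
rewrite le_eqVlt => /predU1P[<- a0 b0|p1 a0 b0].
  by rewrite !powRr1// addr_ge0.
rewrite !(powRp_split _ _ p1)// ?addr_ge0// mulrDr lerD// ler_wpM2r//.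
  by rewrite ge0_ler_powR ?nnegrE//; lra.
by rewrite ge0_ler_powR ?nnegrE//; lra.
Qed.

(** The signed power: an increasing bijection of the line turning p-th powers
    of increments into plain increments, which reduces statements in the
    p-th power mean to the case p = 1. *)
Definition spow p a := `|a| `^ (p - 1) * a.

Lemma norm_spow p a : 1 < p -> `|spow p a| = `|a| `^ p.
Proof.
move=> p1.
by rewrite /spow normrM ger0_norm ?powR_ge0// -powRp_split.
Qed.

(** For arguments of the same sign this is superadditivity of the p-th power;
    for opposite signs both sides involve sums of absolute values. *)
Lemma spow_sub_ge p a b : 1 < p ->
  `|a - b| `^ p <= 2 `^ p * `|spow p a - spow p b|.
Proof.
move=> p1.
have p0 : 0 <= p by lra.
have two1 : 1 <= 2 `^ p :> R.
  by rewrite -[leLHS](powRr0 2) ler_powR//; lra.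
have pos x y : 0 <= x -> 0 <= y ->
    `|x - y| `^ p <= 2 `^ p * `|spow p x - spow p y|.
  move=> x0 y0; wlog yx : x y x0 y0 / y <= x.
    move=> H; have [yx|/ltW xy] := leP y x; first exact: H.
    by rewrite distrC (distrC (spow p x)); exact: H.
  rewrite /spow !ger0_norm// ?subr_ge0// -?(powRp_split _ _ p1)//; last first.
    by rewrite ge0_ler_powR ?nnegrE.
  have := @powR_superadd (x - y) y p (ltW p1); rewrite subr_ge0 => /(_ yx y0).
  rewrite subrK -lerBrDr => /le_trans; apply.
  by rewrite ler_peMl// subr_ge0 ge0_ler_powR ?nnegrE.
have mixed x y : 0 <= x -> 0 <= y ->
    `|x + y| `^ p <= 2 `^ p * `|spow p x + spow p y|.
  move=> x0 y0; rewrite /spow !ger0_norm// ?addr_ge0 ?mulr_ge0 ?powR_ge0//.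
  by rewrite -!(powRp_split _ _ p1)//; exact: powRD_le.
have spowN x : spow p (- x) = - spow p x by rewrite /spow normrN mulrN.
have [a0|/ltW a0] := leP 0 a; have [b0|/ltW b0] := leP 0 b.
- exact: pos.
- by have := mixed a (- b); rewrite spowN oppr_ge0; apply.
- have := mixed (- a) b; rewrite spowN oppr_ge0 => /(_ a0 b0).
  by rewrite -normrN opprD opprK -(normrN (_ + spow p b)) opprD opprK.
- have := pos (- a) (- b); rewrite !spowN !oppr_ge0 => /(_ a0 b0).
  by rewrite -opprD normrN -opprD normrN.
Qed.

(** The nonlinearity of the fractional p-Laplacian. *)
Definition pflux p a := `|a| `^ (p - 2) * a.

Lemma norm_pflux p a : 2 < p -> `|pflux p a| = `|a| `^ (p - 1).
Proof.
move=> p2; rewrite /pflux normrM ger0_norm ?powR_ge0//.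
rewrite [RHS]powRp_split//; last lra.
by congr (_ `^ _ * _); ring.
Qed.

Lemma pflux_monotone p a b : 2 < p -> a <= b -> pflux p a <= pflux p b.
Proof.
move=> p2; rewrite /pflux => ab.
have mono x y : 0 <= x -> x <= y -> x `^ (p - 2) * x <= y `^ (p - 2) * y.
  move=> x0 xy; have y0 := le_trans x0 xy.
  rewrite ler_pM ?powR_ge0// ge0_ler_powR ?nnegrE//; lra.
have [a0|a0] := leP 0 a.
  by have b0 := le_trans a0 ab; rewrite !ger0_norm//; exact: mono.
have [b0|b0] := leP 0 b.
  apply: (@le_trans _ _ 0); last by rewrite mulr_ge0 ?powR_ge0.
  by rewrite mulr_ge0_le0 ?powR_ge0// ltW.
rewrite !ltr0_norm// -lerN2 -!mulrN; apply: mono; lra.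
Qed.

(** The sign condition behind the comparison principle. If b1 - b2 <= a1 - a2
    then w1 <= w2 for w = b - a, and the positive part preserves this order, so
    that both factors have the same sign. *)
Lemma pflux_maxr_ge0 p a1 a2 b1 b2 : 2 < p ->
  0 <= (pflux p (b1 - b2) - pflux p (a1 - a2)) *
       (Num.max (b1 - a1) 0 - Num.max (b2 - a2) 0).
Proof.
move=> p2; have [h|/ltW h] := leP (b1 - b2) (a1 - a2).
  rewrite mulr_le0// ?subr_le0; first exact: pflux_monotone.
  case: (leP (b1 - a1) 0); case: (leP (b2 - a2) 0) => *; lra.
rewrite mulr_ge0// ?subr_ge0; first exact: pflux_monotone.
case: (leP (b1 - a1) 0); case: (leP (b2 - a2) 0) => *; lra.
Qed.

Lemma maxr_sub_le a b : `|Num.max a 0 - Num.max b 0| <= `|a - b|.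
Proof. by rewrite ler_norml; have := ler_norm (a - b); have := ler_norm (b - a);
  rewrite (distrC b); case: (leP a 0); case: (leP b 0) => *; lra.
Qed.

(** The squared positive part is convex with derivative 2 a_+, so it lies above
    its tangent at a. This replaces the chain rule for the time derivative of
    the squared norm of the excess. *)
Lemma maxr_sqr_convex a b :
  (Num.max a 0 ^+ 2 - Num.max b 0 ^+ 2) / 2 <= (a - b) * Num.max a 0.
Proof.
have := sqr_ge0 (a - b); have := sqr_ge0 a; have := sqr_ge0 b.
case: (leP a 0); case: (leP b 0) => b0 a0 h1 h2 h3; rewrite ?expr0n/=; nra.
Qed.

(** Lets smallness of the squared positive part pass from one time to another
    at the price of the squared increment. *)
Lemma maxr_sqr_le a b :
  Num.max a 0 ^+ 2 <= 2 * Num.max b 0 ^+ 2 + 2 * (a - b) ^+ 2.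
Proof.
have := sqr_ge0 (a - 2 * b); have := sqr_ge0 (a - b); have := sqr_ge0 b.
case: (leP a 0); case: (leP b 0) => b0 a0 h1 h2 h3; rewrite ?expr0n/=; nra.
Qed.

End power_inequalities.

(** * Continuity of time translations *)

Section translation.
Context {R : realType}.
Local Notation dt := (@lebesgue_measure R).
Local Notation T := (measurableTypeR R).

Lemma measurable_translate (c : R) : measurable_fun setT ((fun x => x + c) : T -> T).
Proof. exact: measurable_funD. Qed.

Section pushforward_translate.
Variable c : R.
Let phi : T -> T := fun x => x + c.
Let nu : {measure set T -> \bar R} :=
  @measure_function_pushforward__canonical__measure_function_Measure
    _ _ _ _ _ dt phi (measurable_translate c).

Lemma lebesgue_measure_translate (A : set T) : measurable A ->
  dt A = pushforward dt phi A.
Proof.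
move=> mA; apply: (@lebesgue_measure_unique R nu) => // X [[a b] _ <-] /=.
rewrite /nu /pushforward /= /phi.
have -> : (fun x : R => x + c) @^-1` `]a, b] = `]a - c, b - c]%classic.
  by apply/seteqP; split=> x /=; rewrite !in_itv /= ltrBlDr lerBrDr.
rewrite !lebesgue_measure_itv /= !lte_fin ltrD2r; case: ifPn => // _.
by rewrite -!EFinB; congr EFin; ring.
Qed.

Lemma ge0_integral_translate (f : R -> \bar R) : measurable_fun setT f ->
  (forall x, 0 <= f x)%E -> (\int[dt]_x f (x + c)%R = \int[dt]_x f x)%E.
Proof.
move=> mf f0; rewrite [RHS](eq_measure_integral nu); last first.
  by move=> A mA _; exact: lebesgue_measure_translate.
rewrite /nu ge0_integral_pushforward//; exact: measurable_translate.
Qed.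
End pushforward_translate.

Lemma ge0_integral_itv_translate (f : R -> \bar R) (c a b : R) :
  measurable_fun setT f -> (forall x, 0 <= f x)%E ->
  (\int[dt]_(x in `[a, b]) f (x + c)%R = \int[dt]_(x in `[(a + c)%R, (b + c)%R]) f x)%E.
Proof.
move=> mf f0; rewrite [RHS]integral_mkcond -(ge0_integral_translate c).
- rewrite integral_mkcond; apply: eq_integral => x _.
  rewrite /patch; congr (if _ then _ else _); apply/idP/idP;
  by rewrite !inE /= !in_itv /= !lerD2r.
- apply/(measurable_restrictT _ _).1 => //; exact: measurable_funS mf.
- by move=> x; rewrite /patch; case: ifP.
Qed.

End translation.

Section L1_translation.
Context {R : realType}.
Local Notation dt := (@lebesgue_measure R).
Local Notation T := (measurableTypeR R).

Lemma continuous_translate_le (g : R -> R) (a b e : R) : 0 < e ->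
  continuous g ->
  \forall h \near 0^'+, forall t, t \in `[a, b] -> `|g (t - h) - g t| <= e.
Proof.
move=> e0 cg.
have /compact_near_coveringP/(_ R (0^'+)
  (fun h t => `|g (t - h) - g t| <= e)) := @segment_compact R a b.
apply => x _.
have e20 : 0 < e / 2 by rewrite divr_gt0.
have /cvgrPdist_le /(_ _ e20) [r /= r0 hr] := cg x.
exists (ball x (r / 2), [set h | 0 < h < r / 2]) => /=.
  split; first by apply: nbhsx_ballx; rewrite divr_gt0.
  have r20 : 0 < r / 2 by rewrite divr_gt0.
  apply: filterS2 (nbhs_right_gt (0 : R)) (nbhs_right_lt r20) => h h0 hr2.
  exact/andP.
move=> [y h] /= [yx0 /andP[h0 hr2]].
have yx : `|x - y| < r / 2 := yx0.
have h1 : `|g x - g (y - h)| <= e / 2.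
  apply: hr => /=; rewrite opprB addrCA.
  rewrite (le_lt_trans (ler_normD _ _))// gtr0_norm//.
  lra.
have h2 : `|g x - g y| <= e / 2.
  by apply: hr => /=; lra.
rewrite (_ : _ - _ = (g x - g y) - (g x - g (y - h))); last ring.
by rewrite (le_trans (ler_normB _ _))// (splitr e) lerD.
Qed.

(** True for continuous functions by uniform continuity, and these are dense
    in L^1 of a bounded interval. *)
Lemma L1_translation (f : R -> R) (a b e : R) : measurable_fun setT f ->
  dt.-integrable `[a, b] (EFin \o f) -> 0 < e ->
  \forall h \near 0^'+,
    (\int[dt]_(t in `[(a + h)%R, b]) (`|f (t - h) - f t|%:E) <= e%:E)%E.
Proof.
move=> mf intf e0.
have mI : measurable (`[a, b]%classic : set T) by [].
have Ifin : (dt `[a, b]%classic < +oo)%E.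
  by rewrite lebesgue_measure_itv /=; case: ifPn => // _; rewrite -EFinB ltry.
have [g [cg ig]] := approximation_continuous_integrable mI Ifin intf.
have e40 : 0 < e / 4 by rewrite divr_gt0.
move/fine_cvgP => -[gfin /cvgrPdist_le /(_ _ e40) gl].
have [n [gnfin gnl]] := filter_ex (filterI gfin gl).
have gn : (\int[dt]_(z in `[a, b]) `|(f z - g n z)%:E| <= (e / 4)%:E)%E.
  rewrite -(fineK gnfin) lee_fin; move: gnl; rewrite /= sub0r normrN.
  exact/le_trans/ler_norm.
have mg : measurable_fun setT (g n) by exact: continuous_measurable_fun.
set L := Num.max (b - a) 1.
have L0 : 0 < L by rewrite lt_max ltr01 orbT.
have := continuous_translate_le (g n) a b _ (divr_gt0 e40 L0) (cg n).
apply: filter_app; near=> h => hg.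
have h0 : 0 < h by near: h; exact: nbhs_right_gt.
have sub1 : `[(a + h), b] `<=` `[a, b].
  by move=> x /=; rewrite !in_itv /= => /andP[? ->]; rewrite andbT; lra.
pose F x := `|(f x - g n x)%:E|%E.
have mF : measurable_fun setT F.
  by apply: measurableT_comp => //; apply/measurable_EFinP; exact: measurable_funB.
have F0 x : (0 <= F x)%E by exact: abse_ge0.
have mFh : measurable_fun setT (fun t : R => F (t - h)).
  exact: (measurableT_comp mF (measurable_translate (- h))).
have mfh : measurable_fun setT (fun t : R => f (t - h)).
  exact: (measurableT_comp mf (measurable_translate (- h))).
apply: (@le_trans _ _ (\int[dt]_(t in `[(a + h)%R, b])
    (F (t - h)%R + (e / 4 / L)%:E + F t))%E).
  apply: ge0_le_integral => //.
  - apply/measurable_EFinP; apply: measurable_funTS.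
    by apply: measurableT_comp => //; exact: measurable_funB.
  - apply: measurable_funTS; apply: emeasurable_funD => //.
    by apply: emeasurable_funD.
  - move=> t; rewrite /= => tI; rewrite /F /= -!EFinD lee_fin.
    have H := hg t (sub1 _ tI).
    rewrite (_ : f (t - h) - f t = (f (t - h) - g n (t - h)) +
      (g n (t - h) - g n t) + - (f t - g n t)); last ring.
    rewrite (le_trans (ler_normD _ _))// normrN lerD2r.
    by rewrite (le_trans (ler_normD _ _))// lerD2l.
rewrite ge0_integralD//; last 3 first.
- by move=> t _; rewrite adde_ge0// lee_fin ltW// !divr_gt0.
- by apply: measurable_funTS; apply: emeasurable_funD.
- exact: measurable_funTS.
rewrite ge0_integralD//; last 2 first.
- exact: measurable_funTS.
- by move=> t _; rewrite lee_fin ltW// !divr_gt0.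
rewrite (ge0_integral_itv_translate _ (- h))// addrK.
rewrite integral_cst//.
have i1 : (\int[dt]_(t in `[a, (b - h)%R]) F t <= (e / 4)%:E)%E.
  apply: le_trans gn; apply: ge0_subset_integral => //.
    exact: measurable_funTS.
  by move=> x /=; rewrite !in_itv /= => /andP[->] /=; lra.
have i2 : (\int[dt]_(t in `[(a + h)%R, b]) F t <= (e / 4)%:E)%E.
  apply: le_trans gn; apply: ge0_subset_integral => //.
  exact: measurable_funTS.
have i3 : ((e / 4 / L)%:E * dt `[(a + h)%R, b]%classic <= (e / 4)%:E)%E.
  rewrite lebesgue_measure_itv /= lte_fin; case: ifPn => abh; last first.
    by rewrite mule0 lee_fin ltW.
  rewrite -EFinB -EFinM lee_fin mulrAC ler_pdivrMr// ler_wpM2l ?(ltW e40)//.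
  rewrite le_max; apply/orP; left; lra.
apply: (@le_trans _ _ ((e / 4)%:E + (e / 4)%:E + (e / 4)%:E)%E).
  by rewrite leeD// leeD.
rewrite -!EFinD lee_fin; lra.
Unshelve. all: by end_near. Qed.

End L1_translation.

Section ereal_cvg0.
Context {R : realType} {T : Type} (F : set_system T) {FF : Filter F}.
Implicit Types f : T -> \bar R.

Lemma cvge0_near_le f (e : R) : 0 < e -> f x @[x --> F] --> 0%E ->
  \forall x \near F, (f x <= e%:E)%E.
Proof.
move=> e0 f0.
have : nbhs (0 : \bar R)%E [set y | y < e%:E]%E.
  by apply: open_nbhs_nbhs; split; [exact: open_ereal_lt_ereal | rewrite /= lte_fin].
move=> /f0 H; have {}H : F [set x | (f x < e%:E)%E] := H.
by apply: filterS H => x /= /ltW.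
Qed.

Lemma near_le_cvge0 f : (forall x, 0 <= f x)%E ->
  (forall e : R, 0 < e -> \forall x \near F, (f x <= e%:E)%E) ->
  f x @[x --> F] --> 0%E.
Proof.
move=> f0 fe; apply/fine_cvgP; split.
  apply: filterS (fe _ ltr01) => x fx1.
  by rewrite ge0_fin_numE// (le_lt_trans fx1)// ltry.
apply/cvgrPdist_le => e e0; apply: filterS (fe _ e0) => x fxe.
rewrite sub0r normrN /= ger0_norm ?fine_ge0// -lee_fin fineK//.
by rewrite ge0_fin_numE// (le_lt_trans fxe)// ltry.
Qed.

End ereal_cvg0.

Section fubini_in.
Local Open Scope ereal_scope.
Context d1 d2 (T1 : measurableType d1) (T2 : measurableType d2) (R : realType).
Variable m1 : {sigma_finite_measure set T1 -> \bar R}.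
Variable m2 : {sigma_finite_measure set T2 -> \bar R}.
Variables (A : set T1) (B : set T2) (f : T1 * T2 -> \bar R).
Hypotheses (mA : measurable A) (mB : measurable B).
Hypotheses (mf : measurable_fun setT f) (f0 : forall z, 0 <= f z).

Lemma measurable_fun_integral2 :
  measurable_fun setT (fun x => \int[m2]_(y in B) f (x, y)).
Proof.
rewrite (_ : (fun _ => _) = fubini_F m2 (f \_ (setT `*` B))).
  apply: measurable_fun_fubini_tonelli_F; last exact: erestrict_ge0.
  apply/(measurable_restrictT _ _).1; first exact: measurableX.
  exact: measurable_funTS.
apply/funext => x; rewrite integral_mkcond; apply: eq_integral => y _.
by rewrite /patch in_setX in_setT.
Qed.

Lemma measurable_fun_integral1 :
  measurable_fun setT (fun y => \int[m1]_(x in A) f (x, y)).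
Proof.
rewrite (_ : (fun _ => _) = fubini_G m1 (f \_ (A `*` setT))).
  apply: measurable_fun_fubini_tonelli_G; last exact: erestrict_ge0.
  apply/(measurable_restrictT _ _).1; first exact: measurableX.
  exact: measurable_funTS.
apply/funext => x; rewrite integral_mkcond; apply: eq_integral => y _.
by rewrite /patch in_setX in_setT andbT.
Qed.

Let fAB := f \_ (A `*` B).

Let mfAB : measurable_fun setT fAB.
Proof.
apply/(measurable_restrictT _ _).1; first exact: measurableX.
exact: measurable_funTS.
Qed.

Let fAB0 z : 0 <= fAB z. Proof. exact: erestrict_ge0. Qed.

Lemma integral_setX12 : \int[m1 \x m2]_(z in A `*` B) f z =
  \int[m1]_(x in A) \int[m2]_(y in B) f (x, y).
Proof.
rewrite integral_mkcond.
transitivity (\int[m1]_x fubini_F m2 fAB x); first exact: fubini_tonelli1.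
rewrite [RHS]integral_mkcond; apply: eq_integral => x _.
rewrite /fubini_F /fAB /patch; case: ifPn => xA.
  rewrite [RHS]integral_mkcond; apply: eq_integral => y _.
  by rewrite /patch in_setX xA.
by apply: integral0_eq => y _; rewrite in_setX (negbTE xA).
Qed.

Lemma integral_setX21 : \int[m1 \x m2]_(z in A `*` B) f z =
  \int[m2]_(y in B) \int[m1]_(x in A) f (x, y).
Proof.
rewrite integral_mkcond.
transitivity (\int[m2]_y fubini_G m1 fAB y); first exact: fubini_tonelli2.
rewrite [RHS]integral_mkcond; apply: eq_integral => y _.
rewrite /fubini_G /fAB /patch; case: ifPn => yB.
  rewrite [RHS]integral_mkcond; apply: eq_integral => x _.
  by rewrite /patch in_setX yB andbT.
by apply: integral0_eq => x _; rewrite in_setX (negbTE yB) andbF.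
Qed.

Lemma integral_setX_swap : \int[m1]_(x in A) \int[m2]_(y in B) f (x, y) =
  \int[m2]_(y in B) \int[m1]_(x in A) f (x, y).
Proof. by rewrite -integral_setX12 integral_setX21. Qed.

End fubini_in.
Arguments measurable_fun_integral2 {d1 d2 T1 T2 R m2 B f}.
Arguments measurable_fun_integral1 {d1 d2 T1 T2 R m1 A f}.
Arguments integral_setX12 {d1 d2 T1 T2 R m1 m2 A B f}.
Arguments integral_setX21 {d1 d2 T1 T2 R m1 m2 A B f}.
Arguments integral_setX_swap {d1 d2 T1 T2 R m1 m2 A B f}.

Section Lp_translation.
Context {R : realType} d (Z : measurableType d).
Variable mu : {sigma_finite_measure set Z -> \bar R}.
Local Notation dt := (@lebesgue_measure R).
Local Notation T := (measurableTypeR R).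
Implicit Types (f : Z * T -> R) (a b e : R).

Let mshift (h : R) :
  measurable_fun setT (fun z : Z * T => (z.1, (z.2 - h : T))).
Proof.
apply: measurable_fun_pair => //.
exact: (measurableT_comp (measurable_translate (- h)) measurable_snd).
Qed.

(** The scalar statement holds on almost every line, and twice the L^1 norm of
    the line dominates, so that dominated convergence applies in z. *)
Lemma L1_translation_param f a b e : measurable_fun setT f ->
  (\int[mu]_z \int[dt]_(t in `[a, b]) `|f (z, t)|%:E < +oo)%E -> 0 < e ->
  \forall h \near 0^'+, (\int[dt]_(t in `[(a + h)%R, b])
     \int[mu]_z (`|f (z, (t - h)%R) - f (z, t)|%:E) <= e%:E)%E.
Proof.
move=> mf fint e0.
pose D h (z : Z * T) : \bar R := `|f (z.1, (z.2 - h)%R) - f z|%:E.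
have mD h : measurable_fun setT (D h).
  apply/measurable_EFinP; apply: measurableT_comp => //.
  by apply: measurable_funB => //; exact: measurableT_comp mf (mshift h).
have D0 h z : (0 <= D h z)%E by rewrite lee_fin.
have mabs : measurable_fun setT (fun z : Z * T => `|f z|%:E).
  by apply/measurable_EFinP; exact: measurableT_comp.
pose phi h z := (\int[dt]_(t in `[(a + h)%R, b]) D h (z, t))%E.
pose g z := (2%:E * \int[dt]_(t in `[a, b]) `|f (z, t)|%:E)%E.
have mint : measurable_fun setT (fun z => \int[dt]_(t in `[a, b]) `|f (z, t)|%:E)%E.
  exact: (measurable_fun_integral2 (f := fun z => `|f z|%:E)).
have int0 z : (0 <= \int[dt]_(t in `[a, b]) `|f (z, t)|%:E)%E.
  by apply: integral_ge0 => t _; rewrite lee_fin.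
suff : (\int[mu]_z phi h z)%E @[h --> 0^'+] --> (0%:E : \bar R).
  move/(cvge0_near_le _ _ _ e0); apply: filterS => h.
  rewrite (_ : integral _ _ _ = (\int[mu]_z phi h z)%E)//.
  by rewrite (integral_setX_swap (f := D h)).
apply/cvge_at_rightP => h [h0 hcvg].
have phi0 z k : (0 <= phi k z)%E by exact: integral_ge0.
have mphi k : measurable_fun setT (phi k).
  exact: measurable_fun_integral2.
have phig z n : (phi (h n) z <= g z)%E.
  have mft k : measurable_fun setT (fun t : R => `|f (z, (t - k)%R)|%:E).
    apply/measurable_EFinP; apply: measurableT_comp => //.
    apply: (measurableT_comp mf); apply: measurable_fun_pair => //.
    exact: measurable_translate.
  have mft0 : measurable_fun setT (fun t : R => `|f (z, t)|%:E).
    exact: measurable_fun_pair2 mabs.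
  apply: (@le_trans _ _ (\int[dt]_(t in `[(a + h n)%R, b])
      (`|f (z, (t - h n)%R)|%:E + `|f (z, t)|%:E))%E).
    apply: ge0_le_integral => //.
    - by apply: measurable_funTS; exact: measurable_fun_pair2 (mD _).
    - by apply: measurable_funTS; exact: emeasurable_funD (mft _) mft0.
    - by move=> t _; rewrite -EFinD lee_fin ler_normB.
  rewrite ge0_integralD//; [|exact: measurable_funTS (mft _)|exact: measurable_funTS mft0].
  rewrite (ge0_integral_itv_translate (fun t => `|f (z, t)|%:E) (- h n))//.
  rewrite addrK /g -[2]/(1 + 1) EFinD ge0_muleDl// mul1e leeD//.
    apply: ge0_subset_integral => //; first exact: measurable_funTS.
    move=> x /=; rewrite !in_itv /= => /andP[-> /=]; have := h0 n; lra.
  apply: ge0_subset_integral => //; first exact: measurable_funTS.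
  move=> x /=; rewrite !in_itv /= => /andP[+ ->]; rewrite andbT; have := h0 n; lra.
have ig : mu.-integrable setT g.
  apply/integrableP; split; first exact: measurable_funeM.
  rewrite (eq_integral g); last by move=> z _; rewrite gee0_abs// mule_ge0.
  by rewrite /g ge0_integralZl// lte_mul_pinfty.
have phicvg : {ae mu, forall z, setT z ->
    phi (h n) z @[n --> \oo] --> (0 : \bar R)%E}.
  have : {ae mu, forall z, setT z -> g z \is a fin_num} by exact: integrable_ae.
  apply: filterS => z /(_ I) gfin _.
  have fz : dt.-integrable `[a, b] (EFin \o (fun t : R => f (z, t))).
    apply/integrableP; split.
      by apply/measurable_EFinP; apply: measurable_funTS; exact: measurable_fun_pair2.
    rewrite /=; move: gfin; rewrite /g.
    rewrite ge0_fin_numE ?mule_ge0//.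
    case: (\int[dt]_(t in `[a, b]) `|f (z, t)|%:E)%E (int0 z) => // [r _ _|].
      by rewrite ltry.
    by rewrite gt0_muley// lte_fin.
  have h0' : h n @[n --> \oo] --> 0^'+.
    move=> B [r /= r0 rB]; move/cvgrPdist_lt : hcvg => /(_ _ r0) hr.
    by apply: filterS hr => n hn; exact: rB.
  apply: near_le_cvge0 => // r r0.
  have mfz : measurable_fun setT (fun t : R => f (z, t)) by exact: measurable_fun_pair2.
  exact: h0' _ (L1_translation _ _ _ _ mfz fz r0).
have phidom : {ae mu, forall z n, setT z -> (`|phi (h n) z| <= g z)%E}.
  by apply: nearW => z n _; rewrite gee0_abs.
have [_ _] := dominated_convergence measurableT (mu := mu)
  (fun n => mphi (h n)) (measurable_cst _) phicvg ig phidom.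
by rewrite /= integral0.
Qed.

(** The signed power spow reduces the p-th power mean to p = 1: it turns f into
    an L^1 function whose increments dominate the p-th powers of those of f. *)
Lemma Lp_translation f p a b e : 1 < p -> measurable_fun setT f ->
  (\int[mu]_z \int[dt]_(t in `[a, b]) (`|f (z, t)| `^ p)%:E < +oo)%E -> 0 < e ->
  \forall h \near 0^'+, (\int[dt]_(t in `[(a + h)%R, b])
     \int[mu]_z ((`|f (z, (t - h)%R) - f (z, t)| `^ p)%:E) <= e%:E)%E.
Proof.
move=> p1 mf fint e0.
pose G z := spow p (f z).
have mG : measurable_fun setT G.
  apply: measurable_funM => //.
  by apply: (measurableT_comp (measurable_powR _)); exact: measurableT_comp.
have p2 : 0 < 2 `^ p :> R by exact: powR_gt0.
have Gint : (\int[mu]_z \int[dt]_(t in `[a, b]) `|G (z, t)|%:E < +oo)%E.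
  rewrite (eq_integral (fun z =>
    \int[dt]_(t in `[a, b]) (`|f (z, t)| `^ p)%:E)%E)//.
  by move=> z _; apply: eq_integral => t _; rewrite norm_spow.
apply: filterS (L1_translation_param G a b _ mG Gint (divr_gt0 e0 p2)) => h Hh.
have mDD : measurable_fun setT (fun z : Z * T =>
     `|f (z.1, (z.2 - h)%R) - f z| `^ p).
  apply: (measurableT_comp (measurable_powR _)); apply: measurableT_comp => //.
  by apply: measurable_funB => //; exact: measurableT_comp mf (mshift h).
have mDG : measurable_fun setT (fun z : Z * T =>
     `|G (z.1, (z.2 - h)%R) - G z|).
  apply: measurableT_comp => //.
  by apply: measurable_funB => //; exact: measurableT_comp mG (mshift h).
pose DF (z : Z * T) : \bar R := (`|f (z.1, (z.2 - h)%R) - f z| `^ p)%:E.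
pose DG (z : Z * T) : \bar R := `|G (z.1, (z.2 - h)%R) - G z|%:E.
have mDF : measurable_fun setT DF by exact/measurable_EFinP.
have {}mDG : measurable_fun setT DG by exact/measurable_EFinP.
have DF0 z : (0 <= DF z)%E by rewrite lee_fin powR_ge0.
have DG0 z : (0 <= DG z)%E by rewrite lee_fin.
have mIF := measurable_fun_integral1 (m1 := mu) measurableT mDF DF0.
have mIG := measurable_fun_integral1 (m1 := mu) measurableT mDG DG0.
apply: (@le_trans _ _ ((2 `^ p)%:E * \int[dt]_(t in `[(a + h)%R, b])
     \int[mu]_z DG (z, t))%E); last first.
  apply: (@le_trans _ _ ((2 `^ p)%:E * (e / 2 `^ p)%:E)%E).
    by rewrite lee_wpmul2l// lee_fin ltW.
  by rewrite -EFinM lee_fin mulrC divfK// gt_eqF.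
rewrite -ge0_integralZl//; last 2 first.
- exact: measurable_funTS.
- by move=> t _; exact: integral_ge0.
apply: ge0_le_integral => //.
- by move=> t _; apply: integral_ge0 => z _; exact: (DF0 (z, t)).
- exact: measurable_funTS mIF.
- by apply: measurable_funTS; exact: measurable_funeM.
- move=> t _; rewrite -ge0_integralZl//; last exact: measurable_fun_pair1.
  apply: ge0_le_integral => //.
  + exact: (@measurable_fun_pair1 _ _ _ Z T _ _ t mDF).
  + by apply: measurable_funeM; exact: measurable_fun_pair1.
  + by move=> z _; rewrite -EFinM lee_fin; exact: spow_sub_ge.
Qed.

End Lp_translation.

(** * Functions with small increments *)

Section ae_logic.
Context d (T : measurableType d) (R : realType) (mu : {measure set T -> \bar R}).
Implicit Types P Q S : T -> Prop.

Lemma ae_imp P Q : (forall x, P x -> Q x) ->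
  {ae mu, forall x, P x} -> {ae mu, forall x, Q x}.
Proof. by move=> PQ; apply: filterS. Qed.

Lemma ae_imp2 P Q S : (forall x, P x -> Q x -> S x) ->
  {ae mu, forall x, P x} -> {ae mu, forall x, Q x} -> {ae mu, forall x, S x}.
Proof. by move=> PQS; apply: filterS2. Qed.

End ae_logic.
Arguments ae_imp {d T R mu P Q}.
Arguments ae_imp2 {d T R mu P Q S}.

Section gap.
Context {R : realType}.
Local Notation dt := (@lebesgue_measure R).
Local Notation T := (measurableTypeR R).
Implicit Types (f G : R -> \bar R) (a b c h : R).

Lemma ge0_integral_itv_split f a b c : a <= b -> b <= c ->
  measurable_fun setT f -> (forall x, 0 <= f x)%E ->
  (\int[dt]_(t in `[a, c]) f t =
   \int[dt]_(t in `[a, b]) f t + \int[dt]_(t in `[b, c]) f t)%E.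
Proof.
move=> ab bc mf f0.
have -> : `[a, c]%classic = `[a, b]%classic `|` `]b, c]%classic :> set R.
  apply/seteqP; split => t /=; rewrite !in_itv /=.
    by move=> /andP[at_ tc]; case: (leP t b) => tb; [left|right]; rewrite ?at_ ?tc.
  by case => /andP[H1 H2]; apply/andP; split; lra.
rewrite ge0_integral_setU//; last 2 first.
- exact: measurable_funTS.
- apply/disj_setPS => t /= [] /=; rewrite !in_itv /= => /andP[_ tb] /andP[bt _].
  by move: tb; rewrite leNgt bt.
congr (_ + _)%E; rewrite integral_itv_obnd_cbnd//.
exact: measurable_funTS.
Qed.

(** A nonnegative function that is small near the left end of an interval and
    whose increase over [r, t] is controlled by the integral of B(., t) over
    [r, t] vanishes when the translates of B near the diagonal have small
    integrals: cut the interval into slices of equal length h, compare each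
    slice with its left neighbour, and let h tend to 0. *)
Lemma integral_eq0_of_gap G a b : a < b ->
  measurable_fun setT G -> (forall t, 0 <= G t)%E ->
  (forall e : R, 0 < e -> \forall h \near 0^'+,
     forall t, a <= t <= a + h -> (G t <= e%:E)%E) ->
  (forall e : R, 0 < e -> exists B : T * T -> \bar R,
    [/\ measurable_fun setT B, forall z, (0 <= B z)%E,
      \forall h \near 0^'+,
        (\int[dt]_(t in `[(a + h)%R, b]) B ((t - h)%R, t) <= e%:E)%E &
      {ae dt, forall t, a < t <= b -> forall r, a <= r < t ->
        (G t <= G r + \int[dt]_(x in `[r, t]) B (x, t))%E}]) ->
  (\int[dt]_(t in `[a, b]) G t = 0)%E.
Proof.
move=> ab mG G0 Ga HB.
suff H (e : R) : 0 < e -> (\int[dt]_(t in `[a, b]) G t <= e%:E)%E.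
  apply/eqP; rewrite eq_le integral_ge0// andbT.
  by apply/lee_addgt0Pr => e e0; rewrite add0e; exact: H.
move=> e0.
(* each of the N slices, of length h = (b - a) / N, will contribute 2 h e1 *)
pose e1 := e / (2 * (b - a)).
have e10 : 0 < e1 by rewrite divr_gt0// mulr_gt0// subr_gt0.
have [B [mB B0 Bh Bgap]] := HB _ e10.
have [d /= d0 dP] := filterI (Ga _ e10) Bh.
pose N := (Num.truncn ((b - a) / d)).+1.
pose h := (b - a) / N%:R.
have N0 : 0 < N%:R :> R by rewrite ltr0n.
have h0 : 0 < h by rewrite divr_gt0// subr_gt0.
have hd : h < d.
  rewrite /h ltr_pdivrMr// mulrC -ltr_pdivrMr//.
  by rewrite /N; apply: truncnS_gt.
have Nh : a + N%:R * h = b by rewrite /h mulrC divfK ?gt_eqF//; lra.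
have dP' k : 0 < k <= h -> (forall t, a <= t <= a + k -> (G t <= e1%:E)%E) /\
    (\int[dt]_(t in `[(a + k)%R, b]) B ((t - k)%R, t) <= e1%:E)%E.
  move=> /andP[k0 kh]; apply: dP => //=.
  by rewrite sub0r normrN gtr0_norm//; exact: le_lt_trans hd.
pose Bk (z : T * T) : \bar R := B ((z.1 - h + z.2)%R, z.1).
have mBk : measurable_fun setT Bk.
  apply: (measurableT_comp mB); apply: measurable_fun_pair => //.
  apply: measurable_funD => //.
  exact: (measurableT_comp (measurable_translate (- h)) measurable_fst).
have Bk0 z : (0 <= Bk z)%E by exact: B0.
(* rho t is the increment allowed between t - h and t; with the shift k running
   over [0, h] its integral is a superposition of integrals near the diagonal *)
pose rho (t : R) := (\int[dt]_(k in `[0%R, h]) Bk (t, k))%E.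
have mrho : measurable_fun setT rho.
  by apply: (measurable_fun_integral2 (f := Bk)) => // z; exact: B0.
have rho0 t : (0 <= rho t)%E by exact: integral_ge0.
have rhoE t : rho t = (\int[dt]_(x in `[(t - h)%R, t]) B (x, t))%E.
  rewrite /rho /Bk /=.
  under eq_integral do rewrite addrC.
  rewrite (ge0_integral_itv_translate (fun x => B (x, t)) (t - h))//.
    by rewrite add0r addrCA subrr addr0.
  exact: (@measurable_fun_pair1 _ _ _ T T _ _ t mB).
have rho_le : (\int[dt]_(t in `[(a + h)%R, b]) rho t <= (h * e1)%:E)%E.
  rewrite (integral_setX_swap (f := Bk))//.
  have mI : measurable_fun setT
      (fun k : T => \int[dt]_(t in `[(a + h)%R, b]) Bk (t, k))%E.
    by apply: (measurable_fun_integral1 (f := Bk)) => // z; exact: B0.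
  rewrite -integral_itv_bndo_bndc; last exact: measurable_funTS.
  apply: (@le_trans _ _ (\int[dt]_(k in `[0%R, h[) e1%:E)%E).
    apply: ge0_le_integral => //.
    - by move=> k _; exact: integral_ge0.
    - exact: measurable_funTS.
    - move=> k /=; rewrite in_itv /= => /andP[k0 kh].
      have [|_ H] := dP' (h - k); first by apply/andP; split; lra.
      apply: le_trans H.
      have mB' : measurable_fun setT (fun t : R => B ((t - (h - k))%R, t)).
        apply: (measurableT_comp mB); apply: measurable_fun_pair => //.
        exact: (measurable_translate (- (h - k))).
      rewrite /Bk /=.
      under eq_integral do rewrite -addrA [(- h + k)%R]addrC -opprB.
      apply: ge0_subset_integral => //; first exact: measurable_funTS.
      move=> t /=; rewrite !in_itv /= => /andP[+ ->]; rewrite andbT; lra.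
  rewrite integral_cst//= lebesgue_measure_itv /= lte_fin h0 oppr0 adde0.
  by rewrite -EFinM mulrC.
pose s n := a + n%:R * h.
have sS n : s n.+1 = s n + h by rewrite /s -addn1 natrD; lra.
have s_le n m : (n <= m)%N -> s n <= s m.
  by move=> nm; rewrite /s lerD2l ler_wpM2r ?ler_nat// ltW.
(* each slice is compared with its left neighbour, with no loss of a factor, so
   that the error over all slices is a single integral of rho *)
have slice n : (n.+1 < N)%N -> (\int[dt]_(t in `[s n.+1, s n.+2]) G t <=
    \int[dt]_(t in `[s n, s n.+1]) G t +
    \int[dt]_(t in `[s n.+1, s n.+2]) rho t)%E.
  move=> nN.
  have mGh : measurable_fun setT (fun t : R => G (t - h)).
    exact: (measurableT_comp mG (measurable_translate (- h))).
  have sb : s n.+2 <= b by rewrite -Nh; exact: s_le.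
  have as1 : a <= s n by rewrite -[a]addr0 -[0](mul0r h); exact: (s_le 0%N n).
  have -> : (\int[dt]_(t in `[s n, s n.+1]) G t =
             \int[dt]_(t in `[s n.+1, s n.+2]) G (t - h)%R)%E.
    rewrite (ge0_integral_itv_translate G (- h))//.
    by rewrite !sS !addrK.
  rewrite -ge0_integralD//; [|exact: measurable_funTS..].
  apply: ae_ge0_le_integral => //.
  - exact: measurable_funTS.
  - by move=> t _; rewrite adde_ge0.
  - by apply: measurable_funTS; exact: emeasurable_funD.
  - move: Bgap; apply: ae_imp => t Ht /=; rewrite in_itv /= => /andP[st ts].
    have sn := sS n; have sn1 := sS n.+1.
    clear -Ht st ts sn sn1 rhoE h0 as1 sb.
    by rewrite rhoE; apply: Ht; apply/andP; split; lra.
have slice_le n : (n < N)%N -> (\int[dt]_(t in `[s n, s n.+1]) G t <=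
    (h * e1)%:E + \int[dt]_(t in `[s 1%N, s n.+1]) rho t)%E.
  elim: n => [_|n IH nN].
    rewrite -[leLHS]adde0 leeD//; last exact: integral_ge0.
    apply: (@le_trans _ _ (\int[dt]_(t in `[s 0%N, s 1%N]) e1%:E)%E).
      apply: ge0_le_integral => //; first exact: measurable_funTS.
      move=> t /=; rewrite in_itv /= => tI.
      have [|H _] := dP' h; first by rewrite h0 lexx.
      by apply: H; move: tI; rewrite sS /s mul0r addr0.
    rewrite integral_cst//= lebesgue_measure_itv /= lte_fin sS ltrDl h0.
    by rewrite -EFinB -EFinM addrC addKr mulrC.
  apply: (le_trans (slice _ nN)).
  rewrite (ge0_integral_itv_split _ (s 1%N) (s n.+1))//; try exact: s_le.
  rewrite [leRHS]addeA leeD//.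
  exact: IH (ltnW nN).
have slice_le2 n : (n < N)%N ->
    (\int[dt]_(t in `[s n, s n.+1]) G t <= (2 * h * e1)%:E)%E.
  move=> nN; apply: (le_trans (slice_le _ nN)).
  rewrite -mulrA mulr_natl mulr2n EFinD leeD//; apply: le_trans rho_le.
  rewrite -Nh (_ : a + h = s 1%N); last by rewrite /s mul1r.
  apply: ge0_subset_integral => //; first exact: measurable_funTS.
  move=> t /=; rewrite !in_itv /= => /andP[-> /=]; move=> /le_trans; apply.
  exact: (s_le n.+1 N).
have total n : (n <= N)%N ->
    (\int[dt]_(t in `[s 0%N, s n]) G t <= (n%:R * (2 * h * e1))%:E)%E.
  elim: n => [_|n IH nN].
    by rewrite set_itv1 integral_set1// mul0r.
  rewrite (ge0_integral_itv_split _ (s 0%N) (s n))//; try exact: s_le.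
  rewrite -addn1 natrD mulrDl mul1r EFinD leeD//; first exact/IH/ltnW.
  by rewrite addn1; exact: slice_le2.
have := total N (leqnn N); rewrite /s Nh mul0r addr0 => /le_trans; apply.
rewrite lee_fin /h /e1; have ba : b - a != 0 by rewrite gt_eqF// subr_gt0.
rewrite le_eqVlt; apply/orP; left; apply/eqP; field.
by rewrite ba gt_eqF.
Qed.

End gap.

(** * Compact sets in R^n *)

Section space.
Context {R : realType} {n : nat}.
Local Notation E := 'rV[R]_n.
Local Notation dx := (@lebesgue_rV R n).
Implicit Types (x y : E) (A K : set E) (r : R).

Lemma coord_le_norm x i : `|x ord0 i| <= `|x|.
Proof.
by rewrite [leRHS]/Num.Def.normr /= mx_normrE (le_bigmax _ (fun ij => `|x ij.1 ij.2|) (ord0, i)).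
Qed.

Lemma norm_rV_le x r : 0 <= r -> (forall i, `|x ord0 i| <= r) -> `|x| <= r.
Proof.
move=> r0 H; rewrite [leLHS]/Num.Def.normr /= mx_normrE; apply/bigmax_leP.
by split => // -[i j] _ /=; rewrite ord1.
Qed.

Lemma norm_rV_lt x r : 0 < r -> (forall i, `|x ord0 i| < r) -> `|x| < r.
Proof.
move=> r0 H; rewrite [ltLHS]/Num.Def.normr /= mx_normrE; apply/bigmax_ltP.
by split => // -[i j] _ /=; rewrite ord1.
Qed.

Definition box (A : 'I_n -> set R) : set E := [set x | forall i, A i (x ord0 i)].

Lemma measurable_box (A : 'I_n -> set R) :
  (forall i, measurable (A i)) -> measurable (box A).
Proof.
move=> mA; rewrite (_ : box A = \bigcap_(i in [set: 'I_n])
    ((fun x : E => x ord0 i) @^-1` A i)).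
  apply: fin_bigcap_measurable => [|i _]; first exact: finite_finset.
  by rewrite -[X in measurable X]setTI; apply: measurable_rV_coord => //; exact: mA.
by apply/seteqP; split => x /= h i; [move=> _|]; exact: h.
Qed.

(** The sigma-algebra is generated by the coordinates, so an open set is
    measurable because it is a countable union of rational boxes. *)
Lemma open_measurable_rV A : open A -> measurable A.
Proof.
move=> oA.
pose B (c : 'rV[rat]_n * nat) := box (fun i : 'I_n =>
  `]ratr (c.1 ord0 i) - c.2.+1%:R^-1, ratr (c.1 ord0 i) + c.2.+1%:R^-1[%classic : set R).
pose F c := if `[< B c `<=` A >] then B c else set0.
have -> : A = \bigcup_c F c.
  apply/seteqP; split => [x Ax|x [c _]]; last first.
    by rewrite /F; case: asboolP => // BA; exact: BA.
  have [r r0 rA] : exists2 r, 0 < r & forall y, `|x - y| < r -> A y.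
    have /nbhs_ballP[r r0 rA] := open_nbhs_nbhs (conj oA Ax).
    by exists r => // y xy; apply: rA; rewrite -ball_normE.
  have [k kr] : exists k, k.+1%:R^-1 < r / 2.
    have [k kr] := ltr_add_invr (divr_gt0 r0 (ltr0Sn R 1)).
    by exists k; move: kr; rewrite add0r.
  have k0 : 0 < k.+1%:R^-1 :> R by rewrite invr_gt0.
  have /boolp.choice [q hq] : forall i, exists q : rat, ratr q \in
      `]x ord0 i - k.+1%:R^-1, x ord0 i + k.+1%:R^-1[.
    move=> i.
    have [|q ?] := @rat_in_itvoo R (x ord0 i - k.+1%:R^-1) (x ord0 i + k.+1%:R^-1).
      by move: (k.+1%:R^-1 : R) k0 => e e0; lra.
    by exists q.
  have Bx : B (\row_i q i, k) x.
    move=> i /=; rewrite mxE in_itv /=; have := hq i; rewrite in_itv /=.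
    by move: (k.+1%:R^-1 : R) => e /andP[H1 H2]; apply/andP; split; lra.
  exists (\row_i q i, k) => //; rewrite /F; case: asboolP => // -[].
  move=> y By; apply: rA; apply: norm_rV_lt => // i; rewrite !mxE.
  have := By i; rewrite /= mxE in_itv /= => /andP[H1 H2].
  have := hq i; rewrite in_itv /= => /andP[H3 H4].
  move: (k.+1%:R^-1 : R) kr H1 H2 H3 H4 => e er H1 H2 H3 H4.
  by rewrite ltr_norml; apply/andP; split; lra.
apply: countable_bigcupT_measurable => // c; rewrite /F; case: ifPn => // _.
by apply: measurable_box => i.
Qed.

Lemma closed_measurable_rV A : closed A -> measurable A.
Proof.
by rewrite -openC => /open_measurable_rV mA; rewrite -(setCK A); exact: measurableC.
Qed.

Lemma compact_measurable_rV A : compact A -> measurable A.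
Proof.
by move=> cA; apply: closed_measurable_rV; apply: compact_closed cA.
Qed.

Lemma lebesgue_rV_cube r : 0 <= r ->
  dx (box (fun=> `[- r, r]%classic)) = ((2 * r) ^+ n)%:E.
Proof.
move=> r0.
transitivity (\prod_(i < n) lebesgue_measure (`[(- r)%R, r]%classic : set R))%E.
  exact: lebesgue_rV_box.
rewrite (eq_bigr (fun=> (2 * r)%:E)); last first.
  move=> i _; rewrite lebesgue_measure_itv /= lte_fin; case: ifPn => [_|].
    by rewrite -EFinB; congr EFin; ring.
  by rewrite -leNgt => ?; congr EFin; lra.
by rewrite prodEFin big_const_ord iter_mulr_1.
Qed.

Lemma compact_sub_cube A : compact A ->
  exists2 r, 0 <= r & A `<=` box (fun=> `[- r, r]%classic).
Proof.
move=> /compact_bounded [M [_ HM]].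
have M1 : M < `|M| + 1 by rewrite (le_lt_trans (ler_norm M))// ltrDl.
exists (`|M| + 1); first by rewrite addr_ge0.
move=> x Ax i /=; rewrite in_itv /= -ler_norml.
exact: le_trans (coord_le_norm x i) (HM _ M1 _ Ax).
Qed.

Lemma compact_lebesgue_rV_lty A : compact A -> (dx A < +oo)%E.
Proof.
move=> cA; have [r r0 Ar] := compact_sub_cube A cA.
apply: (@le_lt_trans _ _ (dx (box (fun=> `[- r, r]%classic)))).
  rewrite le_measure// inE; first exact: compact_measurable_rV.
  exact: measurable_box.
by rewrite lebesgue_rV_cube// ltry.
Qed.

(** K1 is the closed r-neighbourhood of K: the sum of K and a closed ball, which
    is compact. *)
Lemma compact_neighborhood K A : compact K -> open A -> K `<=` A ->
  exists2 r, 0 < r & exists2 K1, compact K1 &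
    [/\ K `<=` K1, K1 `<=` A & forall x y, K x -> ~ K1 y -> r <= `|x - y|].
Proof.
move=> cK oA KA.
have /compact_near_coveringP/(_ R (0^'+)
  (fun r x => forall y, `|x - y| <= r -> A y)) := cK.
have near_x x : K x -> \forall x' \near x & r \near 0^'+,
    forall y, `|x' - y| <= r -> A y.
  move=> Kx; have /nbhs_ballP[r /= r0 rA] := open_nbhs_nbhs (conj oA (KA _ Kx)).
  exists (ball x (r / 2), [set h | 0 < h < r / 2]) => /=.
    have r20 : 0 < r / 2 by rewrite divr_gt0.
    split; first exact: nbhsx_ballx.
    apply: filterS2 (nbhs_right_gt (0 : R)) (nbhs_right_lt r20) => h h0 hr2.
    exact/andP.
  move=> [z h] /= [+ /andP[h0 hr]]; rewrite -ball_normE /= => xz y zy.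
  apply: rA; rewrite -ball_normE /=.
  have := ler_distD z x y; lra.
move=> /(_ _ near_x) rK.
have [r [r0 rP]] := filter_ex (filterI (nbhs_right_gt (0 : R)) rK).
exists r => //.
pose Q : set E := box (fun=> `[- r, r]%classic).
have QE y : Q y <-> `|y| <= r.
  split=> [Qy|yr i /=]; last first.
    by rewrite in_itv /= -ler_norml (le_trans (coord_le_norm y i)).
  apply: norm_rV_le => [|i]; first exact: ltW.
  by rewrite ler_norml; have := Qy i; rewrite /= in_itv.
exists ((fun z : E * E => z.1 + z.2) @` (K `*` Q)).
  apply: continuous_compact.
    by apply: continuous_subspaceT => z; exact: add_continuous.
  apply: compact_setX => //; apply: (@rV_compact _ _ (fun=> `[- r, r]%classic)).
  by move=> _; exact: segment_compact.
split.
- move=> x Kx; exists (x, 0); last by rewrite /= addr0.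
  by split => //=; apply/QE; rewrite normr0 ltW.
- move=> _ [[x y] [/= Kx /QE yr] <-] /=.
  by apply: (rP x Kx); rewrite opprD addrA subrr sub0r normrN.
- move=> x y Kx K1y; rewrite leNgt; apply/negP => xyr; apply: K1y.
  exists (x, y - x); last by rewrite /= addrC subrK.
  by split => //=; apply/QE; rewrite distrC ltW.
Qed.

End space.

(** * The kernel and the tail weight *)

Section euclidean_norm.
Context {R : realType} {n : nat}.
Local Notation E := 'rV[R]_n.
Local Notation dx := (@lebesgue_rV R n).
Implicit Types (x y : E).

Lemma eucl_ge0 x : 0 <= eucl x.
Proof. exact: sqrtr_ge0. Qed.

Lemma euclN x : eucl (- x) = eucl x.
Proof.
by rewrite /eucl; congr Num.sqrt; apply: eq_bigr => i _; rewrite mxE sqrrN.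
Qed.

Lemma eucl_distC x y : eucl (x - y) = eucl (y - x).
Proof. by rewrite -euclN opprB. Qed.

Lemma norm_le_eucl x : `|x| <= eucl x.
Proof.
apply: norm_rV_le => [|i]; first exact: eucl_ge0.
rewrite -sqrtr_sqr ler_wsqrtr// (bigD1 i)//= lerDl.
by apply: sumr_ge0 => j _; exact: sqr_ge0.
Qed.

Lemma eucl_le_norm x : eucl x <= n%:R * `|x|.
Proof.
have nx0 : 0 <= n%:R * `|x| by rewrite mulr_ge0.
rewrite -(ger0_norm nx0) -sqrtr_sqr ler_wsqrtr//.
apply: (@le_trans _ _ (\sum_(i < n) `|x| ^+ 2)).
  apply: ler_sum => i _; rewrite -[leLHS]real_normK ?num_real//.
  by rewrite ler_sqr ?nnegrE// coord_le_norm.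
rewrite sumr_const card_ord -[leLHS]mulr_natl exprMn ler_wpM2r ?sqr_ge0//.
by rewrite -natrX ler_nat; case: (n) => // m; rewrite leq_pmulr.
Qed.

Lemma measurable_eucl : measurable_fun setT (eucl : E -> R).
Proof.
rewrite (_ : eucl = (fun x : E => (\sum_(i < n) x ord0 i ^+ 2) `^ 2^-1)).
  apply: (measurableT_comp (measurable_powR _)).
  apply: measurable_sum => i; apply: measurable_funX.
  exact: measurable_rV_coord.
apply/funext => x; rewrite powR12_sqrt//.
by apply: sumr_ge0 => i _; exact: sqr_ge0.
Qed.

Definition tail_weight (q : R) x : R := (1 + eucl x `^ q)^-1.

Lemma tail_weight_gt0 q x : 0 < tail_weight q x.
Proof. by rewrite invr_gt0 ltr_wpDr ?powR_ge0. Qed.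

Lemma tail_weight_ge0 q x : 0 <= tail_weight q x.
Proof. exact/ltW/tail_weight_gt0. Qed.

Lemma tail_weight_le1 q x : tail_weight q x <= 1.
Proof. by rewrite invf_le1 ?lerDl ?powR_ge0// ltr_wpDr ?powR_ge0. Qed.

Lemma measurable_tail_weight q : measurable_fun setT (tail_weight q).
Proof.
rewrite (_ : tail_weight q = (fun x => (1 + eucl x `^ q) `^ (- 1))).
  apply: (measurableT_comp (measurable_powR _)); apply: measurable_funD => //.
  by apply: (measurableT_comp (measurable_powR _)); exact: measurable_eucl.
by apply/funext => x; rewrite powR_inv1// addr_ge0 ?powR_ge0.
Qed.

(** Dyadic decomposition: on the shell between the cubes of half-side 2^(k-1)
    and 2^k the weight is at most a constant times 2^(-kq), while the cube has
    measure of order 2^(kn). *)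
Lemma tail_weight_integrable q : n%:R < q ->
  (\int[dx]_x (tail_weight q x)%:E < +oo)%E.
Proof.
move=> nq; have q0 : 0 < q by rewrite (le_lt_trans _ nq).
pose cube k : set E := box (fun=> `[- (2 ^+ k), 2 ^+ k]%classic).
have mcube k : measurable (cube k) by exact: measurable_box.
pose c k : R := 2 `^ q * (2 `^ (- q)) ^+ k.
have c0 k : 0 <= c k by rewrite mulr_ge0 ?exprn_ge0 ?powR_ge0.
pose g k x : \bar R := (c k * \1_(cube k) x)%:E.
have g0 k x : (0 <= g k x)%E by rewrite lee_fin mulr_ge0.
have mg k : measurable_fun setT (g k).
  by apply/measurable_EFinP; apply: measurable_funM.
have in_cube x k : `|x| <= 2 ^+ k -> \1_(cube k) x = 1 :> R.
  move=> xk; rewrite indicE mem_set// => i /=; rewrite in_itv /= -ler_norml.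
  exact: le_trans (coord_le_norm x i) xk.
have c2 k : c k.+1 = (2 ^+ k) `^ (- q).
  rewrite /c exprS mulrA powRN divff ?mul1r ?gt_eqF ?powR_gt0//.
  by rewrite -!powR_mulrn ?powR_ge0 ?invr_ge0 ?powR_ge0// -powRN -!powRrM mulrC.
have le_g x : exists k, ((tail_weight q x)%:E <= g k x)%E.
  have exk : exists k, `|x| <= 2 ^+ k.
    exists (Num.truncn `|x|).+1.
    apply: (@le_trans _ _ (Num.truncn `|x|).+1%:R).
      by apply/ltW/truncnS_gt.
    by rewrite -natrX ler_nat ltnW// ltn_expl.
  have [k xk kmin] := ex_minnP exk; exists k; rewrite lee_fin.
  case: k xk kmin => [|k] xk kmin.
    rewrite in_cube// mulr1; apply: le_trans (tail_weight_le1 q x) _.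
    by rewrite /c expr0 mulr1 -[leLHS](powRr0 2) ler_powR ?ltW// ltr1n.
  rewrite in_cube// mulr1 c2 powRN lef_pV2 ?posrE ?powR_gt0 ?ltr_wpDr ?powR_ge0//.
  have kx : 2 ^+ k < `|x|.
    by rewrite ltNge; apply/negP => /kmin; rewrite ltnn.
  rewrite ler_wpDl// ge0_ler_powR ?nnegrE ?exprn_ge0 ?eucl_ge0 ?(ltW q0)//.
  exact: le_trans (ltW kx) (norm_le_eucl x).
apply: (@le_lt_trans _ _ (\int[dx]_x \sum_(k <oo) g k x)%E).
  apply: ge0_le_integral => //.
  - by move=> x _; rewrite lee_fin tail_weight_ge0.
  - by apply/measurable_EFinP; exact: measurable_tail_weight.
  - by apply: ge0_emeasurable_sum.
  - move=> x _; have [k xk] := le_g x; apply: le_trans xk _.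
    rewrite (nneseriesD1 (n := k))// leeDl//.
    exact: nneseries_ge0.
rewrite integral_nneseries//.
pose a : R := 2 `^ q * 2 ^+ n.
pose z : R := 2 `^ (- q) * 2 ^+ n.
have ge k : (\int[dx]_x g k x)%E = (geometric a z k)%:E.
  rewrite /g; under eq_integral do rewrite EFinM.
  rewrite ge0_integralZl//; [|exact/measurable_EFinP|exact: c0].
  have -> : (\int[dx]_x (\1_(cube k) x)%:E = ((2 * 2 ^+ k) ^+ n)%:E)%E.
    by rewrite integral_indic// setIT; apply: lebesgue_rV_cube; rewrite exprn_ge0.
  rewrite -EFinM /geometric /= /a /z /c; congr EFin.
  by rewrite !exprMn -!exprM (mulnC k); ring.
have z0 : 0 < z by rewrite mulr_gt0 ?powR_gt0 ?exprn_gt0.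
have z1 : `|z| < 1.
  rewrite gtr0_norm// /z -powR_mulrn// -powRD; last by rewrite pnatr_eq0 implybT.
  rewrite addrC -opprB powRN invf_lt1 ?powR_gt0//.
  apply: (@le_lt_trans _ _ (1 `^ (q - n%:R))); first by rewrite powR1.
  by rewrite gt0_ltr_powR ?nnegrE ?subr_gt0 ?ltr1n.
have a0 : 0 <= a by rewrite mulr_ge0 ?powR_ge0 ?exprn_ge0.
apply: (@le_lt_trans _ _ (a * (1 - z)^-1)%:E); last by rewrite ltry.
under eq_eseriesr do rewrite ge.
apply: lime_le; first by apply: is_cvg_nneseries => k _ _; rewrite lee_fin geometric_ge0// ltW.
apply: nearW => m; rewrite sumEFin lee_fin.
exact: geometric_le_lim.
Qed.

(** For x in the bounded set K and y at distance at least r from x, both 1 and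
    the size of y are at most a constant multiple of |x - y|. *)
Lemma kernel_le_tail_weight (K K1 : set E) (r q : R) : 0 < q -> 0 < r ->
  compact K -> (forall x y, K x -> ~ K1 y -> r <= `|x - y|) ->
  exists2 C, 0 < C & forall x y, K x -> ~ K1 y ->
    (eucl (x - y) `^ q)^-1 <= C * tail_weight q y.
Proof.
move=> q0 r0 cK rK; have [M M0 KM] := compact_sub_cube K cK.
pose C := r^-1 `^ q + (n%:R * (M / r + 1)) `^ q.
exists C; first by rewrite ltr_wpDr ?powR_gt0 ?powR_ge0// invr_gt0.
move=> x y Kx K1y.
have xy := rK _ _ Kx K1y.
have exy : r <= eucl (x - y) by exact: le_trans xy (norm_le_eucl _).
have e0 : 0 < eucl (x - y) by exact: lt_le_trans exy.
have xM : `|x| <= M.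
  by apply: norm_rV_le => // i; rewrite ler_norml; have := KM _ Kx i; rewrite /= in_itv.
rewrite ler_pdivlMr ?ltr_wpDr ?powR_ge0//.
rewrite mulrC ler_pdivrMr ?powR_gt0// /C mulrDl lerD//.
  rewrite -powRM ?invr_ge0 ?(ltW r0) ?(ltW e0)//.
  apply: (@le_trans _ _ (1 `^ q)); first by rewrite powR1.
  rewrite ge0_ler_powR ?nnegrE ?mulr_ge0 ?invr_ge0 ?(ltW r0) ?(ltW e0) ?(ltW q0)//.
  by rewrite ler_pdivlMl// mulr1.
rewrite -powRM ?(ltW e0)//; last first.
  by rewrite mulr_ge0// addr_ge0// divr_ge0// ltW.
rewrite ge0_ler_powR ?nnegrE ?eucl_ge0 ?(ltW q0)//.
  by rewrite !mulr_ge0 ?eucl_ge0// addr_ge0// divr_ge0// ltW.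
rewrite (le_trans (eucl_le_norm y))// -mulrA ler_wpM2l// mulrDl mul1r.
have : `|y| <= `|x| + `|x - y|.
  by rewrite -{1}(subKr x y) (le_trans (ler_normB _ _)).
move/le_trans; apply; rewrite lerD// ?norm_le_eucl//.
rewrite (le_trans xM)// mulrAC ler_pdivlMr// ler_wpM2l//.
Qed.

End euclidean_norm.

(** * Pointwise bounds for the nonlocal form *)

Section product_integrals.
Local Open Scope ereal_scope.
Context d (T : measurableType d) (R : realType).
Variable mu : {sigma_finite_measure set T -> \bar R}.
Implicit Types f g : T -> R.

Lemma integral_indic_mul (nu : {measure set T -> \bar R}) (D : set T) f :
  \int[nu]_x (\1_D x * f x)%:E = \int[nu]_(x in D) (f x)%:E.
Proof.
rewrite [RHS]integral_mkcond; apply: eq_integral => x _.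
by rewrite /patch indicE; case: ifP => _; rewrite ?mul1r ?mul0r.
Qed.

Lemma ge0_integral_tensor f g : measurable_fun setT f -> measurable_fun setT g ->
  (forall x, 0 <= f x)%R -> (forall x, 0 <= g x)%R ->
  \int[mu \x mu]_z (f z.1 * g z.2)%:E =
  \int[mu]_x (f x)%:E * \int[mu]_x (g x)%:E.
Proof.
move=> mf mg f0 g0.
have G0 : 0 <= \int[mu]_y (g y)%:E.
  by apply: integral_ge0 => y _; rewrite lee_fin.
transitivity (\int[mu]_x ((f x)%:E * \int[mu]_y (g y)%:E)).
  transitivity (\int[mu]_x \int[mu]_y (f x * g y)%:E).
    apply: (fubini_tonelli1 (fun z => (f z.1 * g z.2)%:E)).
      apply/measurable_EFinP; apply: measurable_funM.
        exact: (measurableT_comp mf measurable_fst).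
      exact: (measurableT_comp mg measurable_snd).
    by move=> z; rewrite lee_fin mulr_ge0.
  apply: eq_integral => x _; under eq_integral do rewrite EFinM.
  rewrite ge0_integralZl//.
  - exact/measurable_EFinP.
  - by move=> y _; rewrite lee_fin.
  - by rewrite lee_fin.
under eq_integral do rewrite muleC.
rewrite ge0_integralZl//; first by rewrite muleC.
  exact/measurable_EFinP.
by move=> x _; rewrite lee_fin.
Qed.

Let mfst f : measurable_fun setT f -> measurable_fun setT (fun z : T * T => f z.1).
Proof. by move=> mf; exact: (measurableT_comp mf measurable_fst). Qed.

Let msnd f : measurable_fun setT f -> measurable_fun setT (fun z : T * T => f z.2).
Proof. by move=> mf; exact: (measurableT_comp mf measurable_snd). Qed.

(** Tensor products are symmetrized because the form is symmetric in (x, y) while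
    the bounds below distinguish which point lies in K0. *)
Definition cross f g (z : T * T) : R := (f z.1 * g z.2 + f z.2 * g z.1)%R.

Lemma cross_ge0 f g z : (forall x, 0 <= f x)%R -> (forall x, 0 <= g x)%R ->
  (0 <= cross f g z)%R.
Proof. by move=> f0 g0; rewrite addr_ge0// mulr_ge0. Qed.

Lemma measurable_cross f g : measurable_fun setT f -> measurable_fun setT g ->
  measurable_fun setT (cross f g).
Proof.
move=> mf mg; rewrite /cross.
by apply: measurable_funD; apply: measurable_funM;
  [exact: mfst|exact: msnd|exact: msnd|exact: mfst].
Qed.

Lemma ge0_integral_cross f g :
  measurable_fun setT f -> measurable_fun setT g ->
  (forall x, 0 <= f x)%R -> (forall x, 0 <= g x)%R ->
  \int[mu \x mu]_z (cross f g z)%:E =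
  2%:E * (\int[mu]_x (f x)%:E * \int[mu]_x (g x)%:E).
Proof.
move=> mf mg f0 g0; rewrite /cross; under eq_integral do rewrite EFinD.
rewrite ge0_integralD//; last 4 first.
- by move=> z _; rewrite lee_fin mulr_ge0.
- by apply/measurable_EFinP; apply: measurable_funM; [exact: mfst|exact: msnd].
- by move=> z _; rewrite lee_fin mulr_ge0.
- by apply/measurable_EFinP; apply: measurable_funM; [exact: msnd|exact: mfst].
rewrite ge0_integral_tensor//.
under [X in _ + X = _]eq_integral do rewrite mulrC.
rewrite ge0_integral_tensor// [X in _ + X = _]muleC.
by rewrite mule_natl mule2n.
Qed.

End product_integrals.
Arguments cross {d T R}.
Arguments cross_ge0 {d T R}.
Arguments measurable_cross {d T R f g}.
Arguments ge0_integral_cross {d T R mu f g}.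
Arguments integral_indic_mul {d T R nu}.

Section nonlocal_bounds.
Context {R : realType} {n : nat}.
Local Notation E := 'rV[R]_n.
Local Notation dx := (@lebesgue_rV R n).
Variables (p q : R) (K0 K1 : set E) (C : R).
Hypotheses (p1 : 1 < p) (C0 : 0 < C).
Hypothesis K01 : K0 `<=` K1.
Hypothesis kernelC : forall x y, K0 x -> ~ K1 y ->
  (eucl (x - y) `^ q)^-1 <= C * tail_weight q y.
Implicit Types (v xi : E -> R) (z : E * E).

Let p0 : 0 < p. Proof. exact: lt_trans ltr01 p1. Qed.
Let pm1 : 0 <= p - 1. Proof. by rewrite subr_ge0 ltW. Qed.
Let powp0 : 0 `^ p = 0 :> R. Proof. by rewrite powR0 ?gt_eqF. Qed.
Let tw0 := @tail_weight_ge0 R n q.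

(** The integrand of the Gagliardo seminorm. *)
Definition gag (f : E -> R) z : R :=
  `|f z.1 - f z.2| `^ p / eucl (z.1 - z.2) `^ q.

Definition tail_integrand v x := `|v x| `^ (p - 1) * tail_weight q x.

Lemma gag_ge0 f z : 0 <= gag f z.
Proof. by rewrite divr_ge0 ?powR_ge0. Qed.

Lemma tail_integrand_ge0 v x : 0 <= tail_integrand v x.
Proof. by rewrite mulr_ge0 ?powR_ge0. Qed.

(** The part of the bound that does not involve the test function. *)
Definition flux_weight v z : R := \1_(K1 `*` K1) z * gag v z +
  C * 2 `^ p * (cross (fun x => \1_K0 x * `|v x| `^ p) (tail_weight q) z +
                cross (\1_K0) (tail_integrand v) z).

(** The part that is homogeneous of degree p in the test function. *)
Definition test_weight v xi z : R := \1_(K1 `*` K1) z * gag xi z +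
  C * 2 `^ p * (cross (fun x => `|xi x| `^ p) (tail_weight q) z +
                cross (fun x => `|xi x| `^ p) (tail_integrand v) z).

(** Young's inequality applied to each of the two terms that bound |a - a'|^(p-1);
    a' enters only through its power p - 1, the one controlled by the tail. *)
Lemma far_Young (a a' b e : R) : 0 <= b -> 0 < e ->
  `|a - a'| `^ (p - 1) * b <=
  2 `^ p * (e * (`|a| `^ p + `|a'| `^ (p - 1)) +
            e `^ (1 - p) * (b `^ p * (1 + `|a'| `^ (p - 1)))).
Proof.
move=> b0 e0; set A := `|a'| `^ (p - 1).
have A0 : 0 <= A by exact: powR_ge0.
have le1 : `|a - a'| `^ (p - 1) <= 2 `^ p * (`|a| `^ (p - 1) + A).
  apply: (@le_trans _ _ ((`|a| + `|a'|) `^ (p - 1))).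
    by rewrite ge0_ler_powR ?nnegrE ?ler_normB// addr_ge0.
  apply: le_trans (powRD_le _ _ _ _ _ _) _ => //.
  by rewrite ler_wpM2r ?addr_ge0 ?powR_ge0// ler_powR ?ler1n// gerBl.
apply: le_trans (ler_wpM2r b0 le1) _; rewrite -mulrA ler_wpM2l ?powR_ge0//.
have Ya := powR_Young_eps `|a| b e p p1 (normr_ge0 a) b0 e0.
have := powR_Young_eps 1 b e p p1 ler01 b0 e0; rewrite !powR1 mul1r mulr1 => Yb.
have := ler_wpM2l A0 Yb; move: Ya.
move: (`|a| `^ p) (e `^ (1 - p)) (b `^ p) (`|a| `^ (p - 1)) => u1 u2 u3 u4.
lra.
Qed.

Lemma far_flux_le v xi x y (e : R) : 0 < e -> K0 x -> ~ K1 y -> xi y = 0 ->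
  `|v x - v y| `^ (p - 1) * `|xi x - xi y| / eucl (x - y) `^ q <=
  C * 2 `^ p * (e * (`|v x| `^ p * tail_weight q y + tail_integrand v y) +
    e `^ (1 - p) * (`|xi x| `^ p * tail_weight q y + `|xi x| `^ p * tail_integrand v y)).
Proof.
move=> e0 Kx Ky xiy; rewrite xiy subr0.
apply: (@le_trans _ _ (`|v x - v y| `^ (p - 1) * `|xi x| * (C * tail_weight q y))).
  by rewrite ler_wpM2l ?mulr_ge0 ?powR_ge0//; exact: kernelC.
have := ler_wpM2r (mulr_ge0 (ltW C0) (tw0 y)) (far_Young (v x) (v y) _ _ (normr_ge0 (xi x)) e0).
move/le_trans; apply; rewrite /tail_integrand le_eqVlt; apply/orP; left; apply/eqP; ring.
Qed.

(** On K1 x K1 this is Young's inequality for the increments. If xi does not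
    vanish at both points of a pair outside K1 x K1, then one point is in K0 and
    the other off K1, where the kernel is no larger than the tail weight. *)
Lemma flux_bound v xi z (e : R) : 0 < e -> (forall x, ~ K0 x -> xi x = 0) ->
  `|v z.1 - v z.2| `^ (p - 1) * `|xi z.1 - xi z.2| / eucl (z.1 - z.2) `^ q <=
  e * flux_weight v z + e `^ (1 - p) * test_weight v xi z.
Proof.
move=> e0 xi0; case: z => x y /=.
have ep0 : 0 <= e `^ (1 - p) by exact: powR_ge0.
have CC0 : 0 <= C * 2 `^ p by rewrite mulr_ge0 ?powR_ge0 ?ltW.
have cr1 : 0 <= cross (fun x => \1_K0 x * `|v x| `^ p) (tail_weight q) (x, y) +
    cross (\1_K0) (tail_integrand v) (x, y).
  by rewrite addr_ge0// cross_ge0// => w; rewrite ?mulr_ge0 ?powR_ge0 ?tail_integrand_ge0.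
have cr2 : 0 <= cross (fun x => `|xi x| `^ p) (tail_weight q) (x, y) +
    cross (fun x => `|xi x| `^ p) (tail_integrand v) (x, y).
  by rewrite addr_ge0// cross_ge0// => w; rewrite ?powR_ge0 ?tail_integrand_ge0.
have [[K1x K1y]|nK] := pselect (K1 x /\ K1 y).
  rewrite /flux_weight /test_weight indicE mem_set//= !mul1r.
  apply: (@le_trans _ _ (e * gag v (x, y) + e `^ (1 - p) * gag xi (x, y))).
    rewrite /gag /= !mulrA -mulrDl ler_wpM2r ?invr_ge0 ?powR_ge0//.
    exact: powR_Young_eps.
  by rewrite lerD// ler_wpM2l ?(ltW e0)// lerDl mulr_ge0.
have far x' y' : K0 x' -> ~ K1 y' -> xi y' = 0.
  by move=> _ K1y'; apply: xi0 => /K01.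
rewrite /flux_weight /test_weight indicE memNset//= !mul0r !add0r.
have [K0x|nK0x] := pselect (K0 x).
  have K1y : ~ K1 y by move=> K1y; apply: nK; split => //; exact: K01.
  apply: le_trans (far_flux_le _ _ _ _ _ e0 K0x K1y (far _ _ K0x K1y)) _.
  rewrite /cross /= !indicE (mem_set K0x) memNset; last by move/K01.
  rewrite (far _ _ K0x K1y) normr0 powp0.
  by rewrite !mul1r !mul0r ?addr0 ?add0r mulrDr mulrCA [X in _ + X <= _]mulrCA.
have [K0y|nK0y] := pselect (K0 y).
  have K1x : ~ K1 x by move=> K1x; apply: nK; split => //; exact: K01.
  rewrite distrC (distrC (xi x)) eucl_distC.
  apply: le_trans (far_flux_le _ _ _ _ _ e0 K0y K1x (far _ _ K0y K1x)) _.
  rewrite /cross /= !indicE (mem_set K0y) memNset//.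
  rewrite (far _ _ K0y K1x) normr0 powp0.
  by rewrite !mul1r !mul0r ?addr0 ?add0r mulrDr mulrCA [X in _ + X <= _]mulrCA.
rewrite !xi0// subrr normr0 mulr0 mul0r.
by rewrite addr_ge0// mulr_ge0 ?(ltW e0)// mulr_ge0.
Qed.

Lemma gag_bound xi z : (forall x, ~ K0 x -> xi x = 0) ->
  gag xi z <= \1_(K1 `*` K1) z * gag xi z +
    C * cross (fun x => `|xi x| `^ p) (tail_weight q) z.
Proof.
move=> xi0; case: z => x y.
have cr2 : 0 <= C * cross (fun x => `|xi x| `^ p) (tail_weight q) (x, y).
  by rewrite mulr_ge0 ?(ltW C0)// cross_ge0// => w; rewrite powR_ge0.
have [[K1x K1y]|nK] := pselect (K1 x /\ K1 y).
  by rewrite indicE mem_set//= mul1r lerDl.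
rewrite indicE memNset//= !mul0r !add0r /gag /cross /=.
have far x' y' : K0 x' -> ~ K1 y' -> `|xi x' - xi y'| `^ p / eucl (x' - y') `^ q <=
    C * (`|xi x'| `^ p * tail_weight q y' + `|xi y'| `^ p * tail_weight q x').
  move=> K0x K1y; rewrite (xi0 y') ?subr0; last by move/K01.
  rewrite normr0 powp0.
  rewrite mul0r addr0 mulrCA ler_wpM2l ?powR_ge0//; exact: kernelC.
have [K0x|nK0x] := pselect (K0 x).
  by apply: far => // K1y; apply: nK; split => //; exact: K01.
have [K0y|nK0y] := pselect (K0 y).
  rewrite distrC eucl_distC [X in _ <= C * X]addrC.
  by apply: far => // K1x; apply: nK; split => //; exact: K01.
rewrite !xi0// subrr normr0 powp0.
by rewrite !mul0r addr0 mulr0.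
Qed.

End nonlocal_bounds.

(** * The energy at a fixed time *)

Section ae_integral.
Local Open Scope ereal_scope.
Context d (T : measurableType d) (R : realType).

Lemma integral_le_ge0 (mu : {measure set T -> \bar R}) (D : set T)
    (f g : T -> \bar R) : measurable D ->
  measurable_fun D f -> measurable_fun D g -> (forall x, D x -> 0 <= g x) ->
  {ae mu, forall x, D x -> f x <= g x} ->
  \int[mu]_(x in D) f x <= \int[mu]_(x in D) g x.
Proof.
move=> mD mf mg g0 fg; rewrite integralE.
apply: (@le_trans _ _ (\int[mu]_(x in D) f^\+ x)).
  by rewrite geeDl// oppe_le0; apply: integral_ge0 => x _.
apply: ae_ge0_le_integral => //; first exact: measurable_funepos.
move: fg; apply: ae_imp => x fgx Dx.
by rewrite funeposE ge_max fgx// g0.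
Qed.

Lemma ae_pair (mu : {sigma_finite_measure set T -> \bar R}) (P : T -> Prop) :
  {ae mu, forall x, P x} -> {ae (mu \x mu), forall z, P z.1 /\ P z.2}.
Proof.
move=> [N [mN N0 PN]].
exists ((N `*` setT) `|` (setT `*` N)); split.
- by apply: measurableU; exact: measurableX.
- apply/eqP; rewrite -measure_le0.
  apply: (le_trans (measureU2 _ _ _)); [exact: measurableX..|].
  have e1 : (mu \x mu) (N `*` setT) = 0 by rewrite product_measure1E// [X in X * _]N0 mul0e.
  have e2 : (mu \x mu) (setT `*` N) = 0 by rewrite product_measure1E// [X in _ * X]N0 mule0.
  by rewrite [X in X + _]e1 [X in _ + X]e2 adde0.
- move=> z /= nP; apply: contrapT => nN; apply: nP; split; apply: contrapT => nPz.
    by apply: nN; left; split => //; exact: PN.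
  by apply: nN; right; split => //; exact: PN.
Qed.

End ae_integral.
Arguments integral_le_ge0 {d T R mu D f g}.
Arguments ae_pair {d T R mu P}.

Section fixed_time.
Set Implicit Arguments.
Context {R : realType} {n : nat}.
Local Notation E := 'rV[R]_n.
Local Notation dx := (@lebesgue_rV R n).
Variables (s p : R) (K0 K1 : set E) (C M : R).
Local Notation q := (n%:R + s * p).
Hypotheses (s0 : 0 < s) (p2 : 2 < p) (C0 : 0 < C) (M0 : 0 <= M).
Hypotheses (cK0 : compact K0) (cK1 : compact K1).
Hypothesis K01 : K0 `<=` K1.
Hypothesis kernelC : forall x y, K0 x -> ~ K1 y ->
  (eucl (x - y) `^ q)^-1 <= C * tail_weight q y.
Implicit Types (u v w xi zeta phi : E -> R) (z : E * E) (e : R).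

Let p1 : 1 < p. Proof. by apply: lt_trans p2; rewrite ltr1n. Qed.
Let p0 : 0 < p. Proof. exact: lt_trans ltr01 p1. Qed.
Let nq : n%:R < q. Proof. by rewrite ltrDl mulr_gt0. Qed.
Let mK0 := compact_measurable_rV K0 cK0.
Let mK1 := compact_measurable_rV K1 cK1.
Let C20 : 0 <= C * 2 `^ p. Proof. by rewrite mulr_ge0 ?powR_ge0 ?ltW. Qed.

Let mfst w : measurable_fun setT w -> measurable_fun setT (fun z : E * E => w z.1).
Proof. by move=> mw; exact: (measurableT_comp mw measurable_fst). Qed.

Let msnd w : measurable_fun setT w -> measurable_fun setT (fun z : E * E => w z.2).
Proof. by move=> mw; exact: (measurableT_comp mw measurable_snd). Qed.

Let mdiff w : measurable_fun setT w ->
  measurable_fun setT (fun z : E * E => w z.1 - w z.2).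
Proof. by move=> mw; apply: measurable_funB; [exact: mfst|exact: msnd]. Qed.

Let mpow r d (T : measurableType d) (f : T -> R) :
  measurable_fun setT f -> measurable_fun setT (fun x => `|f x| `^ r).
Proof.
move=> mf; apply: (measurableT_comp (measurable_powR r)).
exact: measurableT_comp.
Qed.

Lemma measurable_kernel :
  measurable_fun setT (fun z : E * E => (eucl (z.1 - z.2) `^ q)^-1).
Proof.
rewrite (_ : (fun _ => _) = fun z : E * E => eucl (z.1 - z.2) `^ (- q)); last first.
  by apply/funext => z; rewrite powRN.
apply: (measurableT_comp (measurable_powR _)).
apply: (measurableT_comp measurable_eucl); apply: measurable_fun_rVP => i.
under eq_fun do rewrite !mxE; apply: measurable_funB.
  exact: (measurableT_comp (measurable_rV_coord i) measurable_fst).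
exact: (measurableT_comp (measurable_rV_coord i) measurable_snd).
Qed.

Lemma measurable_gag w : measurable_fun setT w -> measurable_fun setT (gag p q w).
Proof.
move=> mw; apply: measurable_funM; last exact: measurable_kernel.
exact: mpow (mdiff mw).
Qed.

Lemma measurable_tail_integrand w : measurable_fun setT w ->
  measurable_fun setT (tail_integrand p q w).
Proof.
move=> mw; apply: measurable_funM; last exact: measurable_tail_weight.
exact: mpow mw.
Qed.

Definition flux v xi z :=
  `|v z.1 - v z.2| `^ (p - 1) * `|xi z.1 - xi z.2| / eucl (z.1 - z.2) `^ q.

Lemma flux_ge0 v xi z : 0 <= flux v xi z.
Proof. by rewrite divr_ge0 ?mulr_ge0 ?powR_ge0. Qed.

Lemma measurable_flux v xi : measurable_fun setT v -> measurable_fun setT xi ->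
  measurable_fun setT (flux v xi).
Proof.
move=> mv mxi; apply: measurable_funM; last exact: measurable_kernel.
apply: measurable_funM; first exact: mpow (mdiff mv).
by apply: measurableT_comp => //; exact: mdiff.
Qed.

Definition kappa : R := fine (\int[dx]_x (tail_weight q x)%:E)%E.
Definition volK0 : R := fine (dx K0).

Lemma kappaE : (\int[dx]_x (tail_weight q x)%:E)%E = kappa%:E.
Proof.
rewrite fineK// ge0_fin_numE; first exact: tail_weight_integrable.
by apply: integral_ge0 => x _; rewrite lee_fin tail_weight_ge0.
Qed.

Lemma volK0E : dx K0 = volK0%:E.
Proof. by rewrite fineK// ge0_fin_numE// compact_lebesgue_rV_lty. Qed.

Lemma kappa_ge0 : 0 <= kappa.
Proof.
by apply: fine_ge0; apply: integral_ge0 => x _; rewrite lee_fin tail_weight_ge0.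
Qed.

Lemma volK0_ge0 : 0 <= volK0.
Proof. exact: fine_ge0. Qed.

Definition gag1 w : \bar R := (\int[dx \x dx]_(z in K1 `*` K1) (gag p q w z)%:E)%E.

Definition data_lp_const : R := C * 2 `^ p * (2 * kappa).
Definition data_tail_const : R := C * 2 `^ p * (2 * (volK0 * M)).
Definition test_lp_const : R := C * 2 `^ p * (2 * (kappa + M)).

Lemma data_lp_const_ge0 : 0 <= data_lp_const.
Proof. by rewrite mulr_ge0// mulr_ge0// kappa_ge0. Qed.

Lemma data_tail_const_ge0 : 0 <= data_tail_const.
Proof. by rewrite mulr_ge0// mulr_ge0// mulr_ge0// volK0_ge0. Qed.

Lemma test_lp_const_ge0 : 0 <= test_lp_const.
Proof. by rewrite mulr_ge0// mulr_ge0// addr_ge0// kappa_ge0. Qed.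

(** The integral of the part of the flux bound that depends on the solution
    alone, the tail being replaced by its bound M. *)
Definition data_size v : \bar R :=
  (gag1 v + data_lp_const%:E * \int[dx]_(x in K0) (`|v x| `^ p)%:E
   + data_tail_const%:E)%E.

(** The integral of the part of the flux bound that is homogeneous of degree p in
    the test function: up to constants, the p-th power of its W^{s,p} norm. *)
Definition test_size xi : \bar R :=
  (gag1 xi + test_lp_const%:E * \int[dx]_x (`|xi x| `^ p)%:E)%E.

Lemma gag1_ge0 w : (0 <= gag1 w)%E.
Proof. by apply: integral_ge0 => z _; rewrite lee_fin gag_ge0. Qed.

Let lp_ge0 (D : set E) w : (0 <= \int[dx]_(x in D) (`|w x| `^ p)%:E)%E.
Proof. by apply: integral_ge0 => x _; rewrite lee_fin powR_ge0. Qed.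

Lemma data_size_ge0 v : (0 <= data_size v)%E.
Proof.
apply: adde_ge0; last by rewrite lee_fin data_tail_const_ge0.
by apply: adde_ge0; [exact: gag1_ge0|rewrite mule_ge0// lee_fin data_lp_const_ge0].
Qed.

Lemma test_size_ge0 xi : (0 <= test_size xi)%E.
Proof.
by apply: adde_ge0; [exact: gag1_ge0|rewrite mule_ge0// lee_fin test_lp_const_ge0].
Qed.

Let mindicK1 : measurable_fun setT (\1_(K1 `*` K1) : E * E -> R).
Proof. by apply: measurable_indic; exact: measurableX. Qed.

Let mindicK0 : measurable_fun setT (\1_K0 : E -> R).
Proof. exact: measurable_indic. Qed.

Let mtw := @measurable_tail_weight R n q.
Let tw0 := @tail_weight_ge0 R n q.

Let integral_gag w : measurable_fun setT w ->
  (\int[dx \x dx]_z (\1_(K1 `*` K1) z * gag p q w z)%:E = gag1 w)%E.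
Proof. by move=> mw; rewrite integral_indic_mul. Qed.

Lemma integral_flux_weight v : measurable_fun setT v ->
  (\int[dx]_x (tail_integrand p q v x)%:E <= M%:E)%E ->
  (\int[dx \x dx]_z (flux_weight p q K0 K1 C v z)%:E <= data_size v)%E.
Proof.
move=> mv vM; rewrite /flux_weight.
have mt := measurable_tail_integrand mv.
have mg := measurable_gag mv.
have mpv := mpow p mv.
have mc1 : measurable_fun setT
    (cross (fun x => \1_K0 x * `|v x| `^ p) (tail_weight q)).
  by apply: measurable_cross => //; exact: measurable_funM.
have mc2 : measurable_fun setT (cross (\1_K0) (tail_integrand p q v)).
  exact: measurable_cross.
have l0 x : 0 <= \1_K0 x * `|v x| `^ p by rewrite mulr_ge0 ?powR_ge0.
have c10 z : 0 <= cross (fun x => \1_K0 x * `|v x| `^ p) (tail_weight q) z.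
  exact: cross_ge0.
have c20 z : 0 <= cross (\1_K0) (tail_integrand p q v) z.
  by apply: cross_ge0 => // x; exact: tail_integrand_ge0.
under eq_integral do rewrite EFinD (EFinM (C * _)) EFinD.
rewrite ge0_integralD//; last 4 first.
- by move=> z _; rewrite lee_fin mulr_ge0 ?gag_ge0.
- by apply/measurable_EFinP; exact: measurable_funM.
- by move=> z _; rewrite mule_ge0 ?adde_ge0 ?lee_fin.
- apply: measurable_funeM; apply: emeasurable_funD; exact/measurable_EFinP.
rewrite ge0_integralZl//; last 2 first.
- by apply: emeasurable_funD; exact/measurable_EFinP.
- by move=> z _; rewrite adde_ge0 ?lee_fin.
rewrite ge0_integralD//; [|by move=> z _; rewrite lee_fin|
  exact/measurable_EFinP|by move=> z _; rewrite lee_fin|exact/measurable_EFinP].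
have mlp : measurable_fun setT (fun x => \1_K0 x * `|v x| `^ p).
  exact: measurable_funM.
have t0 x := tail_integrand_ge0 p q v x.
rewrite !ge0_integral_cross//.
rewrite integral_gag// kappaE integral_indic_mul integral_indic// setIT.
rewrite [X in (_ + _ * (_ + _ * (X * _)))%E]volK0E.
have L0 := lp_ge0 K0 v.
have tv0 : (0 <= \int[dx]_x (tail_integrand p q v x)%:E)%E.
  by apply: integral_ge0 => x _; rewrite lee_fin.
rewrite /data_size /data_lp_const /data_tail_const.
move: (gag1 v) (\int[dx]_(x in K0) (`|v x| `^ p)%:E)%E L0 => g L L0.
move: (\int[dx]_x (tail_integrand p q v x)%:E)%E tv0 vM => tv tv0 vM.
rewrite -addeA leeD// ge0_muleDr ?mule_ge0 ?lee_fin ?kappa_ge0 ?volK0_ge0//.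
apply: leeD; first by rewrite (muleC L) !muleA -!EFinM -mulrA.
rewrite (EFinM (C * _)) lee_wpmul2l ?lee_fin// !EFinM lee_wpmul2l ?lee_fin//.
by rewrite lee_wpmul2l ?lee_fin ?volK0_ge0.
Qed.

Lemma integral_test_weight v xi : measurable_fun setT v -> measurable_fun setT xi ->
  (\int[dx]_x (tail_integrand p q v x)%:E <= M%:E)%E ->
  (\int[dx \x dx]_z (test_weight p q K1 C v xi z)%:E <= test_size xi)%E.
Proof.
move=> mv mxi vM; rewrite /test_weight.
have mt := measurable_tail_integrand mv.
have mg := measurable_gag mxi.
have mpx := mpow p mxi.
have t0 x := tail_integrand_ge0 p q v x.
have x0 x : 0 <= `|xi x| `^ p by exact: powR_ge0.
have mc1 : measurable_fun setT (cross (fun x => `|xi x| `^ p) (tail_weight q)).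
  exact: measurable_cross.
have mc2 : measurable_fun setT (cross (fun x => `|xi x| `^ p) (tail_integrand p q v)).
  exact: measurable_cross.
have c10 z : 0 <= cross (fun x => `|xi x| `^ p) (tail_weight q) z.
  exact: cross_ge0.
have c20 z : 0 <= cross (fun x => `|xi x| `^ p) (tail_integrand p q v) z.
  exact: cross_ge0.
under eq_integral do rewrite EFinD (EFinM (C * _)) EFinD.
rewrite ge0_integralD//; last 4 first.
- by move=> z _; rewrite lee_fin mulr_ge0 ?gag_ge0.
- by apply/measurable_EFinP; exact: measurable_funM.
- by move=> z _; rewrite mule_ge0 ?adde_ge0 ?lee_fin.
- apply: measurable_funeM; apply: emeasurable_funD; exact/measurable_EFinP.
rewrite ge0_integralZl//; last 2 first.
- by apply: emeasurable_funD; exact/measurable_EFinP.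
- by move=> z _; rewrite adde_ge0 ?lee_fin.
rewrite ge0_integralD//; [|by move=> z _; rewrite lee_fin|
  exact/measurable_EFinP|by move=> z _; rewrite lee_fin|exact/measurable_EFinP].
rewrite !ge0_integral_cross// integral_gag// kappaE.
have tv0 : (0 <= \int[dx]_x (tail_integrand p q v x)%:E)%E.
  by apply: integral_ge0 => x _; rewrite lee_fin.
have L0 := lp_ge0 setT xi.
rewrite /test_size /test_lp_const.
move: (gag1 xi) (\int[dx]_x (`|xi x| `^ p)%:E)%E L0 => g L L0.
move: (\int[dx]_x (tail_integrand p q v x)%:E)%E tv0 vM => tv tv0 vM.
rewrite leeD// -ge0_muleDr ?mule_ge0 ?lee_fin ?kappa_ge0//.
rewrite -ge0_muleDr ?lee_fin ?kappa_ge0//.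
rewrite (EFinM (C * _)) -!muleA lee_wpmul2l ?lee_fin//.
rewrite EFinM -muleA lee_wpmul2l ?lee_fin//.
by rewrite muleC lee_wpmul2r// EFinD leeD.
Qed.

(** The energy form is a small multiple of the size of v plus a large multiple of
    the p-th power of the norm of xi. Since e is free, xi only has to be small
    in W^{s,p} for the whole form to be small. *)
Lemma integral_flux_le v xi e : measurable_fun setT v -> measurable_fun setT xi ->
  (forall x, ~ K0 x -> xi x = 0) -> 0 < e ->
  (\int[dx]_x (tail_integrand p q v x)%:E <= M%:E)%E ->
  (\int[dx \x dx]_z (flux v xi z)%:E <=
    e%:E * data_size v + (e `^ (1 - p))%:E * test_size xi)%E.
Proof.
move=> mv mxi xi0 e0 vM.
have mg1 := measurable_gag mv; have mg2 := measurable_gag mxi.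
have mt := measurable_tail_integrand mv.
have mpv := mpow p mv; have mpx := mpow p mxi.
have t0 x := tail_integrand_ge0 p q v x.
have ep0 : 0 <= e `^ (1 - p) by exact: powR_ge0.
have fw0 z : 0 <= flux_weight p q K0 K1 C v z.
  apply: addr_ge0; first by rewrite mulr_ge0 ?gag_ge0.
  by rewrite mulr_ge0//; apply: addr_ge0; apply: cross_ge0.
have tw_0 z : 0 <= test_weight p q K1 C v xi z.
  apply: addr_ge0; first by rewrite mulr_ge0 ?gag_ge0.
  by rewrite mulr_ge0//; apply: addr_ge0; apply: cross_ge0 => // x; exact: powR_ge0.
have mfw : measurable_fun setT (flux_weight p q K0 K1 C v).
  apply: measurable_funD; first exact: measurable_funM.
  apply: measurable_funM => //; apply: measurable_funD; apply: measurable_cross => //.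
  exact: measurable_funM.
have mtw' : measurable_fun setT (test_weight p q K1 C v xi).
  apply: measurable_funD; first exact: measurable_funM.
  by apply: measurable_funM => //; apply: measurable_funD; exact: measurable_cross.
apply: (@le_trans _ _ (\int[dx \x dx]_z (e%:E * (flux_weight p q K0 K1 C v z)%:E +
    (e `^ (1 - p))%:E * (test_weight p q K1 C v xi z)%:E))%E).
  apply: ge0_le_integral => //.
  - by move=> z _; rewrite lee_fin flux_ge0.
  - by apply/measurable_EFinP; exact: measurable_flux.
  - by apply: emeasurable_funD; apply: measurable_funeM; exact/measurable_EFinP.
  - move=> z _; rewrite -!EFinM -EFinD lee_fin.
    exact: (flux_bound p q K0 K1 C p1 C0 K01 kernelC).
rewrite ge0_integralD//; last 4 first.
- by move=> z _; rewrite mule_ge0 ?lee_fin ?(ltW e0).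
- by apply: measurable_funeM; exact/measurable_EFinP.
- by move=> z _; rewrite mule_ge0 ?lee_fin.
- by apply: measurable_funeM; exact/measurable_EFinP.
rewrite ge0_integralZl//; [|exact/measurable_EFinP|
  by move=> z _; rewrite lee_fin|by rewrite lee_fin ltW].
rewrite ge0_integralZl//; [|exact/measurable_EFinP|by move=> z _; rewrite lee_fin].
apply: leeD; rewrite lee_wpmul2l ?lee_fin ?(ltW e0)//.
  exact: integral_flux_weight.
exact: integral_test_weight.
Qed.

Definition energy_density w phi z : R :=
  pflux p (w z.1 - w z.2) * (phi z.1 - phi z.2) / eucl (z.1 - z.2) `^ q.

Lemma norm_energy_density w phi z : `|energy_density w phi z| = flux w phi z.
Proof.
by rewrite /energy_density /flux 2!normrM norm_pflux// normfV (ger0_norm (powR_ge0 _ _)).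
Qed.

Lemma measurable_pflux d (T : measurableType d) (f : T -> R) :
  measurable_fun setT f -> measurable_fun setT (fun x => pflux p (f x)).
Proof. by move=> mf; apply: measurable_funM => //; exact: mpow. Qed.

Lemma measurable_energy_density w phi : measurable_fun setT w ->
  measurable_fun setT phi -> measurable_fun setT (energy_density w phi).
Proof.
move=> mw mphi; apply: measurable_funM; last exact: measurable_kernel.
apply: measurable_funM; last exact: mdiff.
by apply: measurable_pflux; exact: mdiff.
Qed.

Lemma integrable_energy_density w phi : measurable_fun setT w ->
  measurable_fun setT phi -> (forall x, ~ K0 x -> phi x = 0) ->
  (\int[dx]_x (tail_integrand p q w x)%:E <= M%:E)%E ->
  (data_size w < +oo)%E -> (test_size phi < +oo)%E ->
  (dx \x dx)%E.-integrable setT (EFin \o energy_density w phi).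
Proof.
move=> mw mphi phi0 wM wfin phifin; apply/integrableP; split.
  by apply/measurable_EFinP; exact: measurable_energy_density.
under eq_integral do rewrite /= norm_energy_density.
have H := integral_flux_le 1 mw mphi phi0 ltr01 wM.
apply: (le_lt_trans H).
rewrite powR1 !mul1e lte_add_pinfty//.
Qed.

Lemma norm_energy_le (w phi : E -> R) : measurable_fun setT w -> measurable_fun setT phi ->
  (forall x, ~ K0 x -> phi x = 0) ->
  (\int[dx]_x (tail_integrand p q w x)%:E <= M%:E)%E ->
  (data_size w < +oo)%E -> (test_size phi < +oo)%E ->
  (`|energy s p w phi|%:E <= data_size w + test_size phi)%E.
Proof.
move=> mw mphi phi0 wM wfin phifin.
have iE := integrable_energy_density mw mphi phi0
  wM wfin phifin.
have H := integral_flux_le 1 mw mphi phi0 ltr01 wM.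
rewrite powR1 !mul1e in H; apply: le_trans H.
apply: (@le_trans _ _ (\int[(dx \x dx)%E]_z `|energy_density w phi z|)%:E).
  by rewrite lee_fin; exact: (le_normr_Rintegral measurableT iE).
rewrite fineK; last first.
  apply: integrable_fin_num => //; have := integrable_norm iE.
  by apply: eq_integrable.
rewrite le_eqVlt; apply/orP; left; apply/eqP; apply: eq_integral => z _.
by rewrite norm_energy_density.
Qed.

(** The positive part of v - u. The cutoff changes it only on a null set when
    v <= u almost everywhere off K0, and makes it vanish off K0 exactly. *)
Definition excess u v x : R := \1_K0 x * Num.max (v x - u x) 0.

Lemma measurable_excess u v : measurable_fun setT u -> measurable_fun setT v ->
  measurable_fun setT (excess u v).
Proof.
move=> mu mv; apply: measurable_funM => //.
by apply: measurable_maxr => //; exact: measurable_funB.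
Qed.

Lemma excess_out u v x : ~ K0 x -> excess u v x = 0.
Proof. by move=> Kx; rewrite /excess indicE memNset// mul0r. Qed.

Lemma excessE u v x : (~ K0 x -> v x <= u x) ->
  excess u v x = Num.max (v x - u x) 0.
Proof.
move=> H; rewrite /excess indicE; have [Kx|nKx] := pselect (K0 x).
  by rewrite mem_set// mul1r.
rewrite memNset// mul0r; apply/esym/max_idPr; rewrite subr_le0; exact: H.
Qed.

(** The difference of the energies of u and v tested with zeta is controlled by
    the distance of zeta to eta = (v - u)_+, because testing with eta itself
    gives a difference of the good sign. *)
Lemma energy_gap u v zeta e :
  measurable_fun setT u -> measurable_fun setT v -> measurable_fun setT zeta ->
  (forall x, ~ K0 x -> zeta x = 0) ->
  (\int[dx]_x (tail_integrand p q u x)%:E <= M%:E)%E ->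
  (\int[dx]_x (tail_integrand p q v x)%:E <= M%:E)%E ->
  (data_size u < +oo)%E -> (data_size v < +oo)%E -> (test_size zeta < +oo)%E ->
  {ae dx, forall x, ~ K0 x -> v x <= u x} -> 0 < e ->
  ((energy s p u zeta - energy s p v zeta)%:E <=
   (e%:E * data_size u +
    (e `^ (1 - p))%:E * test_size (zeta \- excess u v)%R) +
   (e%:E * data_size v +
    (e `^ (1 - p))%:E * test_size (zeta \- excess u v)%R))%E.
Proof.
move=> mu mv mz z0 uM vM ufin vfin zfin vu e0; pose xi := zeta \- excess u v.
have iu := integrable_energy_density mu mz z0 uM ufin zfin.
have iv := integrable_energy_density mv mz z0 vM vfin zfin.
have mxi : measurable_fun setT xi.
  by apply: measurable_funB => //; exact: measurable_excess.
have xi0 x : ~ K0 x -> xi x = 0.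
  by move=> Kx; rewrite /xi /= z0// excess_out// subrr.
have mfu := measurable_flux mu mxi; have mfv := measurable_flux mv mxi.
rewrite (_ : energy s p u zeta - energy s p v zeta =
    \int[(dx \x dx)%E]_z (energy_density u zeta z - energy_density v zeta z));
  last by rewrite RintegralB.
have iuv : (dx \x dx)%E.-integrable setT
    (fun z => (energy_density u zeta z - energy_density v zeta z)%:E).
  rewrite (_ : (fun _ => _) = (EFin \o energy_density u zeta) \-
    (EFin \o energy_density v zeta))%E//; exact: integrableB.
rewrite fineK; last exact: integrable_fin_num.
apply: (@le_trans _ _ (\int[dx \x dx]_z ((flux u xi z)%:E + (flux v xi z)%:E))%E).
  apply: integral_le_ge0 => //.
  - exact: measurable_int iuv.
  - by apply: emeasurable_funD; exact/measurable_EFinP.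
  - by move=> z _; rewrite adde_ge0// lee_fin flux_ge0.
  - apply: ae_imp (ae_pair vu) => -[x y] /= [vux vuy] _.
    pose eta := excess u v.
    rewrite -EFinD lee_fin -!norm_energy_density.
    have -> : energy_density u zeta (x, y) - energy_density v zeta (x, y) =
      (energy_density u eta (x, y) - energy_density v eta (x, y)) +
      (energy_density u xi (x, y) - energy_density v xi (x, y)).
      by rewrite /energy_density /xi /= -/eta; ring.
    rewrite -[leRHS]add0r lerD//; last first.
      by rewrite (le_trans (ler_norm _))// ler_normB.
    rewrite /energy_density /= /eta (@excessE u v x vux) (@excessE u v y vuy) -2!mulrBl.
    rewrite mulr_le0_ge0 ?invr_ge0 ?powR_ge0//.
    rewrite -opprB mulNr oppr_le0; exact: pflux_maxr_ge0.
rewrite ge0_integralD//; [|by move=> z _; rewrite lee_fin flux_ge0|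
  exact/measurable_EFinP|by move=> z _; rewrite lee_fin flux_ge0|exact/measurable_EFinP].
by apply: leeD; exact: integral_flux_le.
Qed.

(** A function supported in K0 interacts with the complement of K1 only through
    the tail weight, so the local energy and the L^p norm suffice. *)
Lemma integral_gag_lty xi : measurable_fun setT xi ->
  (forall x, ~ K0 x -> xi x = 0) -> (test_size xi < +oo)%E ->
  (\int[dx]_x (`|xi x| `^ p)%:E < +oo)%E ->
  (\int[dx \x dx]_z (gag p q xi z)%:E < +oo)%E.
Proof.
move=> mxi xi0 xifin lpfin.
have mg := measurable_gag mxi.
have mpx := mpow p mxi.
have gfin : (gag1 xi < +oo)%E.
  apply: le_lt_trans xifin; rewrite leeDl// mule_ge0// ?lee_fin ?test_lp_const_ge0//.
have mc : measurable_fun setT (cross (fun x => `|xi x| `^ p) (tail_weight q)).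
  exact: measurable_cross.
have c0 z : 0 <= cross (fun x => `|xi x| `^ p) (tail_weight q) z.
  by apply: cross_ge0 => // x; exact: powR_ge0.
apply: (@le_lt_trans _ _ (\int[dx \x dx]_z ((\1_(K1 `*` K1) z * gag p q xi z)%:E +
    C%:E * (cross (fun x => `|xi x| `^ p) (tail_weight q) z)%:E))%E).
  apply: ge0_le_integral => //.
  - by move=> z _; rewrite lee_fin gag_ge0.
  - exact/measurable_EFinP.
  - apply: emeasurable_funD; first by apply/measurable_EFinP; exact: measurable_funM.
    by apply: measurable_funeM; exact/measurable_EFinP.
  - move=> z _; rewrite -EFinM -EFinD lee_fin.
    exact: (gag_bound p q K0 K1 C p1 C0 K01 kernelC).
rewrite ge0_integralD//; last 4 first.
- by move=> z _; rewrite lee_fin mulr_ge0 ?gag_ge0.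
- by apply/measurable_EFinP; exact: measurable_funM.
- by move=> z _; rewrite mule_ge0 ?lee_fin ?(ltW C0).
- by apply: measurable_funeM; exact/measurable_EFinP.
rewrite integral_gag// lte_add_pinfty//.
rewrite ge0_integralZl//; [|exact/measurable_EFinP|
  by move=> z _; rewrite lee_fin|by rewrite lee_fin ltW].
rewrite ge0_integral_cross// kappaE.
have := lp_ge0 setT xi; move: (\int[dx]_x (`|xi x| `^ p)%:E)%E lpfin => L Lfin L0.
have Lf : L \is a fin_num by rewrite ge0_fin_numE.
by rewrite -(fineK Lf) -!EFinM ltry.
Qed.

End fixed_time.

(** * Joint measurability *)

Section sigma_finite_product.
Local Open Scope ereal_scope.
Context d1 d2 (T1 : measurableType d1) (T2 : measurableType d2) (R : realType).
Variable m1 : {sigma_finite_measure set T1 -> \bar R}.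
Variable m2 : {sigma_finite_measure set T2 -> \bar R}.

(** An alias of the product measure on which the sigma-finite structure is the
    one inferred, so that Tonelli's theorem applies to pairs of points together
    with time. *)
Definition sf_prod : set (T1 * T2) -> \bar R := m1 \x m2.

HB.instance Definition _ := Measure.on sf_prod.

Let sf_prod_sigma_finite : sigma_finite setT sf_prod.
Proof.
have /sigma_finiteP[F [TF ndF Foo]] := sigma_finiteT m1.
have /sigma_finiteP[G [TG ndG Goo]] := sigma_finiteT m2.
exists (fun i => F i `*` G i).
  apply/seteqP; split => // -[x y] _.
  have [i _ Fix] : (\bigcup_i F i) x by rewrite -TF.
  have [j _ Gjy] : (\bigcup_i G i) y by rewrite -TG.
  exists (maxn i j) => //; split => /=.
  - by move: x Fix; exact/subsetPset/ndF/leq_maxl.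
  - by move: y Gjy; exact/subsetPset/ndG/leq_maxr.
move=> i; have [mF Fi] := Foo i; have [mG Gi] := Goo i.
split; first exact: measurableX.
by rewrite /sf_prod product_measure1E// lte_mul_pinfty// ge0_fin_numE.
Qed.

HB.instance Definition _ :=
  Measure_isSigmaFinite.Build _ _ _ sf_prod sf_prod_sigma_finite.

End sigma_finite_product.
Arguments sf_prod {d1 d2 T1 T2 R}.

Section parametrized_measurability.
Set Implicit Arguments.
Context {R : realType} {n : nat} (s p : R) (K1 : set 'rV[R]_n).
Local Notation E := 'rV[R]_n.
Local Notation dx := (@lebesgue_rV R n).
Local Notation q := (n%:R + s * p).
Hypothesis cK1 : compact K1.
Context d (P : measurableType d).
Variable W : E * P -> R.
Hypothesis mW : measurable_fun setT W.

Let mK1 := compact_measurable_rV K1 cK1.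

Let mW1 : measurable_fun setT (fun zt : (E * E) * P => W (zt.1.1, zt.2)).
Proof.
apply: (measurableT_comp mW); apply: measurable_fun_pair => //.
exact: (measurableT_comp measurable_fst measurable_fst).
Qed.

Let mW2 : measurable_fun setT (fun zt : (E * E) * P => W (zt.1.2, zt.2)).
Proof.
apply: (measurableT_comp mW); apply: measurable_fun_pair => //.
exact: (measurableT_comp measurable_snd measurable_fst).
Qed.

Let mker : measurable_fun setT
  (fun zt : (E * E) * P => (eucl (zt.1.1 - zt.1.2) `^ q)^-1).
Proof. exact: (measurableT_comp (measurable_kernel s p) measurable_fst). Qed.

Lemma measurable_gag_param : measurable_fun setT
  (fun zt : (E * E) * P => gag p q (fun x => W (x, zt.2)) zt.1).
Proof.
apply: measurable_funM => //; apply: (measurableT_comp (measurable_powR _)).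
by apply: measurableT_comp => //; exact: measurable_funB.
Qed.

Lemma measurable_gag1_param :
  measurable_fun setT (fun t => gag1 s p K1 (fun x => W (x, t))).
Proof.
apply: (@measurable_fun_integral1 _ _ _ _ _ (sf_prod dx dx) (K1 `*` K1)
  (fun zt : (E * E) * P => (gag p q (fun x => W (x, zt.2)) zt.1)%:E)).
- exact: measurableX.
- by apply/measurable_EFinP; exact: measurable_gag_param.
- by move=> zt; rewrite lee_fin gag_ge0.
Qed.

Lemma measurable_lp_param (r : R) (A : set E) : measurable A ->
  measurable_fun setT (fun t => \int[dx]_(x in A) (`|W (x, t)| `^ r)%:E)%E.
Proof.
move=> mA; apply: (measurable_fun_integral1 (m1 := dx)
  (f := fun xt => (`|W xt| `^ r)%:E)) => //.
apply/measurable_EFinP; apply: (measurableT_comp (measurable_powR _)).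
exact: measurableT_comp.
Qed.

Lemma measurable_data_size_param K0 C M : measurable K0 ->
  measurable_fun setT (fun t => data_size s p K0 K1 C M (fun x => W (x, t))).
Proof.
move=> mK0; apply: emeasurable_funD => //; apply: emeasurable_funD.
  exact: measurable_gag1_param.
by apply: measurable_funeM; exact: measurable_lp_param.
Qed.

Lemma measurable_test_size_param C M :
  measurable_fun setT (fun t => test_size s p K1 C M (fun x => W (x, t))).
Proof.
apply: emeasurable_funD; first exact: measurable_gag1_param.
by apply: measurable_funeM; exact: measurable_lp_param.
Qed.

(** The energy is a signed integral, so measurability in the parameter is
    obtained from its positive and negative parts. *)
Lemma measurable_energy_param phi : measurable_fun setT phi ->
  measurable_fun setT (fun t => energy s p (fun x => W (x, t)) phi).
Proof.
move=> mphi.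
pose D (zt : (E * E) * P) := (energy_density s p (fun x => W (x, zt.2)) phi zt.1)%:E.
have mD : measurable_fun setT D.
  apply/measurable_EFinP; apply: measurable_funM => //; apply: measurable_funM.
    by apply: measurable_pflux; exact: measurable_funB.
  apply: measurable_funB.
    apply: (measurableT_comp mphi).
    exact: (measurableT_comp measurable_fst measurable_fst).
  apply: (measurableT_comp mphi).
  exact: (measurableT_comp measurable_snd measurable_fst).
rewrite (_ : (fun _ => _) = fine \o (fun t =>
    \int[dx \x dx]_z D^\+ (z, t) - \int[dx \x dx]_z D^\- (z, t)))%E.
  apply: measurableT_comp; first exact: fine_measurable.
  apply: emeasurable_funB.
  - by apply: (measurable_fun_integral1 (m1 := sf_prod dx dx) (f := D^\+%E)) => //;
      exact: measurable_funepos.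
  - by apply: (measurable_fun_integral1 (m1 := sf_prod dx dx) (f := D^\-%E)) => //;
      exact: measurable_funeneg.
apply/funext => t; rewrite /energy /Rintegral /= integralE; congr (fine (_ - _)%E).
  by apply: eq_integral => z _; rewrite !funeposE.
by apply: eq_integral => z _; rewrite !funenegE.
Qed.

End parametrized_measurability.

Section integral_helpers.
Local Open Scope ereal_scope.
Context d (T : measurableType d) (R : realType).
Variables (mu : {measure set T -> \bar R}) (D : set T) (mD : measurable D).

Lemma ge0_integral_lin (f g : T -> \bar R) (c k : R) : (0 <= c)%R -> (0 <= k)%R ->
  measurable_fun setT f -> measurable_fun setT g ->
  (forall x, 0 <= f x) -> (forall x, 0 <= g x) ->
  \int[mu]_(x in D) (c%:E * f x + k%:E * g x) =
  c%:E * \int[mu]_(x in D) f x + k%:E * \int[mu]_(x in D) g x.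
Proof.
move=> c0 k0 mf mg f0 g0.
have mf' := measurable_funTS (D := D) mf; have mg' := measurable_funTS (D := D) mg.
rewrite ge0_integralD//; last 4 first.
- by move=> x _; rewrite mule_ge0.
- exact: measurable_funeM.
- by move=> x _; rewrite mule_ge0.
- exact: measurable_funeM.
by rewrite !ge0_integralZl.
Qed.

Lemma ae_dominated_integral_lty (f g1 g2 : T -> \bar R) (c : R) : (0 <= c)%R ->
  measurable_fun setT f -> measurable_fun setT g1 -> measurable_fun setT g2 ->
  (forall x, 0 <= f x) -> (forall x, 0 <= g1 x) -> (forall x, 0 <= g2 x) ->
  {ae mu, forall x, D x -> f x <= c%:E * (g1 x + g2 x)} ->
  \int[mu]_(x in D) g1 x < +oo -> \int[mu]_(x in D) g2 x < +oo ->
  \int[mu]_(x in D) f x < +oo.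
Proof.
move=> c0 mf mg1 mg2 f0 g10 g20 fg i1 i2.
apply: (@le_lt_trans _ _ (\int[mu]_(x in D) (c%:E * g1 x + c%:E * g2 x))).
  apply: ae_ge0_le_integral => //.
  - exact: measurable_funTS.
  - by move=> x _; rewrite adde_ge0// mule_ge0.
  - by apply: measurable_funTS; apply: emeasurable_funD; exact: measurable_funeM.
  - by apply: ae_imp fg => x H Dx; rewrite -ge0_muleDr//; exact: H.
rewrite ge0_integral_lin//.
by apply: lte_add_pinfty; apply: lte_mul_pinfty.
Qed.

Lemma sqr_integral_lty (f g h : T -> R) :
  measurable_fun setT f -> measurable_fun setT g -> measurable_fun setT h ->
  (forall x, `|h x| <= `|f x| + `|g x|)%R ->
  \int[mu]_(x in D) (f x ^+ 2)%:E < +oo -> \int[mu]_(x in D) (g x ^+ 2)%:E < +oo ->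
  \int[mu]_(x in D) (h x ^+ 2)%:E < +oo.
Proof.
move=> mf mg mh hfg f2 g2; have c0 : (0 <= 2 :> R)%R by [].
refine (@ae_dominated_integral_lty (fun x => (h x ^+ 2)%:E) (fun x => (f x ^+ 2)%:E)
  (fun x => (g x ^+ 2)%:E) 2 c0 _ _ _ _ _ _ _ f2 g2);
  try by [apply/measurable_EFinP; exact: measurable_funX|
          move=> x; rewrite lee_fin sqr_ge0].
apply: aeW => x _; rewrite -EFinD -EFinM lee_fin.
have := hfg x; rewrite -(real_normK (num_real (h x))).
rewrite -(real_normK (num_real (f x))) -(real_normK (num_real (g x))).
move: (normr_ge0 (h x)) (normr_ge0 (f x)) (normr_ge0 (g x)).
move: `|h x|%R `|f x|%R `|g x|%R => X Y Z X0 Y0 Z0 XYZ.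
have H1 : (X ^+ 2 <= (Y + Z) ^+ 2)%R by rewrite lerXn2r ?nnegrE ?addr_ge0.
by have := sqr_ge0 (Y - Z)%R; move: H1; rewrite !expr2; nra.
Qed.

Lemma sqr_integrable_mul (f g : T -> R) :
  measurable_fun setT f -> measurable_fun setT g ->
  \int[mu]_(x in D) (f x ^+ 2)%:E < +oo -> \int[mu]_(x in D) (g x ^+ 2)%:E < +oo ->
  mu.-integrable D (EFin \o (f \* g)%R).
Proof.
move=> mf mg f2 g2; have mfg := measurable_funM mf mg.
apply/integrableP; split.
  by apply: measurable_funTS; apply/measurable_EFinP.
refine (@ae_dominated_integral_lty (fun x => `|(f x * g x)%:E|)
  (fun x => (f x ^+ 2)%:E) (fun x => (g x ^+ 2)%:E) 1 ler01 _ _ _ _ _ _ _ f2 g2);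
  try by [apply/measurable_EFinP; exact: measurable_funX|
          move=> x; rewrite lee_fin sqr_ge0].
- by apply: measurableT_comp => //; exact/measurable_EFinP.
- by move=> x.
apply: aeW => x _; rewrite mul1e -EFinD lee_fin normrM.
rewrite -(real_normK (num_real (f x))) -(real_normK (num_real (g x))).
move: (normr_ge0 (f x)) (normr_ge0 (g x)).
move: `|f x|%R `|g x|%R => Y Z Y0 Z0; have := sqr_ge0 (Y - Z)%R; rewrite !expr2; nra.
Qed.

(** Integrated form of a pointwise convexity inequality between two times, with
    the products split into the pairings that occur in the weak formulation. *)
Lemma Rintegral_sqr_growth (zt zr vt vr ut ur : T -> R) :
  measurable_fun setT zt -> measurable_fun setT zr -> measurable_fun setT vt ->
  measurable_fun setT vr -> measurable_fun setT ut -> measurable_fun setT ur ->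
  \int[mu]_(x in D) (zt x ^+ 2)%:E < +oo -> \int[mu]_(x in D) (zr x ^+ 2)%:E < +oo ->
  \int[mu]_(x in D) (vt x ^+ 2)%:E < +oo -> \int[mu]_(x in D) (vr x ^+ 2)%:E < +oo ->
  \int[mu]_(x in D) (ut x ^+ 2)%:E < +oo -> \int[mu]_(x in D) (ur x ^+ 2)%:E < +oo ->
  (forall x, D x -> zt x ^+ 2 - zr x ^+ 2 <=
     2 * ((vt x * zt x - vr x * zt x) - (ut x * zt x - ur x * zt x)))%R ->
  (\int[mu]_(x in D) (zt x ^+ 2) - \int[mu]_(x in D) (zr x ^+ 2) <=
   2 * ((\int[mu]_(x in D) (vt x * zt x) - \int[mu]_(x in D) (vr x * zt x)) -
        (\int[mu]_(x in D) (ut x * zt x) - \int[mu]_(x in D) (ur x * zt x))))%R.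
Proof.
move=> mzt mzr mvt mvr mut mur zt2 zr2 vt2 vr2 ut2 ur2 H.
have I f g mf mg f2 g2 := @sqr_integrable_mul f g mf mg f2 g2.
have Izt := I _ _ mzt mzt zt2 zt2; have Izr := I _ _ mzr mzr zr2 zr2.
have Ivt := I _ _ mvt mzt vt2 zt2; have Ivr := I _ _ mvr mzt vr2 zt2.
have Iut := I _ _ mut mzt ut2 zt2; have Iur := I _ _ mur mzt ur2 zt2.
have Iv := integrableB mD Ivt Ivr; have Iu := integrableB mD Iut Iur.
have Ivu := integrableB mD Iv Iu.
rewrite -[X in (_ <= 2 * (X - _))%R]RintegralB// -[X in (_ <= 2 * (_ - X))%R]RintegralB//.
rewrite -[X in (_ <= 2 * X)%R]RintegralB// -[leRHS]RintegralZl//.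
rewrite -[leLHS]RintegralB//.
apply: le_Rintegral => //.
- exact: (integrableB mD Izt Izr).
- exact: (integrableZl mD 2 Ivu).
Qed.

Lemma lin_lty (c : R) (x y : \bar R) : (0 <= c)%R -> x < +oo -> y < +oo ->
  c%:E * (x + y) < +oo.
Proof.
move=> c0 xl yl; apply: lte_mul_pinfty => //; exact: lte_add_pinfty.
Qed.

Lemma gap_algebra (e k : R) (x y z : \bar R) : (0 <= e)%R -> (0 <= k)%R ->
  0 <= x -> 0 <= y -> 0 <= z ->
  2%:E * ((e%:E * x + k%:E * z) + (e%:E * y + k%:E * z)) =
  (2 * e)%:E * (y + x) + (4 * k)%:E * z.
Proof.
move=> e0 k0 x0 y0 z0.
rewrite addeACA -ge0_muleDr// -ge0_muleDl ?lee_fin//.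
rewrite [LHS]ge0_muleDr; [|by apply: mule_ge0; rewrite ?adde_ge0|
  by apply: mule_ge0 => //; rewrite -EFinD lee_fin addr_ge0].
rewrite !muleA -EFinD -!EFinM (addeC x); congr (_ + _%:E * _); ring.
Qed.

End integral_helpers.
Arguments ge0_integral_lin {d T R} mu {D} mD {f g c k}.
Arguments ae_dominated_integral_lty {d T R} mu {D} mD {f g1 g2 c}.
Arguments sqr_integral_lty {d T R} mu {D} mD {f g h}.
Arguments sqr_integrable_mul {d T R} mu {D} mD {f g}.
Arguments Rintegral_sqr_growth {d T R} mu {D} mD {zt zr vt vr ut ur}.
Arguments lin_lty {R c x y}.
Arguments gap_algebra {R e k x y z}.

(** * The excess on a time slab *)

Lemma le_of_pairings {R : realType} (A B A' B' E E' : R) :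
  0 <= A' - B' + E' -> A - B + E <= 0 -> A - B - (A' - B') <= E' - E.
Proof. lra. Qed.

Section slab.
Set Implicit Arguments.
Context {R : realType} {n : nat}.
Local Notation E := 'rV[R]_n.
Local Notation T := (measurableTypeR R).
Local Notation dx := (@lebesgue_rV R n).
Local Notation dt := (@lebesgue_measure R).

Lemma ae_lty (a b : R) (f : R -> \bar R) : measurable_fun setT f ->
  (forall t, 0 <= f t)%E -> (\int[dt]_(t in `[a, b]) f t < +oo)%E ->
  {ae dt, forall t, t \in `[a, b] -> (f t < +oo)%E}.
Proof.
move=> mf f0 fint.
have : dt.-integrable `[a, b] f.
  apply/integrableP; split; first exact: measurable_funTS.
  by under eq_integral do rewrite gee0_abs//.
move=> /integrable_ae; move/(_ ltac:(by [])); apply: ae_imp => t /= H tI.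
by have := H tI; rewrite ge0_fin_numE.
Qed.

Lemma ae_itv_and (a b : R) (A B : R -> Prop) :
  {ae dt, forall t, t \in `[a, b] -> A t} -> {ae dt, forall t, t \in `[a, b] -> B t} ->
  {ae dt, forall t, t \in `[a, b] -> A t /\ B t}.
Proof. by apply: ae_imp2 => t At Bt tI; split; [exact: At|exact: Bt]. Qed.
Arguments ae_itv_and {a b A B}.

Variables (s p : R) (K0 K1 : set E) (C M a b : R) (u v : E -> R -> R).
Local Notation q := (n%:R + s * p).
Hypotheses (s0 : 0 < s) (p2 : 2 < p) (C0 : 0 < C) (M0 : 0 <= M) (ab : a < b).
Hypotheses (cK0 : compact K0) (cK1 : compact K1) (K01 : K0 `<=` K1).
Hypothesis kernelC : forall x y, K0 x -> ~ K1 y ->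
  (eucl (x - y) `^ q)^-1 <= C * tail_weight q y.

(** What is retained of the function spaces on a time interval: finite space-time
    energies, a uniform tail bound, and square integrability at every time. *)
Definition slab_bound (f : E -> R -> R) :=
  [/\ measurable_fun setT (fun z : E * T => f z.1 z.2),
      (\int[dt]_(t in `[a, b]) gag1 s p K1 (f ^~ t) < +oo)%E,
      (\int[dt]_(t in `[a, b]) \int[dx]_(x in K0) (`|f x t| `^ p)%:E < +oo)%E,
      {ae dt, forall t, t \in `[a, b] ->
        (\int[dx]_x (tail_integrand p q (f ^~ t) x)%:E <= M%:E)%E} &
      forall t, t \in `[a, b] -> (\int[dx]_(x in K0) (f x t ^+ 2)%:E < +oo)%E].

Definition test_function (zeta : E -> R) :=
  [/\ measurable_fun setT zeta, forall x, ~ K0 x -> zeta x = 0,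
      forall x, 0 <= zeta x, (test_size s p K1 C M zeta < +oo)%E &
      (\int[dx]_x (`|zeta x| `^ p)%:E < +oo)%E /\
      (\int[dx]_(x in K0) (zeta x ^+ 2)%:E < +oo)%E].

Hypotheses (bu : slab_bound u) (bv : slab_bound v).
Hypothesis vu_out : {ae dt, forall t, a < t <= b ->
  {ae dx, forall x, ~ K0 x -> v x t <= u x t}}.

(** The weak formulation over [r, t] for a test function constant in time. *)
Definition weak_pairing (f : E -> R -> R) (r t : R) (zeta : E -> R) : R :=
  \int[dx]_(x in K0) (f x t * zeta x) - \int[dx]_(x in K0) (f x r * zeta x) +
  \int[dt]_(tau in `[r, t]) energy s p (f ^~ tau) zeta.

Hypothesis weak_v : forall r t zeta, a <= r -> r < t -> t <= b ->
  test_function zeta -> weak_pairing v r t zeta <= 0.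
Hypothesis weak_u : forall r t zeta, a <= r -> r < t -> t <= b ->
  test_function zeta -> 0 <= weak_pairing u r t zeta.

(** The squared L^2(K0) norm of (v - u)_+. *)
Definition excess_mass (t : R) : \bar R :=
  (\int[dx]_(x in K0) (Num.max (v x t - u x t) 0 ^+ 2)%:E)%E.

Hypothesis mass_small : forall e : R, 0 < e -> \forall h \near 0^'+,
  forall t, a <= t <= a + h -> (excess_mass t <= e%:E)%E.

Let p1 : 1 < p. Proof. by apply: lt_trans p2; rewrite ltr1n. Qed.
Let p0 : 0 < p. Proof. exact: lt_trans ltr01 p1. Qed.
Let mK0 := compact_measurable_rV K0 cK0.
Let mK1 := compact_measurable_rV K1 cK1.

Local Notation ex t := (excess K0 (u ^~ t) (v ^~ t)).

Let mu : measurable_fun setT (fun z : E * T => u z.1 z.2). Proof. by case: bu. Qed.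
Let mv : measurable_fun setT (fun z : E * T => v z.1 z.2). Proof. by case: bv. Qed.
Let mut t : measurable_fun setT (u ^~ t).
Proof. exact: (@measurable_fun_pair1 _ _ _ E T _ _ t mu). Qed.
Let mvt t : measurable_fun setT (v ^~ t).
Proof. exact: (@measurable_fun_pair1 _ _ _ E T _ _ t mv). Qed.

Let mex : measurable_fun setT (fun z : E * T => ex z.2 z.1).
Proof.
apply: measurable_funM.
  exact: (measurableT_comp (measurable_indic mK0) measurable_fst).
by apply: measurable_maxr => //; exact: measurable_funB.
Qed.

Let mex_comp d' (S : measurableType d') (X : S -> E) (t : S -> T) :
  measurable_fun setT X -> measurable_fun setT t ->
  measurable_fun setT (fun w => ex (t w) (X w)).
Proof.
move=> mX mt; have mP := measurable_fun_pair mX mt.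
have H := measurableT_comp mex mP.
exact: H.
Qed.

Let vu_out_cc : {ae dt, forall t, t \in `[a, b] ->
  {ae dx, forall x, ~ K0 x -> v x t <= u x t}}.
Proof.
have ae_a : {ae dt, forall t : R, t != a}.
  exists [set a]; split => //; first exact: lebesgue_measure_set1.
  by move=> t /= /negP; rewrite negbK => /eqP.
move: ae_a vu_out; apply: ae_imp2 => t ta H; rewrite in_itv /= => /andP[at_ tb].
by apply: H; rewrite tb andbT lt_neqAle eq_sym ta.
Qed.

Let mlp (f : E -> R -> R) t : measurable_fun setT (f ^~ t) ->
  measurable_fun setT (fun x : E => (`|f x t : R| `^ p)%:E).
Proof.
move=> mf; apply/measurable_EFinP; apply: (measurableT_comp (measurable_powR _)).
exact: measurableT_comp.
Qed.

Lemma excess_lp_le t : (\int[dx]_x (`|ex t x| `^ p)%:E <=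
  (2 `^ p)%:E * (\int[dx]_(x in K0) (`|v x t| `^ p)%:E +
                 \int[dx]_(x in K0) (`|u x t| `^ p)%:E))%E.
Proof.
have mlv := @mlp v t (mvt t); have mlu := @mlp u t (mut t).
have lv0 x : (0 <= (`|v x t| `^ p)%:E)%E by rewrite lee_fin powR_ge0.
have lu0 x : (0 <= (`|u x t| `^ p)%:E)%E by rewrite lee_fin powR_ge0.
rewrite -ge0_integralD//; [|exact: measurable_funTS..].
rewrite -ge0_integralZl//; last 2 first.
- by apply: measurable_funTS; exact: emeasurable_funD.
- by move=> x _; rewrite adde_ge0.
rewrite [leRHS]integral_mkcond.
apply: ge0_le_integral => //.
- apply/measurable_EFinP; apply: (measurableT_comp (measurable_powR _)).
  by apply: measurableT_comp => //; exact: measurable_excess.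
- apply/(measurable_restrictT _ _).1 => //; apply: measurable_funTS.
  by apply: measurable_funeM; exact: emeasurable_funD.
- move=> x _; rewrite /patch; case: ifPn => xK.
    rewrite -EFinD -EFinM lee_fin /excess indicE xK mul1r.
    apply: (@le_trans _ _ ((`|v x t| + `|u x t|) `^ p)).
      rewrite ge0_ler_powR ?nnegrE ?(ltW p0) ?addr_ge0//.
      have := maxr_sub_le (v x t - u x t) 0; rewrite maxxx !subr0.
      by move/le_trans; apply; exact: ler_normB.
    by rewrite powRD_le// ltW.
  by rewrite /excess indicE (negbTE xK) mul0r normr0 powR0 ?gt_eqF.
Qed.

Lemma gag1_excess_le t : {ae dx, forall x, ~ K0 x -> v x t <= u x t} ->
  (gag1 s p K1 (ex t) <=
   (2 `^ p)%:E * (gag1 s p K1 (v ^~ t) + gag1 s p K1 (u ^~ t)))%E.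
Proof.
move=> out.
have mK : measurable (K1 `*` K1) by exact: measurableX.
have mgag f : measurable_fun setT f ->
    measurable_fun (K1 `*` K1) (fun z => (gag p q f z)%:E).
  by move=> mf; apply/measurable_EFinP; apply: measurable_funTS; exact: measurable_gag.
have g0 f z : (0 <= (gag p q f z)%:E)%E by rewrite lee_fin gag_ge0.
have mgv := mgag _ (mvt t); have mgu := mgag _ (mut t).
rewrite /gag1 -ge0_integralD// -ge0_integralZl//; last 2 first.
- exact: emeasurable_funD.
- by move=> x _; rewrite adde_ge0.
apply: ae_ge0_le_integral => //.
- by apply: mgag; exact: measurable_excess.
- by move=> x _; rewrite mule_ge0 ?adde_ge0// lee_fin powR_ge0.
- by apply: measurable_funeM; exact: emeasurable_funD.
apply: ae_imp (ae_pair out) => -[x y] /= [outx outy] _.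
rewrite -EFinD -EFinM lee_fin /gag /= -mulrDl mulrA ler_wpM2r ?invr_ge0 ?powR_ge0//.
rewrite (@excessE _ _ K0 (u ^~ t) (v ^~ t) x outx).
rewrite (@excessE _ _ K0 (u ^~ t) (v ^~ t) y outy).
apply: (@le_trans _ _ ((`|v x t - v y t| + `|u x t - u y t|) `^ p)).
  rewrite ge0_ler_powR ?nnegrE ?(ltW p0) ?addr_ge0//.
  rewrite (le_trans (maxr_sub_le _ _))//.
  rewrite (_ : v x t - u x t - _ = (v x t - v y t) - (u x t - u y t)); last ring.
  exact: ler_normB.
by rewrite powRD_le// ltW.
Qed.

Let mW (f : E -> R -> R) : measurable_fun setT (fun z : E * T => f z.1 z.2) ->
  [/\ measurable_fun setT (fun t => gag1 s p K1 (f ^~ t)) &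
      measurable_fun setT (fun t => \int[dx]_(x in K0) (`|f x t| `^ p)%:E)%E].
Proof.
move=> mf; split.
  exact: (@measurable_gag1_param _ _ s p K1 cK1 _ T _ mf).
exact: (@measurable_lp_param _ _ _ T _ mf p K0 mK0).
Qed.

Lemma slab_finite_ae f : slab_bound f ->
  {ae dt, forall t, t \in `[a, b] -> [/\ (gag1 s p K1 (f ^~ t) < +oo)%E,
    (\int[dx]_(x in K0) (`|f x t| `^ p)%:E < +oo)%E &
    (data_size s p K0 K1 C M (f ^~ t) < +oo)%E]}.
Proof.
move=> [mf gf lf _ _]; have [mg ml] := @mW f mf.
have l0 t : (0 <= \int[dx]_(x in K0) (`|f x t| `^ p)%:E)%E.
  by apply: integral_ge0 => x _; rewrite lee_fin powR_ge0.
have := ae_lty a b ml l0 lf.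
have := ae_lty a b mg (fun t => gag1_ge0 _ _ _ _) gf.
apply: ae_imp2 => t H1 H2 tI; have {}H1 := H1 tI; have {}H2 := H2 tI.
split => //; apply: lte_add_pinfty; last exact: ltry.
apply: lte_add_pinfty => //; apply: lte_mul_pinfty => //.
by rewrite lee_fin data_lp_const_ge0.
Qed.

Lemma data_size_integral f : slab_bound f ->
  (\int[dt]_(t in `[a, b]) data_size s p K0 K1 C M (f ^~ t) < +oo)%E.
Proof.
move=> [mf gf lf _ _]; have [mg ml] := @mW f mf.
have l0 t : (0 <= \int[dx]_(x in K0) (`|f x t| `^ p)%:E)%E.
  by apply: integral_ge0 => x _; rewrite lee_fin powR_ge0.
have c1 : 0 <= data_lp_const (n := n) s p C by exact: data_lp_const_ge0.
have c2 : 0 <= data_tail_const p K0 C M by exact: data_tail_const_ge0.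
rewrite /data_size ge0_integralD//; last 2 first.
- by move=> t _; apply: adde_ge0; [exact: gag1_ge0|exact: mule_ge0].
- by apply: measurable_funTS; apply: emeasurable_funD => //; exact: measurable_funeM.
rewrite lte_add_pinfty//; last first.
  by rewrite integral_cst//= lebesgue_measure_itv /= lte_fin ab -EFinB -EFinM ltry.
rewrite ge0_integralD//; [|by move=> t _; exact: gag1_ge0|exact: measurable_funTS|
  by move=> t _; exact: mule_ge0|
  by apply: measurable_funTS; exact: measurable_funeM].
rewrite lte_add_pinfty// ge0_integralZl//; last exact: measurable_funTS.
by rewrite lte_mul_pinfty.
Qed.

Let mexW : [/\ measurable_fun setT (fun t => gag1 s p K1 (ex t)) &
  measurable_fun setT (fun t => \int[dx]_x (`|ex t x| `^ p)%:E)%E].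
Proof.
split; first exact: (@measurable_gag1_param _ _ s p K1 cK1 _ T _ mex).
exact: (@measurable_lp_param _ _ _ T _ mex p setT measurableT).
Qed.

Let lp0 (f : E -> R -> R) A t : (0 <= \int[dx]_(x in A) (`|f x t : R| `^ p)%:E)%E.
Proof. by apply: integral_ge0 => x _; rewrite lee_fin powR_ge0. Qed.

Lemma gag1_excess_integral : (\int[dt]_(t in `[a, b]) gag1 s p K1 (ex t) < +oo)%E.
Proof.
have [_ gu _ _ _] := bu; have [_ gv _ _ _] := bv.
have [mgu _] := @mW u mu; have [mgv _] := @mW v mv; have [mg _] := mexW.
have g0 f : (0 <= gag1 s p K1 f)%E by exact: gag1_ge0.
refine (ae_dominated_integral_lty dt (measurable_itv `[a, b]) (powR_ge0 2 p)
  mg mgv mgu (fun t => g0 _) (fun t => g0 _) (fun t => g0 _) _ gv gu).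
by move: vu_out_cc; apply: ae_imp => t H tI; apply: gag1_excess_le; exact: H.
Qed.

Lemma excess_lp_integral :
  (\int[dt]_(t in `[a, b]) \int[dx]_x (`|ex t x| `^ p)%:E < +oo)%E.
Proof.
have [_ _ lu _ _] := bu; have [_ _ lv _ _] := bv.
have [_ mlu] := @mW u mu; have [_ mlv] := @mW v mv; have [_ ml] := mexW.
refine (ae_dominated_integral_lty dt (measurable_itv `[a, b]) (powR_ge0 2 p)
  ml mlv mlu (lp0 (fun x t => ex t x) setT) (lp0 v K0) (lp0 u K0) _ lv lu).
by apply: aeW => t _; exact: excess_lp_le.
Qed.

(** Measures the increment of the excess from time z.1 to time z.2; small on
    average when the two times are close. *)
Definition excess_shift (z : T * T) : \bar R :=
  test_size s p K1 C M (fun x => ex z.2 x - ex z.1 x).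

Let mshift : measurable_fun setT excess_shift.
Proof.
pose W (y : E * (T * T)) := ex y.2.2 y.1 - ex y.2.1 y.1.
have mW' : measurable_fun setT W.
  apply: measurable_funB; apply: mex_comp; (try exact: measurable_fst).
    exact: (measurableT_comp measurable_snd measurable_snd).
  exact: (measurableT_comp measurable_fst measurable_snd).
exact: (@measurable_test_size_param _ _ s p K1 cK1 _ _ W mW' C M).
Qed.

Let shift0 z : (0 <= excess_shift z)%E. Proof. exact: test_size_ge0. Qed.

Lemma excess_lp_translation (e : R) : 0 < e -> \forall h \near 0^'+,
  (\int[dt]_(t in `[(a + h)%R, b])
     \int[dx]_x (`|ex t x - ex (t - h)%R x| `^ p)%:E <= e%:E)%E.
Proof.
move=> e0; pose f (z : E * T) := ex z.2 z.1.
have fint : (\int[dx]_x \int[dt]_(t in `[a, b]) (`|f (x, t)| `^ p)%:E < +oo)%E.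
  rewrite (integral_setX_swap (m1 := dx) (m2 := dt) (A := setT)
    (f := fun z => (`|f z| `^ p)%:E))//.
    exact: excess_lp_integral.
  apply/measurable_EFinP; apply: (measurableT_comp (measurable_powR _)).
  by apply: measurableT_comp => //; exact: mex.
have H := @Lp_translation R _ _ dx f p a b e p1 mex fint e0.
apply: filterS H => h; apply: le_trans; rewrite le_eqVlt; apply/orP; left; apply/eqP.
by apply: eq_integral => t _; apply: eq_integral => x _; rewrite distrC.
Qed.

(** The Gagliardo energy on K1 x K1 is the p-th power of an L^p norm over pairs of
    points, of the increment divided by |x - y|^(q/p); hence translations in time
    are continuous in it. *)
Lemma excess_gag_translation (e : R) : 0 < e -> \forall h \near 0^'+,
  (\int[dt]_(t in `[(a + h)%R, b])
     gag1 s p K1 (fun x => (ex t x - ex (t - h) x)%R) <= e%:E)%E.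
Proof.
move=> e0.
pose k (z : E * E) : R := eucl (z.1 - z.2) `^ (- (q / p)).
have kp z : k z `^ p = (eucl (z.1 - z.2) `^ q)^-1.
  by rewrite /k -powRrM mulNr divfK ?gt_eqF// powRN.
have k0 z : 0 <= k z by exact: powR_ge0.
have gagE (g : E -> R) z :
    `|\1_(K1 `*` K1) z * (g z.1 - g z.2) * k z| `^ p =
    \1_(K1 `*` K1) z * gag p q g z.
  rewrite !normrM (ger0_norm (k0 z)) powRM ?mulr_ge0//.
  rewrite powRM// kp -mulrA; congr (_ * _).
  by rewrite indicE; case: (_ \in _); rewrite ?normr1 ?powR1// normr0 powR0 ?gt_eqF.
pose f (y : (E * E) * T) := \1_(K1 `*` K1) y.1 * (ex y.2 y.1.1 - ex y.2 y.1.2) * k y.1.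
have mK : measurable (K1 `*` K1) by exact: measurableX.
have mf : measurable_fun setT f.
  apply: measurable_funM; last first.
    apply: (measurableT_comp (f := k)) => //; apply: (measurableT_comp (measurable_powR _)).
    apply: (measurableT_comp measurable_eucl); apply: measurable_fun_rVP => i.
    under eq_fun do rewrite !mxE; apply: measurable_funB.
      exact: (measurableT_comp (measurable_rV_coord i) measurable_fst).
    exact: (measurableT_comp (measurable_rV_coord i) measurable_snd).
  apply: measurable_funM.
    exact: (measurableT_comp (measurable_indic mK) measurable_fst).
  apply: measurable_funB; apply: mex_comp; (try exact: measurable_snd).
    exact: (measurableT_comp measurable_fst measurable_fst).
  exact: (measurableT_comp measurable_snd measurable_fst).
have fint : (\int[sf_prod dx dx]_z \int[dt]_(t in `[a, b]) (`|f (z, t)| `^ p)%:E < +oo)%E.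
  rewrite (integral_setX_swap (m1 := sf_prod dx dx) (m2 := dt) (A := setT)
    (f := fun z => (`|f z| `^ p)%:E))//; last first.
    apply/measurable_EFinP; apply: (measurableT_comp (measurable_powR _)).
    exact: measurableT_comp.
  apply: le_lt_trans gag1_excess_integral.
  rewrite le_eqVlt; apply/orP; left; apply/eqP; apply: eq_integral => t _; rewrite /gag1 -[RHS]integral_indic_mul//.
  by apply: eq_integral => z _; rewrite /f /= gagE.
have H := @Lp_translation R _ _ (sf_prod dx dx) f p a b e p1 mf fint e0.
apply: filterS H => h; apply: le_trans; rewrite le_eqVlt; apply/orP; left; apply/eqP.
apply: eq_integral => t _; rewrite /gag1 -[LHS]integral_indic_mul//.
apply: eq_integral => z _; rewrite -gagE distrC /f /=; congr ((`|_| `^ p)%:E); ring.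
Qed.

Lemma excess_shift_small (e : R) : 0 < e -> \forall h \near 0^'+,
  (\int[dt]_(t in `[(a + h)%R, b]) excess_shift ((t - h)%R, t) <= e%:E)%E.
Proof.
move=> e0; pose c := test_lp_const (n := n) s p C M.
have c0 : 0 <= c by exact: test_lp_const_ge0.
have e20 : 0 < e / 2 by rewrite divr_gt0.
have e2c : 0 < e / 2 / (c + 1) by rewrite divr_gt0// ltr_wpDl.
have := excess_gag_translation _ e20; have := excess_lp_translation _ e2c.
apply: filterS2 => h Hl Hg.
have mpair : measurable_fun setT (fun y : E * T => ex y.2 y.1 - ex (y.2 - h) y.1).
  apply: measurable_funB; first exact: mex.
  apply: mex_comp; first exact: measurable_fst.
  exact: (measurableT_comp (measurable_translate (- h)) measurable_snd).
have mg := @measurable_gag1_param _ _ s p K1 cK1 _ T _ mpair.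
have ml := @measurable_lp_param _ _ _ T _ mpair p setT measurableT.
have l0 := lp0 (fun x t => ex t x - ex (t - h) x) setT.
have g0 f : (0 <= gag1 s p K1 f)%E by exact: gag1_ge0.
have E1 := ge0_integral_lin dt (measurable_itv `[(a + h), b]) ler01 c0 mg ml
  (fun t => g0 _) l0.
have E2 : (\int[dt]_(t in `[(a + h)%R, b]) excess_shift ((t - h)%R, t) =
    \int[dt]_(t in `[(a + h)%R, b]) (1%:E * gag1 s p K1 (fun x => (ex t x - ex (t - h) x)%R)
    + c%:E * \int[dx]_x (`|ex t x - ex (t - h)%R x| `^ p)%:E))%E.
  by apply: eq_integral => t _; rewrite mul1e.
rewrite E2 E1 mul1e.
rewrite (splitr e) EFinD; apply: (leeD Hg).
apply: (@le_trans _ _ (c%:E * (e / 2 / (c + 1))%:E)%E).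
  by apply: lee_wpmul2l; [rewrite lee_fin|exact: Hl].
rewrite -EFinM lee_fin mulrCA ler_piMr ?(ltW e20)//.
by rewrite ler_pdivrMr ?mul1r ?lerDl// ltr_wpDl.
Qed.

Let l2u t : t \in `[a, b] -> (\int[dx]_(x in K0) (u x t ^+ 2)%:E < +oo)%E.
Proof. by case: bu => _ _ _ _; exact. Qed.
Let l2v t : t \in `[a, b] -> (\int[dx]_(x in K0) (v x t ^+ 2)%:E < +oo)%E.
Proof. by case: bv => _ _ _ _; exact. Qed.

Let mext t : measurable_fun setT (ex t).
Proof. by apply: measurable_excess. Qed.

Lemma excess_sqr_lty t : t \in `[a, b] ->
  (\int[dx]_(x in K0) (ex t x ^+ 2)%:E < +oo)%E.
Proof.
move=> tI; refine (sqr_integral_lty dx mK0 (mvt t) (mut t) (mext t) _ (l2v _ tI) (l2u _ tI)).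
move=> x; rewrite /excess indicE; case: (_ \in _); rewrite ?mul1r ?mul0r ?normr0.
  have := maxr_sub_le (v x t - u x t) 0; rewrite maxxx !subr0.
  by move/le_trans; apply; exact: ler_normB.
exact: addr_ge0.
Qed.

Lemma excess_massE t : excess_mass t = (\int[dx]_(x in K0) (ex t x ^+ 2)%:E)%E.
Proof.
by apply: eq_integral => x xK; rewrite /excess indicE xK mul1r.
Qed.

(** Times at which the excess is an admissible test function and at which the
    fixed-time estimate applies. *)
Definition good_time t :=
  [/\ t \in `[a, b], {ae dx, forall x, ~ K0 x -> v x t <= u x t},
   (data_size s p K0 K1 C M (u ^~ t) < +oo /\
    data_size s p K0 K1 C M (v ^~ t) < +oo)%E,
   (\int[dx]_x (tail_integrand p q (u ^~ t) x)%:E <= M%:E /\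
    \int[dx]_x (tail_integrand p q (v ^~ t) x)%:E <= M%:E)%E &
   test_function (ex t)].

Lemma good_time_ae : {ae dt, forall t, t \in `[a, b] -> good_time t}.
Proof.
have [_ _ _ tu _] := bu; have [_ _ _ tv _] := bv.
have H1 := ae_itv_and (@slab_finite_ae u bu) (@slab_finite_ae v bv).
have H3 := ae_itv_and H1 (ae_itv_and tu tv).
move: H3 vu_out_cc; apply: ae_imp2 => t A B tI.
have {}B := B tI; have [[[gu lu du] [gv lv dv]] tt] := A tI.
split; [exact: tI|exact: B|exact: conj du dv|exact: tt|split].
- exact: mext.
- by move=> x; exact: excess_out.
- by move=> x; rewrite /excess mulr_ge0// le_max lexx orbT.
- apply: lte_add_pinfty; first apply: (le_lt_trans (gag1_excess_le _ B)).
    exact (lin_lty (powR_ge0 2 p) gv gu).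
  apply: lte_mul_pinfty; [by rewrite lee_fin test_lp_const_ge0|by []|].
  apply: (le_lt_trans (excess_lp_le t)).
  exact (lin_lty (powR_ge0 2 p) lv lu).
- split; last exact: excess_sqr_lty.
  apply: (le_lt_trans (excess_lp_le t)).
  exact (lin_lty (powR_ge0 2 p) lv lu).
Qed.

Local Notation ds f t := (data_size s p K0 K1 C M (f ^~ t)).

Let mds (f : E -> R -> R) : measurable_fun setT (fun z : E * T => f z.1 z.2) ->
  measurable_fun setT (fun t : T => ds f t).
Proof. by move=> mf; exact (@measurable_data_size_param R n s p K1 cK1 _ T _ mf K0 C M mK0). Qed.

Let ts0 phi : (0 <= test_size s p K1 C M phi)%E.
Proof. exact: (test_size_ge0 (n := n)). Qed.

Let ds0 (f : E -> R -> R) t : (0 <= ds f t)%E.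
Proof. exact: data_size_ge0. Qed.

(** Makes the time integrals in the two weak inequalities genuine, so that they
    can be subtracted. *)
Lemma energy_integrable (f : E -> R -> R) phi r t : slab_bound f -> test_function phi ->
  a <= r -> t <= b ->
  dt.-integrable `[r, t] (EFin \o (fun tau => energy s p (f ^~ tau) phi)).
Proof.
move=> bf [mphi phi0 _ phifin _] ar tb; have [mf _ _ tf _] := bf.
have men : measurable_fun setT (fun tau : T => energy s p (f ^~ tau) phi).
  exact (@measurable_energy_param R n s p _ T _ mf phi mphi).
have mEen : measurable_fun setT (EFin \o (fun tau : T => energy s p (f ^~ tau) phi)).
  exact/measurable_EFinP.
have sub : `[r, t] `<=` `[a, b].
  move=> x /=; rewrite !in_itv /= => /andP[rx xt].
  by rewrite (le_trans ar rx) (le_trans xt tb).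
apply/integrableP; split; first exact: measurable_funTS mEen.
refine (ae_dominated_integral_lty dt (measurable_itv `[r, t]) ler01
  (measurableT_comp _ mEen) (mds _ mf) (measurable_cst (test_size s p K1 C M phi))
  (fun x => abse_ge0 _) (ds0 f) (fun=> ts0 phi) _ _ _).
- exact: abse_measurable.
- move: (ae_itv_and (slab_finite_ae bf) tf); apply: ae_imp => x H xI; have [[_ _ df] tx] := H (sub _ xI).
  rewrite mul1e; apply: (norm_energy_le s p C M s0 p2 C0 cK0 cK1 K01 kernelC) => //.
  exact (@measurable_fun_pair1 _ _ _ E T _ _ x mf).
- apply: le_lt_trans (data_size_integral bf).
  apply: ge0_subset_integral => //; exact: measurable_funTS (mds _ mf).
- rewrite integral_cst//= lebesgue_measure_itv /=; apply: lte_mul_pinfty.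
  + exact: ts0.
  + by rewrite ge0_fin_numE//; exact: ts0.
  + by case: ifP => _; [rewrite -EFinB ltry|exact: ltry].
Qed.

(** An upper bound for the integrand (in tau) that controls the growth of the
    excess mass up to time t, as a function of (tau, t). *)
Definition gap_bound (e : R) (z : T * T) : \bar R :=
  ((2 * e)%:E * (ds v z.1 + ds u z.1) + (4 * e `^ (1 - p))%:E * excess_shift z)%E.

Let mgap e : measurable_fun setT (gap_bound e).
Proof.
apply: emeasurable_funD; apply: measurable_funeM; last exact: mshift.
have mD := emeasurable_funD (mds _ mv) (mds _ mu).
exact (measurableT_comp mD measurable_fst).
Qed.

Let gap0 e z : 0 < e -> (0 <= gap_bound e z)%E.
Proof.
move=> e0; apply: adde_ge0; apply: mule_ge0.
- by rewrite lee_fin mulr_ge0// ltW.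
- by apply: adde_ge0; exact: ds0.
- by rewrite lee_fin mulr_ge0// powR_ge0.
- exact: shift0.
Qed.

(** Both weak inequalities over [r, t] are tested with the excess frozen at the
    final time t; convexity of the squared positive part bounds the increase of
    the mass, and at each intermediate time tau the frozen excess is compared
    with the excess at tau. *)
Lemma excess_mass_growth e t r : 0 < e -> good_time t -> a <= r -> r < t ->
  (excess_mass t <= excess_mass r + \int[dt]_(tau in `[r, t]) gap_bound e (tau, t))%E.
Proof.
move=> e0 [tI out [dut dvt] [tut tvt] test] ar rt.
have tb : t <= b by move: tI; rewrite in_itv /= => /andP[].
have rI : r \in `[a, b] by rewrite in_itv /= ar (le_trans (ltW rt) tb).
have Iu := @energy_integrable u (ex t) r t bu test ar tb.
have Iv := @energy_integrable v (ex t) r t bv test ar tb.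
have mI : measurable (`[r, t]%classic : set T) by exact: measurable_itv.
have Iuv := @integrableB _ T R dt _ mI _ _ Iu Iv.
have I2 := @integrableZl _ T R dt _ mI 2 _ Iuv.
have Xr := @excess_sqr_lty r rI; have Xt := @excess_sqr_lty t tI.
have HX := Rintegral_sqr_growth dx mK0 (mext t) (mext r) (mvt t) (mvt r) (mut t) (mut r)
  Xt Xr (l2v _ tI) (l2v _ rI) (l2u _ tI) (l2u _ rI) _.
have {}HX : \int[dx]_(x in K0) (ex t x ^+ 2) - \int[dx]_(x in K0) (ex r x ^+ 2) <=
  \int[dt]_(tau in `[r, t]) (2 * (energy s p (u ^~ tau) (ex t) - energy s p (v ^~ tau) (ex t))).
  apply: (le_trans (HX _)).
    move=> x Kx; rewrite /excess indicE (mem_set Kx) !mul1r.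
    have := maxr_sqr_convex (v x t - u x t) (v x r - u x r).
    rewrite ler_pdivrMr//; move/le_trans; apply; rewrite le_eqVlt; apply/orP; left.
    by apply/eqP; ring.
  rewrite (@RintegralZl _ T R dt _ _ 2 mI Iuv) (@RintegralB _ T R dt _ _ _ mI Iu Iv) ler_pM2l//.
  have := @weak_v r t (ex t) ar rt tb test; have := @weak_u r t (ex t) ar rt tb test.
  exact: le_of_pairings.
rewrite !excess_massE.
have fX t' : t' \in `[a, b] -> (\int[dx]_(x in K0) (ex t' x ^+ 2)%:E =
    (\int[dx]_(x in K0) (ex t' x ^+ 2))%:E)%E.
  move=> t'I; rewrite fineK// ge0_fin_numE; first exact: excess_sqr_lty.
  by apply: integral_ge0 => x _; rewrite lee_fin sqr_ge0.
rewrite (fX _ tI) (fX _ rI).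
rewrite lerBlDl in HX; rewrite -lee_fin EFinD in HX.
apply: (le_trans HX); apply: leeD2l.
rewrite fineK; last exact: integrable_fin_num I2.
apply: integral_le_ge0.
- exact: measurable_itv.
- exact: measurable_int I2.
- apply: measurable_funTS.
  exact (measurableT_comp (mgap e) (pair2_measurable t)).
- by move=> x _; exact: gap0.
- move: good_time_ae; apply: ae_imp => tau H xI.
  have tauI : tau \in `[a, b].
    move: xI; rewrite /= !in_itv /= => /andP[rtau taut].
    by rewrite (le_trans ar rtau) (le_trans taut tb).
  have [_ otau [dut' dvt'] [tut' tvt'] _] := H tauI.
  have [mz z0 _ zfin _] := test.
  have G := energy_gap s p C M s0 p2 C0 cK0 cK1 K01 kernelC e (mut tau) (mvt tau) mz z0
    tut' tvt' dut' dvt' zfin otau e0.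
  rewrite EFinM /gap_bound /excess_shift /= -gap_algebra ?powR_ge0 ?(ltW e0)//.
  by apply: lee_wpmul2l.
Qed.

(** The constant c is chosen first, to make the size of the solutions small; then
    continuity of translations makes the shift term small, although its
    coefficient c^(1-p) is large. *)
Lemma gap_bound_small (e : R) : 0 < e -> exists2 c : R, 0 < c &
  \forall h \near 0^'+,
    (\int[dt]_(t in `[(a + h)%R, b]) gap_bound c ((t - h)%R, t) <= e%:E)%E.
Proof.
move=> e0; pose D (t : T) : \bar R := (ds v t + ds u t)%E.
have mD : measurable_fun setT D := emeasurable_funD (mds _ mv) (mds _ mu).
have D0 t : (0 <= D t)%E by apply: adde_ge0; exact: ds0.
have Dfin : (\int[dt]_(t in `[a, b]) D t < +oo)%E.
  refine (ae_dominated_integral_lty dt (measurable_itv `[a, b]) ler01 mD (mds _ mv) (mds _ mu)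
    D0 (ds0 v) (ds0 u) _ (data_size_integral bv) (data_size_integral bu)).
  by apply: aeW => t _; rewrite mul1e.
pose I := fine (\int[dt]_(t in `[a, b]) D t)%E.
have IE : (\int[dt]_(t in `[a, b]) D t)%E = I%:E.
  by rewrite fineK// ge0_fin_numE// integral_ge0.
have I0 : 0 <= I by apply: fine_ge0; apply: integral_ge0.
(* 2 c I <= e / 2 *)
pose c := e / 4 / (I + 1).
have I1 : 0 < I + 1 by rewrite ltr_wpDl.
have c0 : 0 < c by rewrite !divr_gt0.
pose k := 4 * c `^ (1 - p).
have k0 : 0 < k by rewrite mulr_gt0// powR_gt0.
exists c => //.
have ek0 : 0 < e / 2 / k by rewrite !divr_gt0.
have near_pos : \forall h \near 0^'+, (0 : R) < h by exact: nbhs_right_gt.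
move: near_pos (excess_shift_small _ ek0); apply: filterS2 => h h0 Hh.
have mDh : measurable_fun setT (fun t : T => D (t - h)).
  exact (measurableT_comp mD (measurable_translate (- h))).
have mSh : measurable_fun setT (fun t : T => excess_shift ((t - h)%R : T, t)).
  apply: (measurableT_comp mshift); apply: measurable_fun_pair.
    exact: measurable_translate.
  exact: measurable_id.
have c20 : 0 <= 2 * c by rewrite mulr_ge0// ltW.
rewrite (ge0_integral_lin dt (measurable_itv `[(a + h), b]) c20 (ltW k0) mDh mSh
  (fun t => D0 _) (fun t => shift0 _)).
rewrite (splitr e) EFinD; apply: leeD.
  apply: (@le_trans _ _ ((2 * c)%:E * I%:E)%E).
    apply: lee_wpmul2l; first by rewrite lee_fin.
    rewrite -IE (ge0_integral_itv_translate _ _ _ _ mD D0) addrK.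
    apply: ge0_subset_integral; [exact: measurable_itv|exact: measurable_itv|
      exact: measurable_funTS mD|by move=> x _; exact: D0|].
    move=> x /=; rewrite !in_itv /= => /andP[-> xb].
    by rewrite (le_trans xb)// lerBlDr lerDl ltW.
  rewrite -EFinM lee_fin (_ : 2 * c * I = e / 2 * (I / (I + 1))); last first.
    by rewrite /c; field; rewrite gt_eqF.
  by rewrite ler_piMr ?divr_ge0 ?(ltW e0)// ler_pdivrMr// mul1r lerDl.
apply: (@le_trans _ _ (k%:E * (e / 2 / k)%:E)%E).
  by apply: lee_wpmul2l; [rewrite lee_fin ltW|exact: Hh].
by rewrite -EFinM lee_fin mulrCA divff ?gt_eqF// mulr1.
Qed.

Lemma excess_mass_vanish : (\int[dt]_(t in `[a, b]) excess_mass t = 0)%E.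
Proof.
apply: integral_eq0_of_gap => //.
- rewrite (_ : excess_mass = fun t => \int[dx]_(x in K0) (ex t x ^+ 2)%:E)%E; last first.
    by apply/funext => t; exact: excess_massE.
  refine (measurable_fun_integral1 (m1 := dx) (A := K0)
    (f := fun xt : E * T => (ex xt.2 xt.1 ^+ 2)%:E) _ _ _).
  + exact: mK0.
  + by apply/measurable_EFinP; exact: measurable_funX mex.
  + by move=> x; rewrite lee_fin sqr_ge0.
- by move=> t; apply: integral_ge0 => x _; rewrite lee_fin sqr_ge0.
move=> e e0; have [c c0 Hc] := gap_bound_small _ e0.
exists (gap_bound c); split => //.
- by move=> z; exact: gap0.
- move: good_time_ae; apply: ae_imp => t H /andP[at_ tb] r /andP[ar rt].
  by apply: excess_mass_growth => //; apply: H; rewrite in_itv /= (ltW at_).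
Qed.

End slab.

Unset Implicit Arguments.

(** * Null sets of products, primitives and norms *)

Section product_ae.
Local Open Scope ereal_scope.
Context d1 d2 (T1 : measurableType d1) (T2 : measurableType d2) (R : realType).
Variable m1 : {sigma_finite_measure set T1 -> \bar R}.
Variable m2 : {sigma_finite_measure set T2 -> \bar R}.

Lemma ae_prod_section (P : T1 * T2 -> Prop) : {ae m1 \x m2, forall z, P z} ->
  {ae m2, forall y, {ae m1, forall x, P (x, y)}}.
Proof.
move=> [N [mN N0 PN]].
pose f z : \bar R := (\1_N z)%:E.
have mf : measurable_fun setT f by apply/measurable_EFinP; exact: measurable_indic.
have f0 z : 0 <= f z by rewrite lee_fin.
have mg : measurable_fun setT (fun y => \int[m1]_x f (x, y)).
  exact: (measurable_fun_integral1 (m1 := m1) (A := setT)).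
have : \int[m2]_y `|\int[m1]_x f (x, y)| = 0.
  transitivity (\int[m1 \x m2]_(z in setT `*` setT) f z).
    rewrite (integral_setX21 (m1 := m1) (m2 := m2))//; apply: eq_integral => y _.
    by rewrite gee0_abs// integral_ge0.
  by rewrite setXTT integral_indic// setIT.
move/(ae_eq_integral_abs m2 measurableT mg); apply: ae_imp => y /(_ I) /= Hy.
exists (ysection N y); split.
- exact: measurable_ysection.
- rewrite -[RHS]Hy -[LHS](_ : \int[m1]_x (\1_(ysection N y) x)%:E = _); last first.
    by rewrite integral_indic ?setIT//; exact: measurable_ysection.
  by apply: eq_integral => x _; rewrite /f !indicE mem_ysection.
- by move=> x /= nP; rewrite /ysection /= inE; apply: PN.
Qed.

Lemma prod_ae_of_integral_eq0 (f : T1 * T2 -> \bar R) (A : set T1) (B : set T2) :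
  measurable A -> measurable B -> measurable_fun setT f -> (forall z, 0 <= f z) ->
  \int[m2]_(y in B) \int[m1]_(x in A) f (x, y) = 0 ->
  {ae m1 \x m2, forall z, A z.1 -> B z.2 -> f z = 0}.
Proof.
move=> mA mB mf f0 If.
have mAB : measurable (A `*` B) by exact: measurableX.
have : \int[m1 \x m2]_(z in A `*` B) `|f z| = 0.
  rewrite -If -(integral_setX21 (m1 := m1) (m2 := m2))//.
  by apply: eq_integral => z _; rewrite gee0_abs.
move/(ae_eq_integral_abs _ mAB (measurable_funTS mf)).
by apply: ae_imp => z H Az Bz; exact: H.
Qed.

End product_ae.
Arguments ae_prod_section {d1 d2 T1 T2 R m1 m2 P}.
Arguments prod_ae_of_integral_eq0 {d1 d2 T1 T2 R m1 m2 f A B}.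

Section line.
Context {R : realType}.
Local Notation dt := (@lebesgue_measure R).

Lemma ae_exists_itv (P : R -> Prop) (c d : R) : c < d -> {ae dt, forall t, P t} ->
  exists2 t, c < t < d & P t.
Proof.
move=> cd [N [mN N0 PN]]; apply: contrapT => nex.
have sub : `]c, d[ `<=` N.
  move=> t /=; rewrite in_itv /= => tcd; apply: PN => /= Pt; apply: nex.
  by exists t.
have : (dt `]c, d[ <= dt N)%E by apply: le_measure => //; rewrite inE.
by rewrite [X in (_ <= X)%E]N0 lebesgue_measure_itv /= lte_fin cd -EFinB lee_fin subr_le0 leNgt cd.
Qed.

(** eta vanishes at both end points, which lie outside its support. *)
Lemma integral_smooth_deriv (eta : R -> R^o) (a b : R) : a < b -> is_smooth eta ->
  closure [set t | eta t != 0] `<=` `]a, b[ ->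
  \int[dt]_(t in `]a, b[) derive1 eta t = 0.
Proof.
move=> ab smooth supp; have [der cder] := smooth 1%N.
have eta0 t : ~ `]a, b[%classic t -> eta t = 0.
  move=> nt; apply: contrapT => /eqP et; apply: nt; apply: supp.
  exact: subset_closure.
have contE : forall t, {for t, continuous (eta : R -> R)}.
  by move=> t; apply: differentiable_continuous; apply/derivable1_diffP; exact: der.
have cont' : continuous (derive1 eta).
  rewrite (_ : derive1 eta = fun x => 'D_1 eta x); first exact: cder.
  by apply/funext => x; rewrite derive1E.
rewrite /Rintegral.
rewrite integral_itv_bndo_bndc; last first.
  apply/measurable_EFinP; apply: measurable_funTS; exact: continuous_measurable_fun.
rewrite integral_itv_obnd_cbnd; last first.
  apply/measurable_EFinP; apply: measurable_funTS; exact: continuous_measurable_fun.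
rewrite (continuous_FTC2 ab (F := eta)) //.
- by rewrite !eta0 ?subee//= in_itv /= ?ltxx ?andbF.
- exact: continuous_subspaceT.
- split.
  + by move=> x _; exact: der.
  + exact: cvg_at_right_filter (contE a).
  + exact: cvg_at_left_filter (contE b).
Qed.

End line.

Section Lnorm_finite.
Local Open Scope ereal_scope.
Context d (T : measurableType d) (R : realType) (mu : {measure set T -> \bar R}).

Lemma Lnorm_ltyP (r : R) (f : T -> \bar R) : (0 < r)%R ->
  (Lnorm mu r%:E f < +oo) <-> (\int[mu]_x `|f x| `^ r < +oo).
Proof.
move=> r0; rewrite unlock; split; last exact: poweR_lty.
by apply: lty_poweRy; rewrite invr_eq0 gt_eqF.
Qed.

Lemma Lnorm_restrict_ltyP (r : R) (D : set T) (f : T -> \bar R) : (0 < r)%R ->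
  (Lnorm mu r%:E (f \_ D) < +oo) <-> (\int[mu]_(x in D) `|f x| `^ r < +oo).
Proof.
move=> r0; rewrite Lnorm_ltyP// [X in _ <-> (X < _)]integral_mkcond.
rewrite (eq_integral ((fun x => `|f x| `^ r) \_ D))// => x _.
rewrite /patch; case: ifP => // _; rewrite abse0 poweR0r// gt_eqF//.
Qed.

End Lnorm_finite.

(** * Bounds from the solution space *)

Section solution_spaces.
Context {R : realType} {n : nat}.
Local Notation E := 'rV[R]_n.
Local Notation T := (measurableTypeR R).
Local Notation dx := (@lebesgue_rV R n).
Local Notation dt := (@lebesgue_measure R).

Lemma Lr_norm2_sqr (A : set E) (w : E -> R) :
  (Lr_norm 2 A w `^ 2 = \int[dx]_(x in A) (w x ^+ 2)%:E)%E.
Proof.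
rewrite /Lr_norm powR_Lnorm// [RHS]integral_mkcond; apply: eq_integral => x _.
rewrite /= /patch; case: ifP => _; last by rewrite normr0 powR0.
by rewrite powR_mulrn// real_normK// num_real.
Qed.

Lemma Lr_norm2_ltyP (A : set E) (w : E -> R) :
  (Lr_norm 2 A w < +oo)%E <-> (\int[dx]_(x in A) (w x ^+ 2)%:E < +oo)%E.
Proof.
rewrite -Lr_norm2_sqr; split; first exact: poweR_lty.
by apply: lty_poweRy.
Qed.

(** Extension by zero in time, which turns measurability on a slab into
    measurability on the whole space and leaves all quantities on the slab
    unchanged. *)
Definition slab_cut (a b : R) (f : E -> R -> R) (x : E) (t : R) : R :=
  if t \in `[a, b] then f x t else 0.

Lemma slab_cutE (a b : R) (f : E -> R -> R) t : t \in `[a, b] -> slab_cut a b f ^~ t = f ^~ t.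
Proof. by move=> tI; apply/funext => x; rewrite /slab_cut tI. Qed.

Lemma measurable_slab_cut (a b : R) (f : E -> R -> R) :
  measurable_fun (setT `*` [set` `[a, b]] : set (E * T)) (fun z : E * T => f z.1 z.2) ->
  measurable_fun setT (fun z : E * T => slab_cut a b f z.1 z.2).
Proof.
move=> mf.
have mD : measurable ((setT `*` `[a, b]) : set (E * T)).
  by apply: measurableX => //; exact: measurable_itv.
have := (measurable_restrictT _ mD).1 mf.
congr measurable_fun; apply/funext => -[x t]; rewrite /patch /slab_cut /=.
by rewrite in_setX /= in_setT /= mem_setE.
Qed.

Variables (s p : R) (Omega K0 K1 : set E) (t1 t2 a b : R) (f : E -> R -> R).
Hypotheses (p2 : 2 < p).
Hypotheses (cK0 : compact K0) (cK1 : compact K1).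
Hypotheses (K01 : K0 `<=` K1) (K1O : K1 `<=` Omega).
Hypotheses (t1a : t1 < a) (ab : a < b) (bt2 : b <= t2).
Hypothesis sol : solution_space s p Omega t1 t2 f.
Local Notation q := (n%:R + s * p).

Let p1 : 1 < p. Proof. by apply: lt_trans p2; rewrite ltr1n. Qed.
Let p0 : 0 < p. Proof. exact: lt_trans ltr01 p1. Qed.
Let mK0 := compact_measurable_rV K0 cK0.
Let mK1 := compact_measurable_rV K1 cK1.
Local Notation g := (slab_cut a b f).

Let mg : measurable_fun setT (fun z : E * T => g z.1 z.2).
Proof. by have [_ _ [mf _]] := sol _ _ t1a ab bt2; exact: measurable_slab_cut. Qed.

Lemma solution_tail : exists2 M, 0 <= M & {ae dt, forall t, t \in `[a, b] ->
  (\int[dx]_x (tail_integrand p q (f ^~ t) x)%:E <= M%:E)%E}.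
Proof.
have [_ _ [_]] := sol _ _ t1a ab bt2; rewrite unlock /=.
have -> : (0 < dt [set: T])%E.
  apply: (@lt_le_trans _ _ (dt `[0%R, 1%R])).
    by rewrite lebesgue_measure_itv /= lte_fin ltr01 -EFinB lte_fin subr0.
  by apply: le_measure => //; rewrite inE//; exact: measurable_itv.
pose N t := tail_norm s p (f ^~ t); rewrite -/N.
move: (ess_sup_ge dt (abse \o (N \_ `[a, b]))).
move: (ess_sup _ _) => S HS Sfin.
exists (`|fine S| `^ (p - 1)); first exact: powR_ge0.
move: HS; apply: ae_imp => t /= tS tI; move: tS; rewrite /patch mem_setE tI => tS.
have S0 : (0 <= S)%E by apply: le_trans tS.
have SE : S = (fine S)%:E by rewrite fineK// ge0_fin_numE.
have fS0 : 0 <= fine S by rewrite -lee_fin -SE.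
rewrite (ger0_norm fS0) -poweR_EFin -SE.
move: tS; rewrite gee0_abs ?poweR_ge0// /N /tail_norm.
set I := (\int[dx]_x _)%E => tS.
have I0 : (0 <= I)%E.
  by apply: integral_ge0 => x _; rewrite lee_fin divr_ge0 ?powR_ge0// addr_ge0 ?powR_ge0.
have p10 : 0 < p - 1 by rewrite subr_gt0.
have IE : (I = (I `^ (p - 1)^-1) `^ (p - 1))%E.
  by rewrite -poweRrM mulVf ?poweRe1// gt_eqF.
have Ifin : (I < +oo)%E.
  by apply: (lty_poweRy _ (le_lt_trans tS Sfin)); rewrite invr_neq0 ?gt_eqF.
have IfE : I = (fine I)%:E by rewrite fineK// ge0_fin_numE.
move: IE tS; rewrite IfE SE !poweR_EFin !lee_fin => -[IE] tS; rewrite [leLHS]IE.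
by rewrite ge0_ler_powR ?nnegrE ?powR_ge0 ?(ltW p10).
Qed.

Lemma solution_Wsp :
  (\int[dt]_(t in `[a, b]) (\int[dx]_(x in K1) (`|g x t| `^ p)%:E + gag1 s p K1 (g ^~ t))
   < +oo)%E.
Proof.
have [_ H _] := sol _ _ t1a ab bt2; have [_] := H K1 cK1 K1O.
move/(Lnorm_restrict_ltyP _ _ _ _ _ _ _ p0).
apply: le_lt_trans; rewrite le_eqVlt; apply/orP; left; apply/eqP.
apply: eq_integral => t; rewrite inE /= => tI.
pose X := (\int[dx]_(x in K1) (`|f x t| `^ p)%:E + gag1 s p K1 (f ^~ t))%E.
have X0 : (0 <= X)%E.
  by apply: adde_ge0; [apply: integral_ge0 => x _; rewrite lee_fin powR_ge0|exact: gag1_ge0].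
have E1 : (\int[dx]_(x in K1) (`|g x t| `^ p)%:E = \int[dx]_(x in K1) (`|f x t| `^ p)%:E)%E.
  by apply: eq_integral => x _; rewrite /slab_cut tI.
have E2 : gag1 s p K1 (g ^~ t) = gag1 s p K1 (f ^~ t) by rewrite slab_cutE.
transitivity X; first by rewrite E1 E2.
have -> : Wsp_norm s p K1 (f ^~ t) = (X `^ p^-1)%E by [].
rewrite gee0_abs; last exact: poweR_ge0.
rewrite -poweRrM mulVf; last by rewrite gt_eqF.
by rewrite (poweRe1 X0).
Qed.

Lemma solution_slab_bound : exists2 M0, 0 <= M0 &
  forall M, M0 <= M -> slab_bound s p K0 K1 M a b g.
Proof.
have [M0 M00 tailM] := solution_tail; exists M0 => // M M0M.
have mG := @measurable_gag1_param _ _ s p K1 cK1 _ T _ mg.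
have mL0 := @measurable_lp_param _ _ _ T _ mg p K0 mK0.
have mL1 := @measurable_lp_param _ _ _ T _ mg p K1 mK1.
have msum := emeasurable_funD mL1 mG.
have L0 A t : (0 <= \int[dx]_(x in A) (`|g x t| `^ p)%:E)%E.
  by apply: integral_ge0 => x _; rewrite lee_fin powR_ge0.
have mgt t : measurable_fun setT (g ^~ t).
  exact (@measurable_fun_pair1 _ _ _ E T _ _ t mg).
split.
- exact: mg.
- apply: le_lt_trans solution_Wsp; apply: ge0_le_integral.
  + exact: measurable_itv.
  + by move=> t _; exact: gag1_ge0.
  + exact: measurable_funTS mG.
  + exact: measurable_funTS msum.
  + by move=> t _; rewrite leeDr.
- apply: le_lt_trans solution_Wsp; apply: ge0_le_integral.
  + exact: measurable_itv.
  + by move=> t _; exact: L0.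
  + exact: measurable_funTS mL0.
  + exact: measurable_funTS msum.
  + move=> t _; apply: (@le_trans _ _ (\int[dx]_(x in K1) (`|g x t| `^ p)%:E)%E).
      apply: ge0_subset_integral => //.
      apply/measurable_EFinP; apply: measurable_funTS.
      apply: (measurableT_comp (measurable_powR _)).
      exact: measurableT_comp.
    by rewrite leeDl// gag1_ge0.
- move: tailM; apply: ae_imp => t H tI; rewrite slab_cutE//.
  by apply: le_trans (H tI) _; rewrite lee_fin.
- move=> t tI; apply/Lr_norm2_ltyP; rewrite slab_cutE//.
  have [H _ _] := sol _ _ t1a ab bt2.
  have [H0 _] := H K0 cK0 (subset_trans K01 K1O).
  by have [] := H0 t tI.
Qed.

End solution_spaces.

(** * The initial time *)

Section initial_time.
Set Implicit Arguments.
Context {R : realType} {n : nat}.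
Local Notation E := 'rV[R]_n.
Local Notation dx := (@lebesgue_rV R n).
Local Notation dt := (@lebesgue_measure R).

Lemma C_L2_increment (a b e : R) (K : set E) (f : E -> R -> R) :
  a < b -> 0 < e -> C_L2 a b K f -> \forall h \near 0^'+, forall t, a <= t <= a + h ->
  (\int[dx]_(x in K) ((f x t - f x a) ^+ 2)%:E <= e%:E)%E.
Proof.
move=> ab e0 [_ cont].
have aI : a \in `[a, b] by rewrite in_itv /= lexx ltW.
have d0 : 0 < Num.sqrt e by rewrite sqrtr_gt0.
have FF : Filter (within `[a, b] (nbhs a)) by apply: within_filter.
have := @cvge0_near_le R _ _ FF _ _ d0 (cont a aI).
rewrite near_withinE => /nbhs_ballP[r /= r0 ball_r].
have near_r : \forall h \near 0^'+, h < r by exact: nbhs_right_lt.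
have near_b : \forall h \near 0^'+, h < b - a by apply: nbhs_right_lt; rewrite subr_gt0.
move: near_r near_b; apply: filterS2 => h hr hb t /andP[at_ tah].
have tI : t \in `[a, b].
  by rewrite in_itv /= at_ (le_trans tah)// addrC -lerBrDr ltW.
have /ball_r/(_ tI) : ball a r t.
  by rewrite /ball /= distrC ger0_norm ?subr_ge0// (le_lt_trans _ hr)// lerBlDl.
rewrite -Lr_norm2_sqr; have : (0 <= Lr_norm 2 K (fun x => f x t - f x a)%R)%E.
  exact: Lnorm_ge0.
move: (Lr_norm _ _ _) => -[X| |]//=; rewrite !lee_fin => X0 Xe.
by rewrite powR_mulrn// -(sqr_sqrtr (ltW e0)) lerXn2r// nnegrE ltW.
Qed.

(** On K the initial excess vanishes by assumption. Off K one compares, by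
    continuity in L^2, with times arbitrarily close to a at which v <= u almost
    everywhere off K. *)
Lemma excess_mass_small (K K0 : set E) (a b : R) (u v : E -> R -> R) :
  measurable K0 -> a < b ->
  (forall t, measurable_fun setT (u ^~ t)) -> (forall t, measurable_fun setT (v ^~ t)) ->
  (forall e, 0 < e -> \forall h \near 0^'+, forall t, a <= t <= a + h ->
    (\int[dx]_(x in K0) ((u x t - u x a) ^+ 2)%:E <= e%:E)%E) ->
  (forall e, 0 < e -> \forall h \near 0^'+, forall t, a <= t <= a + h ->
    (\int[dx]_(x in K0) ((v x t - v x a) ^+ 2)%:E <= e%:E)%E) ->
  {ae dx, forall x, K x -> v x a <= u x a} ->
  {ae dt, forall t, a < t <= b -> {ae dx, forall x, ~ K x -> v x t <= u x t}} ->
  forall e, 0 < e -> \forall h \near 0^'+, forall t, a <= t <= a + h ->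
    (excess_mass K0 u v t <= e%:E)%E.
Proof.
move=> mK0 ab mu mv Hu Hv init out e e0.
(* 24 = 2 * 8 + 8: increments of u and v from time a enter once through the mass
   at time a and once through the mass at time t *)
have e240 : 0 < e / 24 by rewrite divr_gt0.
have near_pos : \forall h \near 0^'+, (0 : R) < h by exact: nbhs_right_gt.
have Huv : \forall h \near 0^'+, forall t, a <= t <= a + h ->
    (\int[dx]_(x in K0) ((u x t - u x a) ^+ 2)%:E <= (e / 24)%:E)%E /\
    (\int[dx]_(x in K0) ((v x t - v x a) ^+ 2)%:E <= (e / 24)%:E)%E.
  move: (Hu _ e240) (Hv _ e240); apply: filterS2 => h H1 H2 t th.
  by split; [exact: H1|exact: H2].
move: near_pos Huv; apply: filterS2 => h h0 {Hu Hv} Huv.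
pose du t x : \bar R := ((u x t - u x a) ^+ 2)%:E.
pose dv t x : \bar R := ((v x t - v x a) ^+ 2)%:E.
pose ma t x : \bar R := (Num.max (v x t - u x t) 0 ^+ 2)%:E.
have mdu t : measurable_fun setT (du t).
  by apply/measurable_EFinP; apply: measurable_funX; exact: measurable_funB.
have mdv t : measurable_fun setT (dv t).
  by apply/measurable_EFinP; apply: measurable_funX; exact: measurable_funB.
have mma t : measurable_fun setT (ma t).
  apply/measurable_EFinP; apply: measurable_funX; apply: measurable_maxr => //.
  exact: measurable_funB.
have du0 t x : (0 <= du t x)%E by rewrite lee_fin sqr_ge0.
have dv0 t x : (0 <= dv t x)%E by rewrite lee_fin sqr_ge0.
have ma0 t x : (0 <= ma t x)%E by rewrite lee_fin sqr_ge0.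
have c4 : (0 : R) <= 4 by [].
pose inc t x : \bar R := (4%:E * dv t x + 4%:E * du t x)%E.
have minc t : measurable_fun setT (inc t).
  by apply: emeasurable_funD; exact: measurable_funeM.
have inc0 t x : (0 <= inc t x)%E by rewrite adde_ge0// mule_ge0.
have incS t : a <= t <= a + h -> (\int[dx]_(x in K0) inc t x <= (8 * (e / 24))%:E)%E.
  move=> /Huv[H1 H2].
  rewrite (ge0_integral_lin dx mK0 c4 c4 (mdv t) (mdu t) (dv0 t) (du0 t)).
  have -> : ((8 * (e / 24))%:E = 4%:E * (e / 24)%:E + 4%:E * (e / 24)%:E)%E.
    by rewrite -!EFinM -EFinD; congr (_%:E); field.
  by apply: leeD; apply: lee_wpmul2l.
have inc_ge t x : 2 * ((v x a - u x a) - (v x t - u x t)) ^+ 2 <=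
    4 * (v x t - v x a) ^+ 2 + 4 * (u x t - u x a) ^+ 2.
  have := sqr_ge0 ((v x t - v x a) + (u x t - u x a)).
  move: (v x t) (v x a) (u x t) (u x a) => X Y Z W; rewrite !expr2; nra.
(* no mass at the initial time: compare with a later time at which v <= u off K *)
have init_mass : (\int[dx]_(x in K0) ma a x <= (8 * (e / 24))%:E)%E.
  have cd : a < Num.min (a + h) b by rewrite lt_min ab ltrDl h0.
  have [t /andP[at_ tm] outt] := ae_exists_itv _ _ _ cd out.
  move: tm; rewrite lt_min => /andP[tah tb].
  have th : a <= t <= a + h by rewrite !ltW.
  apply: le_trans (incS t th); apply: integral_le_ge0 => //.
  - exact: measurable_funTS (mma a).
  - exact: measurable_funTS (minc t).
  have {}outt : {ae dx, forall x, ~ K x -> v x t <= u x t}.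
    by apply: outt; rewrite at_ ltW.
  move: init outt; apply: ae_imp2 => x initx outx _.
  rewrite /ma /inc /dv /du -!EFinM -EFinD lee_fin; apply: le_trans (inc_ge t x).
  have [Kx|nKx] := pselect (K x).
    by rewrite (max_idPr _) ?subr_le0 ?initx// expr0n /= mulr_ge0// sqr_ge0.
  have := maxr_sqr_le (v x a - u x a) (v x t - u x t).
  by rewrite (max_idPr (_ : v x t - u x t <= 0)) ?subr_le0 ?outx// expr0n /= mulr0 add0r.
move=> t th; have c2 : (0 : R) <= 2 by [].
apply: (@le_trans _ _ (\int[dx]_(x in K0) (2%:E * ma a x + 1%:E * inc t x))%E).
  apply: ge0_le_integral => //.
  - by move=> x _; exact: (ma0 t).
  - exact: measurable_funTS (mma t).
  - by apply: measurable_funTS; apply: emeasurable_funD; exact: measurable_funeM.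
  move=> x _; rewrite mul1e /ma /inc /dv /du -!EFinM -!EFinD lee_fin.
  apply: le_trans (maxr_sqr_le _ (v x a - u x a)) _; rewrite lerD2l.
  by apply: le_trans (inc_ge t x); rewrite -sqrrN opprB.
rewrite (ge0_integral_lin dx mK0 c2 ler01 (mma a) (minc t) (ma0 a) (inc0 t)) mul1e.
have -> : (e%:E = 2%:E * (8 * (e / 24))%:E + (8 * (e / 24))%:E)%E.
  by rewrite -EFinM -EFinD; congr (_%:E); field.
by apply: leeD; [apply: lee_wpmul2l|exact: incS].
Qed.

End initial_time.

(** * Time-independent test functions *)

Section static_test.
Set Implicit Arguments.
Context {R : realType} {n : nat}.
Local Notation E := 'rV[R]_n.
Local Notation T := (measurableTypeR R).
Local Notation dx := (@lebesgue_rV R n).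
Local Notation dt := (@lebesgue_measure R).

Lemma static_bochner (q r t : R) (A : set E) (N : (E -> R) -> \bar R) (zeta : E -> R) :
  0 < q -> measurable_fun setT zeta -> (0 <= N zeta)%E -> (N zeta < +oo)%E ->
  bochner_space q%:E `[r, t] A N (fun x _ => zeta x).
Proof.
move=> q0 mz N0 Noo; split.
  by apply: measurable_funTS; exact: (measurableT_comp mz measurable_fst).
apply/(Lnorm_restrict_ltyP _ _ _ _ _ _ _ q0).
rewrite gee0_abs// integral_cst//= lebesgue_measure_itv /=; apply: lte_mul_pinfty.
- exact: poweR_ge0.
- by rewrite ge0_fin_numE ?poweR_ge0// poweR_lty.
- by case: ifP => _; [rewrite -EFinB ltry|exact: ltry].
Qed.

Lemma Lr_norm2_0 (A : set E) (w : E -> R) : w =1 (fun=> 0) -> Lr_norm 2 A w = 0%E.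
Proof.
move=> w0; apply: (@poweR_eq0_eq0 _ _ 2); first exact: Lnorm_ge0.
rewrite Lr_norm2_sqr; under eq_integral do rewrite w0 expr0n.
exact: integral0.
Qed.

Variables (s p C M : R) (K0 K1 : set E).
Local Notation q := (n%:R + s * p).
Hypotheses (s0 : 0 < s) (p2 : 2 < p) (C0 : 0 < C) (M0 : 0 <= M).
Hypotheses (cK0 : compact K0) (cK1 : compact K1) (K01 : K0 `<=` K1).
Hypothesis kernelC : forall x y, K0 x -> ~ K1 y ->
  (eucl (x - y) `^ q)^-1 <= C * tail_weight q y.
Variables (zeta : E -> R) (test : test_function s p K0 K1 C M zeta).

Lemma static_Lp_Wsp0 r t : Lp_Wsp0 s p r t K0 (fun x _ => zeta x).
Proof.
have [mz z0 _ zfin [zlp _]] := test.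
have p0 : 0 < p by rewrite (lt_trans _ p2).
split; last by apply: aeW => tau _; apply: aeW => x; exact: z0.
apply: static_bochner => //; first exact: poweR_ge0.
rewrite /Wsp_norm setXTT; apply: poweR_lty; apply: lte_add_pinfty => //.
have H := integral_gag_lty s p C M s0 p2 C0 M0 cK1 K01 kernelC mz z0 zfin zlp.
apply: le_lt_trans H; rewrite le_eqVlt; apply/orP; left; apply/eqP.
by apply: eq_integral => z _.
Qed.

(** The time derivative is 0, and the distributional identity says that the
    derivative of a test function of time has zero integral. *)
Lemma static_H1_L2 r t : r < t -> H1_L2 r t K0 (fun x _ => zeta x) (fun _ _ => 0).
Proof.
move=> rt; have [mz z0 _ zfin [_ z2]] := test.
have zL2 : (Lr_norm 2 K0 zeta < +oo)%E by apply/Lr_norm2_ltyP.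
split.
- by apply: static_bochner => //; exact: Lnorm_ge0.
- have L0 : Lr_norm 2 K0 (fun=> 0) = 0%E :> \bar R by exact: Lr_norm2_0.
  by apply: (@static_bochner _ _ _ _ _ (fun=> 0)) => //; rewrite L0.
- move=> eta smooth supp; apply: aeW => x _.
  under [in RHS]eq_Rintegral do rewrite mul0r.
  have [der cder] := smooth 1%N.
  have eq0 : \int[dt]_(t in `]r, t[) (0 : R) = 0 by rewrite /Rintegral integral0.
  rewrite eq0 oppr0 RintegralZl ?(integral_smooth_deriv _ _ _ rt smooth supp) ?mulr0//.
  have cont' : continuous (derive1 eta).
    rewrite (_ : derive1 eta = fun x => 'D_1 eta x); first exact: cder.
    by apply/funext => y; rewrite derive1E.
  have cI : dt.-integrable `[r, t] (EFin \o derive1 eta).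
    apply: continuous_compact_integrable; first exact: segment_compact.
    exact: continuous_subspaceT.
  by apply: (integrableS _ _ _ cI) => //; exact: subset_itv_oo_cc.
- split=> [tau _|tau _]; first by split; [exact: measurable_funTS|].
  rewrite (_ : (fun _ => _) = fun=> 0%E); first exact: cvg_cst.
  by apply/funext => y; apply: Lr_norm2_0 => x; rewrite subrr.
Qed.

Lemma static_weak_form (a b r t : R) (f : E -> R -> R) :
  a <= r -> r < t -> t <= b ->
  weak_form s p K0 r t f (fun x _ => zeta x) (fun _ _ => 0) =
  weak_pairing s p K0 (slab_cut a b f) r t zeta.
Proof.
move=> ar rt tb.
have cutE tau : r <= tau <= t -> slab_cut a b f ^~ tau = f ^~ tau.
  move=> /andP[rtau taut]; apply: slab_cutE.
  by rewrite in_itv /= (le_trans ar rtau) (le_trans taut tb).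
have cutx tau x : r <= tau <= t -> slab_cut a b f x tau = f x tau.
  by move=> H; rewrite -[RHS]/((f ^~ tau) x) -(cutE _ H).
rewrite /weak_form /weak_pairing.
have -> : \int[dt]_(tau in `[r, t]) \int[dx]_(x in K0) (f x tau * 0) = 0.
  rewrite /Rintegral integral0_eq// => tau _.
  by rewrite integral0_eq// => x _; rewrite mulr0.
rewrite subr0; congr (_ - _ + _).
- by apply: eq_Rintegral => x _; rewrite cutx// lexx ltW.
- by apply: eq_Rintegral => x _; rewrite cutx// lexx ltW.
- apply: eq_Rintegral => tau; rewrite inE /= in_itv /= => H.
  by rewrite cutE.
Qed.

End static_test.

Unset Implicit Arguments.

(** * The comparison principle *)

Theorem theorem3p1 (R : realType) (d : nat) (s p : R)
    (Omega K : set 'rV[R]_d) (t1 t2 tau1 tau2 : R)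
    (u v : 'rV[R]_d -> R -> R) :
  (0 < d)%N ->
  0 < s -> s < 1 -> 2 < p -> p < 2 / (1 - s) ->
  bounded_smooth_domain Omega -> t1 < t2 ->
  weak_supersolution s p Omega t1 t2 u ->
  weak_subsolution s p Omega t1 t2 v ->
  compactly_contained K Omega ->
  t1 < tau1 -> tau1 < tau2 -> tau2 <= t2 ->
  {ae (lebesgue_rV d \x lebesgue_measure)%E,
    forall z, ~ K z.1 -> z.2 \in `]tau1, tau2] -> v z.1 z.2 <= u z.1 z.2} ->
  {ae lebesgue_rV d, forall x, K x -> v x tau1 <= u x tau1} ->
  {ae (lebesgue_rV d \x lebesgue_measure)%E,
    forall z, K z.1 -> z.2 \in `]tau1, tau2] -> v z.1 z.2 <= u z.1 z.2}.
Proof.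
move=> _ s0 _ p2 _ [_ oO _ _ _] _ [solu wu] [solv wv] [cK0 KO] t1a ab bt2 out init.
pose K0 := closure K; rewrite -/K0 in cK0 KO.
have [r r0 [K1 cK1 [K01 K1O rK]]] := compact_neighborhood K0 Omega cK0 oO KO.
have q0 : 0 < d%:R + s * p by rewrite ltr_wpDl ?mulr_gt0// (lt_trans _ p2).
have [C C0 kC] := kernel_le_tail_weight K0 K1 r _ q0 r0 cK0 rK.
have [Mu Mu0 bu] :=
  solution_slab_bound s p Omega K0 K1 t1 t2 tau1 tau2 u p2 cK0 cK1 K01 K1O t1a ab bt2 solu.
have [Mv Mv0 bv] :=
  solution_slab_bound s p Omega K0 K1 t1 t2 tau1 tau2 v p2 cK0 cK1 K01 K1O t1a ab bt2 solv.
pose M := Num.max Mu Mv.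
have {}bu : slab_bound s p K0 K1 M tau1 tau2 (slab_cut tau1 tau2 u).
  by apply: bu; rewrite le_max lexx.
have {}bv : slab_bound s p K0 K1 M tau1 tau2 (slab_cut tau1 tau2 v).
  by apply: bv; rewrite le_max lexx orbT.
have M0 : 0 <= M by rewrite le_max Mu0.
set uc := slab_cut tau1 tau2 u in bu *; set vc := slab_cut tau1 tau2 v in bv *.
have cutE f x t : t \in `[tau1, tau2] -> slab_cut tau1 tau2 f x t = f x t.
  by move=> tI; rewrite /slab_cut tI.
have oc t : tau1 < t <= tau2 -> t \in `[tau1, tau2].
  by move=> /andP[at_ tb]; rewrite in_itv /= tb ltW.
have aI : tau1 \in `[tau1, tau2] by rewrite in_itv /= lexx ltW.
have outT : {ae lebesgue_measure, forall t : R, tau1 < t <= tau2 ->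
    {ae lebesgue_rV d, forall x, ~ K x -> vc x t <= uc x t}}.
  move: (ae_prod_section out); apply: ae_imp => t H tI.
  apply: ae_imp H => x H Kx; rewrite /vc /uc !cutE ?oc//.
  by apply: H => //=; rewrite in_itv.
have outT0 : {ae lebesgue_measure, forall t : R, tau1 < t <= tau2 ->
    {ae lebesgue_rV d, forall x, ~ K0 x -> vc x t <= uc x t}}.
  move: outT; apply: ae_imp => t H tI.
  apply: ae_imp (H tI) => x {}H Kx; apply: H => Kx'; apply: Kx.
  exact: subset_closure.
have init' : {ae lebesgue_rV d, forall x, K x -> vc x tau1 <= uc x tau1}.
  by move: init; apply: ae_imp => x H Kx; rewrite /vc /uc !cutE//; exact: H.
have weak f P : weak_ineq P s p Omega t1 t2 f -> forall a b zeta,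
    tau1 <= a -> a < b -> b <= tau2 -> test_function s p K0 K1 C M zeta ->
    P (weak_pairing s p K0 (slab_cut tau1 tau2 f) a b zeta).
  move=> wf a b zeta ha hab hb test.
  rewrite -(static_weak_form s p K0 zeta tau1 tau2 a b f ha hab hb).
  apply: wf => //.
  - exact: lt_le_trans ha.
  - exact: le_trans bt2.
  - exact: (static_Lp_Wsp0 s0 p2 C0 M0 cK1 K01 kC test).
  - exact: (static_H1_L2 test a b hab).
  - by apply: aeW => z _; have [_ _ + _ _] := test; exact.
have [muc _ _ _ _] := bu; have [mvc _ _ _ _] := bv.
have small : forall e, 0 < e -> \forall h \near 0^'+, forall t, tau1 <= t <= tau1 + h ->
    (excess_mass K0 uc vc t <= e%:E)%E.
  have mK0 := compact_measurable_rV K0 cK0.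
  have inc f e : solution_space s p Omega t1 t2 f -> 0 < e ->
      \forall h \near 0^'+, forall t, tau1 <= t <= tau1 + h ->
      (\int[lebesgue_rV d]_(x in K0)
        ((slab_cut tau1 tau2 f x t - slab_cut tau1 tau2 f x tau1) ^+ 2)%:E <= e%:E)%E.
    move=> sol e0; have [H _ _] := sol _ _ t1a ab bt2.
    have near_b : \forall h \near 0^'+, h < tau2 - tau1.
      by apply: nbhs_right_lt; rewrite subr_gt0.
    move: near_b (C_L2_increment _ ab e0 (H K0 cK0 KO)); apply: filterS2 => h hb Hh t th.
    have tI : t \in `[tau1, tau2].
      move: th => /andP[at_ tah]; rewrite in_itv /= at_ (le_trans tah)//.
      by rewrite addrC -lerBrDr ltW.
    by under eq_integral do rewrite !cutE//; exact: Hh.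
  apply: (excess_mass_small K tau1 tau2 uc vc mK0 ab _ _ _ _ init' outT).
  - by move=> t; exact (@measurable_fun_pair1 _ _ _ _ (measurableTypeR R) _ _ t muc).
  - by move=> t; exact (@measurable_fun_pair1 _ _ _ _ (measurableTypeR R) _ _ t mvc).
  - by move=> e; exact: inc.
  - by move=> e; exact: inc.
have vanish := excess_mass_vanish s0 p2 C0 M0 ab cK0 cK1 K01 kC bu bv outT0
  (weak v _ wv) (weak u _ wu) small.
pose g (z : 'rV[R]_d * measurableTypeR R) : \bar R :=
  (Num.max (vc z.1 z.2 - uc z.1 z.2) 0 ^+ 2)%:E.
have mg : measurable_fun setT g.
  apply/measurable_EFinP; apply: measurable_funX; apply: measurable_maxr => //.
  exact: measurable_funB.
have g0 z : (0 <= g z)%E by rewrite lee_fin sqr_ge0.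
have := prod_ae_of_integral_eq0 (m1 := lebesgue_rV d) (m2 := lebesgue_measure) (f := g)
  (compact_measurable_rV K0 cK0)
  (measurable_itv `[tau1, tau2]) mg g0 vanish.
apply: ae_imp => z H Kz; rewrite in_itv /= => tI.
have [/eqP] := H (subset_closure Kz) (oc _ tI).
rewrite sqrf_eq0 => /eqP max0.
have : vc z.1 z.2 - uc z.1 z.2 <= 0 by rewrite -max0 le_max lexx.
by rewrite subr_le0 /vc /uc !cutE ?oc.
Qed.
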